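(* Let $p$ be a prime number and let $(K,\mathcal{O},k)$ be a $p$-modular system with $k$ a perfect field. Let $G$ and $H$ be finite groups and let $n$ be a positive integer that is a multiple of both $|G|$ and $|H|$. Let $b$ and $c$ be block idempotents of $\mathcal{O}G$ and $\mathcal{O}H$ respectively. Suppose that $\mathcal{O}$ is absolutely unramified, i.e. $J(\mathcal{O})=p\mathcal{O}$. If there is a virtual Morita equivalence between $\mathcal{O}Gb$ and $\mathcal{O}Hc$ given by a virtual bimodule $X\in\mathcal{P}(\mathcal{O}Gb,\mathcal{O}Hc)$ and its dual $X^\vee$, then there is a bijection $I:\mathrm{IBr}(G,b)\to\mathrm{IBr}(H,c)$ satisfying ${}^\sigma I(\varphi)=I({}^\sigma\varphi)$ for all $\varphi\in\mathrm{IBr}(G,b)$ and all $\sigma\in\mathcal{H}_{n,k}$.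
   Context: A $p$-modular system $(K,\mathcal{O},k)$ consists of a complete discrete valuation ring $\mathcal{O}$ with residue field $k=\mathcal{O}/J(\mathcal{O})$ of characteristic $p$ (where $J(\mathcal{O})$ is the maximal ideal) and field of fractions $K$ of characteristic zero. No assumption is made that $K$ or $k$ is a splitting field for the groups involved. A block idempotent of $\mathcal{O}G$ is a primitive idempotent of the center $Z(\mathcal{O}G)$; $\bar b$ denotes the image of $b$ in $kG$. Virtual Morita equivalence. For $\mathcal{O}$-algebras $A,B$ that are finitely generated free as $\mathcal{O}$-modules, $\mathcal{P}(A,B)$ denotes the Grothendieck group, with respect to split exact sequences (i.e. direct sums), of the category of $(A,B)$-bimodules which are finitely generated projective as left $A$-modules and as right $B$-modules. Its elements are called virtual bimodules. The tensor product of bimodules induces biadditive maps $-\otimes_B-:\mathcal{P}(A,B)\times\mathcal{P}(B,C)\to\mathcal{P}(A,C)$. Elements $X\in\mathcal{P}(A,B)$ and $Y\in\mathcal{P}(B,A)$ give a virtual Morita equivalence between $A$ and $B$ if $X\otimes_B Y=[A]$ in $\mathcal{P}(A,A)$ and $Y\otimes_A X=[B]$ in $\mathcal{P}(B,B)$. For symmetric algebras $A,B$ (such as $\mathcal{O}Gb$ and $\mathcal{O}Hc$), the dual $X^\vee\in\mathcal{P}(B,A)$ of $X\in\mathcal{P}(A,B)$ is the image of $X$ under the additive extension of $[M]\mapsto[\mathrm{Hom}_{\mathcal{O}}(M,\mathcal{O})]$. The groups $\mathcal{H}_n$ and $\mathcal{H}_{n,k}$. Let $\bar K$ be an algebraic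 closure of $K$, let $\mathbb{Q}_n$ be the $n$-th cyclotomic subfield of $\bar K$, let $n_{p'}$ be the $p'$-part of $n$, and let $k'$ be a splitting field of the polynomial $x^{n_{p'}}-1$ over $k$. $\mathcal{H}_n$ is the subgroup of $\mathrm{Gal}(\mathbb{Q}_n/\mathbb{Q})$ consisting of those $\alpha$ for which there is a non-negative integer $u$ such that $\alpha(\delta)=\delta^{p^u}$ for all $n_{p'}$-roots of unity $\delta$ in $\mathbb{Q}_n$. $\mathcal{H}_{n,k}$ is the subgroup of $\mathcal{H}_n$ consisting of those $\alpha$ for which there exist a non-negative integer $u$ and an element $\tau\in\mathrm{Gal}(k'/k)$ such that $\alpha(\delta)=\delta^{p^u}$ for all $n_{p'}$-roots of unity $\delta$ in $\mathbb{Q}_n$ and $\tau(\eta)=\eta^{p^u}$ for all $n_{p'}$-roots of unity $\eta$ in $k'$. (This is independent of the choice of $k'$.) Brauer characters. $\mathrm{IBr}(G)$ is the set of irreducible Brauer characters of $G$, viewed as functions from the set of $p$-regular elements of $G$ to $\bar K$ (eigenvalues, which are roots of unity of order prime to $p$, being lifted to the roots of unity of order prime to $p$ in $\bar K$ via reduction modulo the maximal ideal in an extension of $\mathcal{O}$ inside $\bar K$). $\mathrm{IBr}(G,b)$ is the subset of Brauer characters of the simple $k''Gb$-modules, for any sufficiently large field $k''$ containing $k$. The group $\mathcal{H}_{n,k}$ acts on $\mathrm{IBr}(G,b)$ by ${}^\sigma\varphi(g)=\sigma(\varphi(g))$ for $\varphi\in\mathrm{IBr}(G,b)$, $\sigma\in\mathcal{H}_{n,k}$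 and $g\in G$ $p$-regular; likewise for $\mathrm{IBr}(H,c)$. *)

(* Defs.v *)
From HB Require Import structures.
From mathcomp Require Import all_boot all_order all_algebra all_fingroup
  all_solvable all_field all_character.
From mathcomp Require Import generic_quotient boolp classical_sets functions.

Set Implicit Arguments.
Unset Strict Implicit.
Unset Printing Implicit Defensive.

Import GRing.Theory.
Local Open Scope ring_scope.
Local Open Scope quotient_scope.

Section ModularSystems.

Definition maximal_ideal (R : comNzRingType) (S : {pred R}) : Prop :=
  idealr_closed S /\
  forall T : {pred R}, idealr_closed T -> {subset S <= T} -> T =i S.

Definition jacobson (R : comNzRingType) (a : R) : Prop :=
  forall S : {pred R}, maximal_ideal S -> a \in S.

Definition generates_jacobson (R : comNzRingType) (t : R) : Prop :=
  forall a, jacobson a <-> exists y, a = y * t.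

(* A principal ideal domain, not a field, with exactly one maximal ideal;
   [idealr_closed] singles out the proper ideals. *)
Definition discrete_valuation_ring (R : idomainType) : Prop :=
  (forall S : {pred R}, idealr_closed S ->
     exists a, forall x, x \in S <-> exists y, x = y * a) /\
  (exists S : {pred R}, [/\ maximal_ideal S, exists2 x, x \in S & x != 0 &
     forall T : {pred R}, maximal_ideal T -> T =i S]).

(* Completeness for the J(R)-adic topology, J(R)^i being generated by t^i. *)
Definition jacobson_complete (R : idomainType) : Prop :=
  forall t : R, generates_jacobson t ->
  forall u : nat -> R, (forall i, exists y, u i.+1 - u i = y * t ^+ i) ->
  exists a, forall i, exists y, a - u i = y * t ^+ i.

Record p_modular_system (p : nat) (O : idomainType) (K k : fieldType)
    (iota : {rmorphism O -> K}) (pi : {rmorphism O -> k}) : Prop := {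
  pms_dvr : discrete_valuation_ring O;
  pms_complete : jacobson_complete O;
  pms_frac_inj : injective iota;
  pms_frac : forall x : K, exists a d : O, d != 0 /\ x = iota a / iota d;
  pms_char0 : [pchar K] =i pred0;
  pms_residue_surj : forall x : k, exists a, pi a = x;
  pms_residue_ker : forall a, pi a = 0 <-> jacobson a;
  pms_charp : p \in [pchar k] }.

(* For a field of characteristic p. *)
Definition perfect_field (p : nat) (k : fieldType) : Prop :=
  forall x : k, exists y, y ^+ p = x.

Definition algebraic_closure (K : fieldType) (Kbar : closedFieldType)
    (j : {rmorphism K -> Kbar}) : Prop :=
  forall x, algebraicOver j x.

(* [red] is the reduction modulo the maximal ideal of the integral closure of
   O in Kbar, with values in its residue field kbar; only the values of [red]
   at integral elements are meaningful.  As O is complete that integral closure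
   is local, and kbar is an algebraic closure of the residue field of O. *)
Record reduction (O : idomainType) (Kbar kbar : closedFieldType)
    (emb : O -> Kbar) (red : Kbar -> kbar) : Prop := {
  red1 : red 1 = 1;
  redD : forall x y, integralOver emb x -> integralOver emb y ->
    red (x + y) = red x + red y;
  redM : forall x y, integralOver emb x -> integralOver emb y ->
    red (x * y) = red x * red y;
  red_surj : forall e, exists2 x, integralOver emb x & red x = e }.

End ModularSystems.

Section GroupAlgebra.
Variables (R : comNzRingType) (G : finGroupType).

(* {ffun G -> R} itself already carries the pointwise product. *)
Definition group_algebra : Type := {ffun G -> R}.

HB.instance Definition _ := GRing.Lmodule.copy group_algebra {ffun G -> R^o}.

Definition coefg (x : group_algebra) (g : G) : R := (x : {ffun G -> R}) g.

Definition ga_one : group_algebra := [ffun g : G => (g == 1%g)%:R].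
Definition ga_mul (x y : group_algebra) : group_algebra :=
  [ffun g => \sum_(h : G) coefg x h * coefg y (h^-1 * g)%g].

Lemma coefgP (x y : group_algebra) : coefg x =1 coefg y -> x = y.
Proof. by move=> e; apply/ffunP. Qed.

Lemma coefgD (x y : group_algebra) g : coefg (x + y) g = coefg x g + coefg y g.
Proof. by rewrite /coefg ffunE. Qed.

Lemma coefgZ a (x : group_algebra) g : coefg (a *: x) g = a * coefg x g.
Proof. by rewrite /coefg ffunE. Qed.

Lemma coefgM (x y : group_algebra) g :
  coefg (ga_mul x y) g = \sum_(h : G) coefg x h * coefg y (h^-1 * g)%g.
Proof. by rewrite {1}/coefg ffunE. Qed.

Lemma coefg1 g : coefg ga_one g = (g == 1%g)%:R.
Proof. by rewrite /coefg ffunE. Qed.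

Fact ga_mulA : associative ga_mul.
Proof.
move=> x y z; apply: coefgP => g; rewrite !coefgM.
under eq_bigr do rewrite coefgM mulr_sumr.
under [RHS]eq_bigr do rewrite coefgM mulr_suml.
rewrite [RHS]exchange_big /=; apply: eq_bigr => h _.
rewrite (reindex_inj (mulgI h^-1%g)) /=; apply: eq_bigr => l _.
by rewrite mulrA invMg invgK -mulgA mulKVg.
Qed.

Fact ga_mul1r : left_id ga_one ga_mul.
Proof.
move=> x; apply: coefgP => g; rewrite coefgM (bigD1 1%g) //= big1 => [|h nh1].
  by rewrite coefg1 eqxx mul1r invg1 mul1g addr0.
by rewrite coefg1 (negPf nh1) mul0r.
Qed.

Fact ga_mulr1 : right_id ga_one ga_mul.
Proof.
move=> x; apply: coefgP => g; rewrite coefgM (bigD1 g) //= big1 => [|h nhg].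
  by rewrite coefg1 mulVg eqxx mulr1 addr0.
by rewrite coefg1 -(inj_eq (mulgI h)) mulKVg mulg1 eq_sym (negPf nhg) mulr0.
Qed.

Fact ga_mulDl : left_distributive ga_mul +%R.
Proof.
move=> x y z; apply: coefgP => g; rewrite coefgD !coefgM -big_split /=.
by apply: eq_bigr => h _; rewrite coefgD mulrDl.
Qed.

Fact ga_mulDr : right_distributive ga_mul +%R.
Proof.
move=> x y z; apply: coefgP => g; rewrite coefgD !coefgM -big_split /=.
by apply: eq_bigr => h _; rewrite coefgD mulrDr.
Qed.

Fact ga_one_neq0 : ga_one != 0.
Proof.
apply/eqP => /(congr1 (coefg^~ 1%g)); rewrite coefg1 eqxx /coefg ffunE.
by move/eqP; rewrite oner_eq0.
Qed.

HB.instance Definition _ := GRing.Zmodule_isNzRing.Build group_algebra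
  ga_mulA ga_mul1r ga_mulr1 ga_mulDl ga_mulDr ga_one_neq0.

Fact ga_scalerAl a (x y : group_algebra) : a *: (x * y) = a *: x * y.
Proof.
apply: coefgP => g; rewrite coefgZ !coefgM mulr_sumr.
by apply: eq_bigr => h _; rewrite coefgZ mulrA.
Qed.

HB.instance Definition _ :=
  GRing.Lmodule_isLalgebra.Build R group_algebra ga_scalerAl.

Fact ga_scalerAr a (x y : group_algebra) : a *: (x * y) = x * (a *: y).
Proof.
apply: coefgP => g; rewrite coefgZ !coefgM mulr_sumr.
by apply: eq_bigr => h _; rewrite coefgZ mulrCA.
Qed.

HB.instance Definition _ :=
  GRing.Lalgebra_isAlgebra.Build R group_algebra ga_scalerAr.

End GroupAlgebra.

Section Blocks.
Variables (R : comNzRingType) (G : finGroupType).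
Local Notation RG := (group_algebra R G).

Definition central (x : RG) : Prop := forall y, x * y = y * x.

Definition central_idempotent (e : RG) : Prop := central e /\ e * e = e.

(* Primitive idempotents of Z(RG). *)
Definition block_idempotent (b : RG) : Prop :=
  [/\ central_idempotent b, b != 0 &
    forall e f : RG, central_idempotent e -> central_idempotent f ->
      e * f = 0 -> b = e + f -> e = 0 \/ f = 0].

Variables (b : RG) (hb : block_idempotent b).

(* The algebra RGb, as the set of x in RG with bx = x; its unit is b. *)
Definition in_block (_ : block_idempotent b) : {pred RG} :=
  fun x => b * x == x.

Let bC : central b. Proof. by case: hb => -[]. Qed.
Let bb : b * b = b. Proof. by case: hb => -[]. Qed.

Fact in_block_submod : subsemimod_closed (in_block hb).
Proof.
split=> [|a x]; first split=> [|x y].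
- by rewrite unfold_in mulr0.
- by rewrite !unfold_in mulrDr => /eqP-> /eqP->.
- by rewrite !unfold_in -scalerAr => /eqP->.
Qed.

HB.instance Definition _ :=
  GRing.isSubmodClosed.Build R RG (in_block hb) in_block_submod.

Definition block_algebra : Type := {x : RG | x \in in_block hb}.
HB.instance Definition _ := Choice.on block_algebra.
HB.instance Definition _ := SubType.on block_algebra.
HB.instance Definition _ :=
  [SubChoice_isSubLmodule of block_algebra by <:].

Fact block_oneP : b \in in_block hb.
Proof. by rewrite unfold_in bb. Qed.
Fact block_mulP (x y : block_algebra) : val x * val y \in in_block hb.
Proof. by rewrite unfold_in mulrA (eqP (valP x)). Qed.

Definition block_one : block_algebra := exist _ b block_oneP.
Definition block_mul (x y : block_algebra) : block_algebra :=
  exist _ (val x * val y) (block_mulP x y).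

Fact block_mulA : associative block_mul.
Proof. by move=> x y z; apply: val_inj; rewrite /= mulrA. Qed.
Fact block_mul1r : left_id block_one block_mul.
Proof. by move=> x; apply: val_inj; rewrite /= (eqP (valP x)). Qed.
Fact block_mulr1 : right_id block_one block_mul.
Proof. by move=> x; apply: val_inj; rewrite /= -bC (eqP (valP x)). Qed.
Fact block_mulDl : left_distributive block_mul +%R.
Proof. by move=> x y z; apply: val_inj; rewrite /= mulrDl. Qed.
Fact block_mulDr : right_distributive block_mul +%R.
Proof. by move=> x y z; apply: val_inj; rewrite /= mulrDr. Qed.
Fact block_one_neq0 : block_one != 0.
Proof. by rewrite -val_eqE /=; case: hb. Qed.

HB.instance Definition _ := GRing.Zmodule_isNzRing.Build block_algebra
  block_mulA block_mul1r block_mulr1 block_mulDl block_mulDr block_one_neq0.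

Fact block_scalerAl a (x y : block_algebra) : a *: (x * y) = a *: x * y.
Proof. by apply: val_inj; rewrite /= scalerAl. Qed.
HB.instance Definition _ :=
  GRing.Lmodule_isLalgebra.Build R block_algebra block_scalerAl.
Fact block_scalerAr a (x y : block_algebra) : a *: (x * y) = x * (a *: y).
Proof. by apply: val_inj; rewrite /= scalerAr. Qed.
HB.instance Definition _ :=
  GRing.Lalgebra_isAlgebra.Build R block_algebra block_scalerAr.

End Blocks.

Section Projective.
Variables (S : nzRingType) (P : lmodType S).

Definition finitely_generated : Prop :=
  exists (d : nat) (e : 'I_d -> P), forall x, exists c : 'I_d -> S,
    x = \sum_i c i *: e i.

Definition projective : Prop :=
  forall (U V : lmodType S) (f : {linear U -> V}) (g : {linear P -> V}),
    (forall v, exists u, f u = v) ->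
    exists h : {linear P -> U}, forall x, f (h x) = g x.

End Projective.

Section Bimodules.
Variable O : comNzRingType.

Lemma lin_addr (U V : lmodType O) (f : U -> V) : linear f -> {morph f : x y / x + y}.
Proof. by move=> lf x y; have := lf 1 x y; rewrite !scale1r. Qed.

Lemma lin_zero (U V : lmodType O) (f : U -> V) : linear f -> f 0 = 0.
Proof.
move=> lf; apply: (addrI (f 0)).
by rewrite -(lin_addr lf) !addr0.
Qed.

Lemma lin_scale (U V : lmodType O) (f : U -> V) a x :
  linear f -> f (a *: x) = a *: f x.
Proof. by move=> lf; have := lf a x 0; rewrite !addr0 lin_zero // addr0. Qed.

Record bimodule_axioms (A B : algType O) (M : lmodType O)
    (l : A -> M -> M) (r : M -> B -> M) : Prop := BimoduleAxioms {
  bim_linear_l : forall a, linear (l a);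
  bim_linear_al : forall m, linear (l^~ m);
  bim_1l : forall m, l 1 m = m;
  bim_Ml : forall a a' m, l (a * a') m = l a (l a' m);
  bim_linear_r : forall b, linear (r^~ b);
  bim_linear_br : forall m, linear (r m);
  bim_r1 : forall m, r m 1 = m;
  bim_rM : forall b b' m, r m (b * b') = r (r m b) b';
  bim_lr : forall a m b, l a (r m b) = r (l a m) b }.

Record bimodule (A B : algType O) := Bimodule {
  bimodule_sort :> lmodType O;
  lact : A -> bimodule_sort -> bimodule_sort;
  ract : bimodule_sort -> B -> bimodule_sort;
  bimoduleP : bimodule_axioms lact ract }.

Section Restriction.
Variables (A B : algType O) (M : bimodule A B).

Definition left_restr : Type := M.
HB.instance Definition _ := GRing.Zmodule.on left_restr.

Fact left_restr_A a a' (m : left_restr) : lact a (lact a' m) = lact (a * a') m.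
Proof. by rewrite (bim_Ml (bimoduleP M)). Qed.
Fact left_restr_1 : left_id 1 (@lact A B M : A -> left_restr -> left_restr).
Proof. exact: (bim_1l (bimoduleP M)). Qed.
Fact left_restr_Dr :
  right_distributive (@lact A B M : A -> left_restr -> left_restr) +%R.
Proof.
by move=> a; exact: lin_addr (bim_linear_l (bimoduleP M) a).
Qed.
Fact left_restr_Dl (m : left_restr) :
  {morph (fun a => lact a m : left_restr) : a a' / a + a'}.
Proof.
exact: lin_addr (bim_linear_al (bimoduleP M) m).
Qed.
HB.instance Definition _ := GRing.Zmodule_isLmodule.Build A left_restr
  left_restr_A left_restr_1 left_restr_Dr left_restr_Dl.

Definition right_restr : Type := M.
HB.instance Definition _ := GRing.Zmodule.on right_restr.
Definition right_scale (b : B^c) (m : right_restr) : right_restr := ract m b.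

Fact right_restr_A (b b' : B^c) (m : right_restr) :
  right_scale b (right_scale b' m) = right_scale (b * b') m.
Proof. by rewrite /right_scale -(bim_rM (bimoduleP M)). Qed.
Fact right_restr_1 : left_id 1 right_scale.
Proof. exact: (bim_r1 (bimoduleP M)). Qed.
Fact right_restr_Dr : right_distributive right_scale +%R.
Proof.
by move=> b; exact: lin_addr (bim_linear_r (bimoduleP M) b).
Qed.
Fact right_restr_Dl m : {morph right_scale^~ m : b b' / b + b'}.
Proof.
exact: lin_addr (bim_linear_br (bimoduleP M) m).
Qed.
HB.instance Definition _ := GRing.Zmodule_isLmodule.Build B^c right_restr
  right_restr_A right_restr_1 right_restr_Dr right_restr_Dl.

(* Finitely generated projective on both sides: the objects of the category
   whose Grothendieck group is P(A,B). *)
Definition biprojective : Prop :=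
  [/\ finitely_generated left_restr, projective left_restr,
      finitely_generated right_restr & projective right_restr].

End Restriction.

Definition bimodule_iso (A B : algType O) (M N : bimodule A B) : Prop :=
  exists f : {linear M -> N}, [/\ bijective f,
    forall a m, f (lact a m) = lact a (f m) &
    forall m b, f (ract m b) = ract (f m) b].

Section Regular.
Variable A : algType O.
Fact regular_axioms : bimodule_axioms (fun a x : A => a * x) (fun x a : A => x * a).
Proof.
split=> *.
- by move=> k x y; rewrite mulrDr scalerAr.
- by move=> k x y; rewrite mulrDl scalerAl.
- exact: mul1r.
- by rewrite mulrA.
- by move=> k x y; rewrite mulrDl scalerAl.
- by move=> k x y; rewrite mulrDr scalerAr.
- exact: mulr1.
- exact: mulrA.
- exact: mulrA.
Qed.
Definition regular_bimodule : bimodule A A := Bimodule regular_axioms.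
End Regular.

Section DirectSum.
Variables (A B : algType O) (M N : bimodule A B).
Definition sum_lact (a : A) (x : M * N) : M * N := (lact a x.1, lact a x.2).
Definition sum_ract (x : M * N) (b : B) : M * N := (ract x.1 b, ract x.2 b).
Fact sum_axioms : bimodule_axioms sum_lact sum_ract.
Proof.
have [a1 a2 a3 a4 a5 a6 a7 a8 a9] := bimoduleP M.
have [b1 b2 b3 b4 b5 b6 b7 b8 b9] := bimoduleP N.
split.
- by move=> a k [x x'] [y y']; congr pair; rewrite /= ?a1 ?b1.
- by move=> [x x'] k a a'; congr pair; rewrite /= ?a2 ?b2.
- by move=> [x x']; rewrite /sum_lact /= a3 b3.
- by move=> a a' [x x']; rewrite /sum_lact /= a4 b4.
- by move=> b k [x x'] [y y']; congr pair; rewrite /= ?a5 ?b5.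
- by move=> [x x'] k b b'; congr pair; rewrite /= ?a6 ?b6.
- by move=> [x x']; rewrite /sum_ract /= a7 b7.
- by move=> b b' [x x']; rewrite /sum_ract /= a8 b8.
- by move=> a [x x'] b; rewrite /sum_lact /sum_ract /= a9 b9.
Qed.
Definition bimodule_sum : bimodule A B := Bimodule sum_axioms.
End DirectSum.

Section Dual.
Variables (A B : algType O) (M : bimodule A B).

Definition dual_pred : {pred M -> O^o} := fun f => `[< linear f >].

Fact dual_submod : subsemimod_closed dual_pred.
Proof.
split=> [|a f]; first split=> [|f g].
- by apply/asboolP => k x y; rewrite /= scaler0 addr0.
- move=> /asboolP lf /asboolP lg; apply/asboolP => k x y.
  by rewrite /= !fctE lf lg scalerDr addrACA.
- move=> /asboolP lf; apply/asboolP => k x y.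
  by rewrite /= !fctE lf scalerDr !scalerA mulrC.
Qed.
HB.instance Definition _ :=
  GRing.isSubmodClosed.Build O (M -> O^o) dual_pred dual_submod.

Definition dual_sort : Type := {f : M -> O^o | f \in dual_pred}.
HB.instance Definition _ := Choice.on dual_sort.
HB.instance Definition _ := SubType.on dual_sort.
HB.instance Definition _ := [SubChoice_isSubLmodule of dual_sort by <:].

Fact dual_lactP (b : B) (f : dual_sort) :
  (fun m => val f (ract m b)) \in dual_pred.
Proof.
apply/asboolP => k x y; rewrite (bim_linear_r (bimoduleP M)).
by have /asboolP -> := valP f.
Qed.
Fact dual_ractP (f : dual_sort) (a : A) :
  (fun m => val f (lact a m)) \in dual_pred.
Proof.
apply/asboolP => k x y; rewrite (bim_linear_l (bimoduleP M)).
by have /asboolP -> := valP f.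
Qed.

Definition dual_lact (b : B) (f : dual_sort) : dual_sort :=
  exist _ (fun m => val f (ract m b)) (dual_lactP b f).
Definition dual_ract (f : dual_sort) (a : A) : dual_sort :=
  exist _ (fun m => val f (lact a m)) (dual_ractP f a).

Fact dual_axioms : bimodule_axioms dual_lact dual_ract.
Proof.
have [a1 a2 a3 a4 a5 a6 a7 a8 a9] := bimoduleP M.
split.
- by move=> b k f g; apply: val_inj.
- move=> f k b b'; apply: val_inj; apply/funext => m /=.
  by rewrite a6; have /asboolP -> := valP f.
- by move=> f; apply: val_inj; apply/funext => m /=; rewrite a7.
- by move=> b b' f; apply: val_inj; apply/funext => m /=; rewrite a8.
- by move=> a k f g; apply: val_inj.
- move=> f k a a'; apply: val_inj; apply/funext => m /=.
  by rewrite a2; have /asboolP -> := valP f.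
- by move=> f; apply: val_inj; apply/funext => m /=; rewrite a3.
- by move=> a a' f; apply: val_inj; apply/funext => m /=; rewrite a4.
- by move=> b f a; apply: val_inj; apply/funext => m /=; rewrite a9.
Qed.
(* Hom_O(M, O), with (b . f . a)(m) = f (a . m . b). *)
Definition bimodule_dual : bimodule B A := Bimodule dual_axioms.
End Dual.

Section Tensor.
Variables (A B C : algType O) (M : bimodule A B) (N : bimodule B C).

Record balanced (W : zmodType) (f : M -> N -> W) : Prop := Balanced {
  balDl : forall m m' n, f (m + m') n = f m n + f m' n;
  balDr : forall m n n', f m (n + n') = f m n + f m n';
  balM : forall m b n, f (ract m b) n = f m (lact b n) }.

Definition bal_sum (W : zmodType) (f : M -> N -> W) (s : seq (M * N)) : W :=
  \sum_(x <- s) f x.1 x.2.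

(* M (x)_B N: formal sums [:: (m1, n1); ...; (mr, nr)], standing for
   m1 (x) n1 + ... + mr (x) nr, two of them being identified when every
   B-balanced biadditive map takes the same value on both.  This is the
   quotient of the free abelian group on M * N by the defining relations of
   the tensor product, presented through its universal property. *)
Definition tensor_rel : rel (seq (M * N)) := fun s t =>
  `[< forall (W : zmodType) (f : M -> N -> W), balanced f ->
        bal_sum f s = bal_sum f t >].

Fact tensor_rel_refl : reflexive tensor_rel.
Proof. by move=> s; apply/asboolP. Qed.
Fact tensor_rel_sym : symmetric tensor_rel.
Proof.
by move=> s t; apply/asboolP/asboolP => e W f bf; rewrite (e W f bf).
Qed.
Fact tensor_rel_trans : transitive tensor_rel.
Proof.
move=> s t u /asboolP e /asboolP e'; apply/asboolP => W f bf.
by rewrite (e W f bf) (e' W f bf).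
Qed.
Canonical tensor_equiv :=
  EquivRel tensor_rel tensor_rel_refl tensor_rel_sym tensor_rel_trans.

Definition tensor_sort : Type := {eq_quot tensor_rel}.
HB.instance Definition _ := Choice.on tensor_sort.
HB.instance Definition _ := EqQuotient.on tensor_sort.

Definition tens (s : seq (M * N)) : tensor_sort := \pi_tensor_sort s.

Lemma tensP s t :
  (forall (W : zmodType) (f : M -> N -> W), balanced f ->
     bal_sum f s = bal_sum f t) <-> tens s = tens t.
Proof.
split=> [e|/eqquotP/asboolP //].
by apply/eqquotP/asboolP.
Qed.

Lemma tens_ind (P : tensor_sort -> Prop) :
  (forall s, P (tens s)) -> forall x, P x.
Proof. by move=> Ps x; rewrite -[x]reprK; apply: Ps. Qed.

Lemma tens_repr s (W : zmodType) (f : M -> N -> W) :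
  balanced f -> bal_sum f (repr (tens s)) = bal_sum f s.
Proof. by move=> bf; apply: (tensP _ _).2 bf; rewrite /tens reprK. Qed.

Lemma bal_sum_cat (W : zmodType) (f : M -> N -> W) s t :
  bal_sum f (s ++ t) = bal_sum f s + bal_sum f t.
Proof. exact: big_cat. Qed.

Lemma bal_sum_map (W : zmodType) (f : M -> N -> W) (h : M * N -> M * N) s :
  bal_sum f (map h s) = bal_sum (fun m n => f (h (m, n)).1 (h (m, n)).2) s.
Proof. by rewrite /bal_sum big_map; apply: eq_bigr => -[]. Qed.

Definition good_map (h : M * N -> M * N) : Prop :=
  forall (W : zmodType) (f : M -> N -> W), balanced f ->
    balanced (fun m n => f (h (m, n)).1 (h (m, n)).2).

Definition tens_map (h : M * N -> M * N) (x : tensor_sort) : tensor_sort :=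
  tens (map h (repr x)).

Lemma tens_mapE h s : good_map h -> tens_map h (tens s) = tens (map h s).
Proof.
by move=> gh; apply/tensP => W f bf; rewrite !bal_sum_map tens_repr //; apply: gh.
Qed.

Lemma bal_sumN (W : zmodType) (f : M -> N -> W) s : balanced f ->
  bal_sum (fun m n => f (- m) n) s = - bal_sum f s.
Proof.
move=> bf; rewrite /bal_sum -sumrN; apply: eq_bigr => x _.
apply/eqP; rewrite -addr_eq0 -(balDl bf) addNr.
by apply/eqP/(addrI (f 0 x.2)); rewrite -(balDl bf) !addr0.
Qed.

Fact good_oppl : good_map (fun x => (- x.1, x.2)).
Proof.
move=> W f bf; split=> [m m' n|m n n'|m b n] /=.
- by rewrite opprD (balDl bf).
- by rewrite (balDr bf).
- rewrite -(balM bf); congr f; rewrite -!scaleN1r.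
  by rewrite (lin_scale _ _ (bim_linear_r (bimoduleP M) b)).
Qed.

Fact good_scale (a : O) : good_map (fun x => (a *: x.1, x.2)).
Proof.
move=> W f bf; split=> [m m' n|m n n'|m b n] /=.
- by rewrite scalerDr (balDl bf).
- by rewrite (balDr bf).
- rewrite -(balM bf); congr f.
  by rewrite (lin_scale _ _ (bim_linear_r (bimoduleP M) b)).
Qed.

Fact good_lact (a : A) : good_map (fun x => (lact a x.1, x.2)).
Proof.
move=> W f bf; split=> [m m' n|m n n'|m b n] /=.
- by rewrite (lin_addr (bim_linear_l (bimoduleP M) a)) (balDl bf).
- by rewrite (balDr bf).
- by rewrite -(balM bf) (bim_lr (bimoduleP M)).
Qed.

Fact good_ract (c : C) : good_map (fun x => (x.1, ract x.2 c)).
Proof.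
move=> W f bf; split=> [m m' n|m n n'|m b n] /=.
- by rewrite (balDl bf).
- by rewrite (lin_addr (bim_linear_r (bimoduleP N) c)) (balDr bf).
- by rewrite (balM bf) (bim_lr (bimoduleP N)).
Qed.

Definition tens_add (x y : tensor_sort) : tensor_sort :=
  tens (repr x ++ repr y).
Definition tens_opp : tensor_sort -> tensor_sort :=
  tens_map (fun x => (- x.1, x.2)).
Definition tens_scale (a : O) : tensor_sort -> tensor_sort :=
  tens_map (fun x => (a *: x.1, x.2)).
Definition tens_lact (a : A) : tensor_sort -> tensor_sort :=
  tens_map (fun x => (lact a x.1, x.2)).
Definition tens_ract (x : tensor_sort) (c : C) : tensor_sort :=
  tens_map (fun x => (x.1, ract x.2 c)) x.

Lemma tens_addE s t : tens_add (tens s) (tens t) = tens (s ++ t).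
Proof. by apply/tensP => W f bf; rewrite !bal_sum_cat !tens_repr. Qed.

Fact tens_addA : associative tens_add.
Proof.
elim/tens_ind=> s; elim/tens_ind=> t; elim/tens_ind=> u.
by rewrite !tens_addE catA.
Qed.
Fact tens_addC : commutative tens_add.
Proof.
elim/tens_ind=> s; elim/tens_ind=> t; rewrite !tens_addE.
by apply/tensP => W f bf; rewrite !bal_sum_cat addrC.
Qed.
Fact tens_add0 : left_id (tens [::]) tens_add.
Proof. by elim/tens_ind=> s; rewrite tens_addE. Qed.
Fact tens_addN : left_inverse (tens [::]) tens_opp tens_add.
Proof.
elim/tens_ind=> s; rewrite /tens_opp tens_mapE; last exact: good_oppl.
rewrite tens_addE; apply/tensP => W f bf.
by rewrite bal_sum_cat bal_sum_map bal_sumN // addNr /bal_sum big_nil.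
Qed.
HB.instance Definition _ := GRing.isZmodule.Build tensor_sort
  tens_addA tens_addC tens_add0 tens_addN.

Lemma tens_cat s t : tens (s ++ t) = tens s + tens t.
Proof. by rewrite -tens_addE. Qed.

Lemma tens_mapD h : good_map h -> {morph tens_map h : x y / x + y}.
Proof.
move=> gh; elim/tens_ind=> s; elim/tens_ind=> t.
by rewrite -tens_cat !tens_mapE // map_cat tens_cat.
Qed.

Fact tens_scaleA a a' x : tens_scale a (tens_scale a' x) = tens_scale (a * a') x.
Proof.
elim/tens_ind: x => s; have g := good_scale.
rewrite /tens_scale !tens_mapE // -map_comp; congr tens.
by apply: eq_map => y /=; rewrite scalerA.
Qed.
Fact tens_scale1 : left_id 1 tens_scale.
Proof.
elim/tens_ind=> s; rewrite /tens_scale tens_mapE; last exact: good_scale.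
by congr tens; rewrite -[RHS]map_id; apply: eq_map => -[m n]; rewrite scale1r.
Qed.
Fact tens_scaleDr : right_distributive tens_scale +%R.
Proof. by move=> a; apply/tens_mapD/good_scale. Qed.
Fact tens_scaleDl x : {morph tens_scale^~ x : a a' / a + a'}.
Proof.
move=> a a'; elim/tens_ind: x => s; have g := good_scale.
rewrite /tens_scale !tens_mapE // -tens_cat; apply/tensP => W f bf.
rewrite bal_sum_cat !bal_sum_map /bal_sum -big_split; apply: eq_bigr => y _ /=.
by rewrite scalerDl (balDl bf).
Qed.
HB.instance Definition _ := GRing.Zmodule_isLmodule.Build O tensor_sort
  tens_scaleA tens_scale1 tens_scaleDr tens_scaleDl.

Lemma tens_scaleE (a : O) s :
  a *: tens s = tens (map (fun x => (a *: x.1, x.2)) s).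
Proof. exact/tens_mapE/good_scale. Qed.

Fact tens_lactE a s :
  tens_lact a (tens s) = tens (map (fun x => (lact a x.1, x.2)) s).
Proof. exact/tens_mapE/good_lact. Qed.
Fact tens_ractE c s :
  tens_ract (tens s) c = tens (map (fun x => (x.1, ract x.2 c)) s).
Proof. exact/tens_mapE/good_ract. Qed.

(* The O-action on M (x)_B N may be computed on either factor. *)
Lemma bal_scale (W : zmodType) (f : M -> N -> W) (k : O) m n : balanced f ->
  f (k *: m) n = f m (k *: n).
Proof.
move=> bf; have [_ _ _ _ _ a6 a7 _ _] := bimoduleP M.
have [_ b2 b3 _ _ _ _ _ _] := bimoduleP N.
by rewrite -{1}[m]a7 -(lin_scale _ _ (a6 m)) (balM bf) (lin_scale _ _ (b2 n)) b3.
Qed.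

Fact tens_axioms : bimodule_axioms tens_lact tens_ract.
Proof.
have [a1 a2 a3 a4 a5 a6 a7 a8 a9] := bimoduleP M.
have [b1 b2 b3 b4 b5 b6 b7 b8 b9] := bimoduleP N.
split.
- move=> a k x y; rewrite [LHS](tens_mapD (good_lact a)); congr (_ + _).
  elim/tens_ind: x => s; rewrite tens_scaleE -/(tens_lact _ _) !tens_lactE.
  rewrite tens_scaleE -!map_comp; congr tens; apply: eq_map => z /=.
  by rewrite (lin_scale _ _ (a1 a)).
- elim/tens_ind=> s k a a'; rewrite !tens_lactE tens_scaleE -tens_cat.
  apply/tensP => W f bf; rewrite bal_sum_cat -map_comp !bal_sum_map /bal_sum.
  by rewrite -big_split; apply: eq_bigr => z _ /=; rewrite a2 (balDl bf).
- elim/tens_ind=> s; rewrite tens_lactE; congr tens.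
  by rewrite -[RHS]map_id; apply: eq_map => -[m n] /=; rewrite a3.
- move=> a a'; elim/tens_ind=> s; rewrite !tens_lactE -map_comp; congr tens.
  by apply: eq_map => z /=; rewrite a4.
- move=> c k x y; rewrite [LHS](tens_mapD (good_ract c)); congr (_ + _).
  elim/tens_ind: x => s; rewrite tens_scaleE -/(tens_ract _ _) !tens_ractE.
  by rewrite tens_scaleE -!map_comp.
- elim/tens_ind=> s k c c'; rewrite !tens_ractE tens_scaleE -tens_cat.
  apply/tensP => W f bf; rewrite bal_sum_cat -map_comp !bal_sum_map /bal_sum.
  rewrite -big_split; apply: eq_bigr => z _ /=.
  by rewrite b6 (balDr bf) bal_scale.
- elim/tens_ind=> s; rewrite tens_ractE; congr tens.
  by rewrite -[RHS]map_id; apply: eq_map => -[m n] /=; rewrite b7.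
- move=> c c'; elim/tens_ind=> s; rewrite !tens_ractE -map_comp; congr tens.
  by apply: eq_map => z /=; rewrite b8.
- move=> a x c; elim/tens_ind: x => s.
  by rewrite tens_ractE !tens_lactE tens_ractE -!map_comp.
Qed.
Definition bimodule_tensor : bimodule A C := Bimodule tens_axioms.
End Tensor.

(* [Virtual M N] stands for [M] - [N]. *)
Record virtual_bimodule (A B : algType O) := Virtual {
  vpos : bimodule A B;
  vneg : bimodule A B }.

Definition in_P (A B : algType O) (X : virtual_bimodule A B) : Prop :=
  biprojective (vpos X) /\ biprojective (vneg X).

(* Equality in P(A,B), i.e. in the group completion of the monoid of
   isomorphism classes of biprojective bimodules under direct sum. *)
Definition eq_P (A B : algType O) (X Y : virtual_bimodule A B) : Prop :=
  exists2 L : bimodule A B, biprojective L &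
    bimodule_iso (bimodule_sum (bimodule_sum (vpos X) (vneg Y)) L)
                 (bimodule_sum (bimodule_sum (vpos Y) (vneg X)) L).

Section ZeroBimodule.
Variables A B : algType O.
Definition zero_lact (_ : A) (m : 'rV[O]_0) := m.
Definition zero_ract (m : 'rV[O]_0) (_ : B) := m.
Fact zero_axioms : bimodule_axioms zero_lact zero_ract.
Proof.
have z (x y : 'rV[O]_0) : x = y by rewrite [x]thinmx0 [y]thinmx0.
by split; repeat move=> ?; apply: z.
Qed.
Definition zero_bimodule : bimodule A B := Bimodule zero_axioms.
End ZeroBimodule.

Definition virtual_class (A B : algType O) (M : bimodule A B) :=
  Virtual M (zero_bimodule A B).

Definition virtual_tensor (A B C : algType O)
    (X : virtual_bimodule A B) (Y : virtual_bimodule B C) :=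
  Virtual (bimodule_sum (bimodule_tensor (vpos X) (vpos Y))
                        (bimodule_tensor (vneg X) (vneg Y)))
          (bimodule_sum (bimodule_tensor (vpos X) (vneg Y))
                        (bimodule_tensor (vneg X) (vpos Y))).

Definition virtual_dual (A B : algType O) (X : virtual_bimodule A B) :=
  Virtual (bimodule_dual (vpos X)) (bimodule_dual (vneg X)).

Definition virtual_Morita (A B : algType O)
    (X : virtual_bimodule A B) (Y : virtual_bimodule B A) : Prop :=
  [/\ in_P X, in_P Y,
      eq_P (virtual_tensor X Y) (virtual_class (regular_bimodule A)) &
      eq_P (virtual_tensor Y X) (virtual_class (regular_bimodule B))].

End Bimodules.

Section Cyclotomic.
Variables (p n : nat) (F : fieldType).

(* The n-th cyclotomic subfield Q_n of F: the smallest subfield containing all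
   n-th roots of unity. *)
Definition cyclotomic_subfield (x : F) : Prop :=
  forall S : {pred F}, divring_closed S ->
    (forall z, z ^+ n = 1 -> z \in S) -> x \in S.

(* Elements of Gal(Q_n / Q), as maps on F of which only the restriction to Q_n
   matters. *)
Record cyclotomic_automorphism (sigma : F -> F) : Prop := {
  cycl_stable : forall x, cyclotomic_subfield x -> cyclotomic_subfield (sigma x);
  cycl_onto : forall y, cyclotomic_subfield y ->
    exists2 x, cyclotomic_subfield x & sigma x = y;
  cycl_D : forall x y, cyclotomic_subfield x -> cyclotomic_subfield y ->
    sigma (x + y) = sigma x + sigma y;
  cycl_M : forall x y, cyclotomic_subfield x -> cyclotomic_subfield y ->
    sigma (x * y) = sigma x * sigma y;
  cycl_Q : forall q : rat, sigma (ratr q) = ratr q }.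

Definition power_on_p'_roots (sigma : F -> F) (u : nat) : Prop :=
  forall delta : F, delta ^+ n`_p^' = 1 -> sigma delta = delta ^+ (p ^ u).

Definition H_n (sigma : F -> F) : Prop :=
  cyclotomic_automorphism sigma /\ exists u, power_on_p'_roots sigma u.

Definition H_nk (k : fieldType) (k' : splittingFieldType k) (sigma : F -> F) :
    Prop :=
  H_n sigma /\
  exists (u : nat) (tau : gal_of {: k'}),
    [/\ tau \in 'Gal({: k'} / 1)%g, power_on_p'_roots sigma u &
        forall eta : k', eta ^+ n`_p^' = 1 -> tau eta = eta ^+ (p ^ u)].

End Cyclotomic.

Section BrauerCharacters.
Variables (p : nat) (O : idomainType) (Kbar kbar : closedFieldType).
Variables (emb : O -> Kbar) (red : Kbar -> kbar).
Variable G : finGroupType.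

Definition p_regular : Type := {g : G | (p^'.-elt g)%g}.
HB.instance Definition _ := SubFinite.on p_regular.

Definition p'_root_of_unity (z : Kbar) : Prop :=
  exists2 m : nat, ~~ (p %| m)%N & z ^+ m = 1.

(* phi g is the sum of the lifts to Kbar of the eigenvalues of rG g, counted
   with multiplicity. *)
Definition is_Brauer_character (d : nat)
    (rG : mx_representation kbar [set: G] d)
    (phi : {ffun p_regular -> Kbar}) : Prop :=
  forall g : p_regular, exists s : seq Kbar,
    [/\ forall z, z \in s -> p'_root_of_unity z,
        char_poly (rG (val g)) = \prod_(z <- s) ('X - (red z)%:P) &
        phi g = \sum_(z <- s) z].

(* A simple kbar G-module belongs to the block b when the image of b in kbar G
   acts on it as the identity. *)
Definition IBr (b : group_algebra O G) : set {ffun p_regular -> Kbar} :=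
  [set phi | exists (d : nat) (rG : mx_representation kbar [set: G] d),
    [/\ mx_irreducible rG,
        \sum_(g : G) red (emb (coefg b g)) *: rG g = 1%:M &
        is_Brauer_character rG phi]].

Definition galois_act (sigma : Kbar -> Kbar)
    (phi : {ffun p_regular -> Kbar}) : {ffun p_regular -> Kbar} :=
  [ffun g => sigma (phi g)].

End BrauerCharacters.

Arguments IBr p {O Kbar kbar} emb red {G} b.

(* Main.v *)
(* A virtual Morita equivalence X induces transfer maps between the trace functions
   of the two algebras: an (A, B)-bimodule with a dual basis (m_i, h_i) over A sends
   f to b |-> sum_i f (h_i (m_i b)).  In characteristic p these maps preserve the
   condition f (a^p) = f (a)^p, and X gives a bijection between the k'-valued trace
   functions with this property on A and on B, commuting with every automorphism of k'
   over k.  On a block algebra the functions in question are exactly the F_p-linear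
   combinations of the irreducible characters of the block, so the permutation
   F_p-modules of the Galois group on the two sets of irreducible Brauer characters
   are isomorphic.  That group acts through the cyclic group generated by a power
   x |-> x^(p^u0) of the Frobenius, and over any field the permutation module of a
   cyclic group determines the permutation action, because it determines the number of
   orbits of every power of the generator. *)
Require Import Defs.
From HB Require Import structures.
From mathcomp Require Import all_boot all_order all_algebra all_fingroup
  all_solvable all_field all_character.
From mathcomp Require Import boolp classical_sets functions.
Import GRing.Theory Num.Theory.
Local Open Scope ring_scope.
Set Implicit Arguments.
Unset Strict Implicit.
Unset Printing Implicit Defensive.

(** * Permutations with equally many cycles in all powers *)

(** The condition f (a^p) = f (a)^p recovers the characters without any splitting hypothesis. It
    makes f vanish on nilpotent elements, so f ignores the radical and lives on a product of matrix
    algebras, where a trace function is c times the trace; testing an idempotent of rank one gives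
    c^p = c. Hence the coefficients lie in F_p, are fixed by Galois automorphisms, and leave only
    finitely many functions, which can be counted: those fixed by the d-th power of a permutation
    number p^(number of its cycles). Transfers preserve the condition because (x + y)^p and x^p +
    y^p have the same value under every trace function with values in characteristic p. Values are
    taken in k', where Gal(k'/k) acts and fixes the scalars coming from O; simple modules are taken
    over kbar, where Burnside's theorem and Schur's lemma apply. An embedding of k' into kbar links
    the two. Since b has coefficients in O, Galois conjugation keeps simple modules inside the
    block. An exponent u realised in Gal(k'/k) has the form l * u0, and the same l serves for G and
    for H. *)

Section PermutationLemma.

(** Reduce [i] modulo the cycle length; a smaller positive power fixing [x] would repeat an entry of
    the duplicate-free trajectory of [x]. *)
Lemma perm_expg_id (T : finType) (s : {perm T}) x i :
  ((s ^+ i)%g x == x) = (#|porbit s x| %| i)%N.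
Proof.
set l := #|porbit s x|.
have l0 : (0 < l)%N by rewrite lt0n card_porbit_neq0.
have idl : (s ^+ l)%g x = x by rewrite permX iter_porbit.
have sx k : (s ^+ (l * k))%g x = x.
  by rewrite expgM permX; elim: k => //= k ->.
rewrite {1}(divn_eq i l) mulnC expgD permM sx /dvdn.
have := ltn_pmod i l0; move: (i %% l)%N => r rl.
apply/eqP/eqP=> [|->]; last by rewrite expg0 perm1.
case: r rl => // r rl e; have := uniq_traject_porbit s x; rewrite -/l.
case: l l0 rl {idl sx} => // l _ rl /andP[/negP[]]; apply/trajectP.
by exists r => //; rewrite -[LHS]e permX iterSr.
Qed.

(** Both sides have the same multiples: l divides d i exactly when l / gcd (l, d) divides i. *)
Lemma card_porbit_expg (T : finType) (s : {perm T}) x d :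
  #|porbit (s ^+ d)%g x| = (#|porbit s x| %/ gcdn #|porbit s x| d)%N.
Proof.
have l0 : (0 < #|porbit s x|)%N by rewrite lt0n card_porbit_neq0.
set l := #|porbit s x| in l0 *; set g := gcdn l d.
have g0 : (0 < g)%N by rewrite gcdn_gt0 l0.
have divE i : (#|porbit (s ^+ d)%g x| %| i)%N = (l %/ g %| i)%N.
  rewrite -perm_expg_id -expgM perm_expg_id -/l.
  have lE := divnK (dvdn_gcdl l d); have dE := divnK (dvdn_gcdr l d).
  rewrite -{1}lE -{3}dE -/g mulnAC dvdn_pmul2r // Gauss_dvdr //.
  by rewrite /coprime -(eqn_pmul2r g0) muln_gcdl mul1n lE dE.
by apply/eqP; rewrite eqn_dvd divE dvdnn -divE dvdnn.
Qed.

Lemma mem_porbits (T : finType) (s : {perm T}) x : porbit s x \in porbits s.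
Proof. exact: imset_f. Qed.

(* Each cycle of length l contributes l terms 1/l. *)
Lemma card_porbits_sum (T : finType) (s : {perm T}) :
  (#|porbits s|%:R = \sum_x (#|porbit s x|%:R)^-1 :> rat).
Proof.
rewrite (partition_big_imset (porbit s)) /= -sum1_card natr_sum.
apply: eq_bigr => _ /imsetP[x _ ->].
rewrite (eq_bigr (fun=> (#|porbit s x|%:R)^-1 : rat)) => [|y /eqP-> //].
rewrite sumr_const -[RHS]mulr_natl.
rewrite (@eq_card _ _ (mem (porbit s x))) => [|y].
  by rewrite mulfV // pnatr_eq0 card_porbit_neq0.
exact: (eq_porbit_mem s y x).
Qed.

Definition perm_invariants (C T : finType) (s : {perm T}) : {set {ffun T -> C}} :=
  [set c : {ffun T -> C} | [forall x, c (s x) == c x]].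

(** An invariant function is constant on cycles, hence a function on the type [Q] of cycles. For [C]
    equal to 'I_p this counts the fixed vectors of the permutation F_p-module. *)
Lemma card_perm_invariants (C T : finType) (s : {perm T}) :
  #|perm_invariants C s| = (#|C| ^ #|porbits s|)%N.
Proof.
pose Q := {O : {set T} | O \in porbits s}.
pose q x : Q := exist (fun O => O \in porbits s) (porbit s x) (mem_porbits s x).
pose h (f : {ffun Q -> C}) : {ffun T -> C} := [ffun x => f (q x)].
have injh : injective h.
  move=> f f' e; apply/ffunP=> -[O hO]; have /imsetP[x _ eO] := hO.
  have := congr1 (fun k : {ffun T -> C} => k x) e; rewrite !ffunE.
  suff -> : q x = exist _ O hO by [].
  by apply: val_inj; rewrite /= eO.
have -> : perm_invariants C s = h @: [set: {ffun Q -> C}]%SET.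
  apply/setP=> c; rewrite inE; apply/forallP/imsetP => [ci | [f _ ->] x].
    have cO x y : porbit s x = porbit s y -> c x = c y.
      move/eqP; rewrite eq_porbit_mem => /porbitP[i ->].
      by elim: i => [|i IH]; rewrite ?expg0 ?perm1 // expgSr permM (eqP (ci _)).
    have rQ (O : Q) : exists x, porbit s x == val O.
      by case: O => O hO; have /imsetP[x _ eO] := hO; exists x; rewrite /= eO.
    exists [ffun O => c (xchoose (rQ O))] => //; apply/ffunP => x; rewrite !ffunE.
    by apply: cO; rewrite (eqP (xchooseP (rQ _))).
  rewrite !ffunE; apply/eqP; congr (f _); apply: val_inj => /=.
  exact: porbit_perm s 1 x.
rewrite card_imset // cardsT card_ffun; congr (_ ^ _)%N.
by rewrite card_sig; apply: eq_card.
Qed.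

(* Since gcd (l, d) is the sum of the totients of the common divisors of l and d,
   induction on d kills all the sums w e of v over the multiples of e, and then v
   vanishes by descending induction. *)
Lemma gcd_sum_eq0 N (v : nat -> rat) :
  (forall d, (0 < d)%N -> \sum_(1 <= l < N) v l * (gcdn l d)%:R = 0) ->
  forall l, (0 < l < N)%N -> v l = 0.
Proof.
move=> v0; pose w e := \sum_(1 <= l < N | (e %| l)%N) v l.
have w0 e : (0 < e)%N -> w e = 0.
  elim/ltn_ind: e => e IH e0.
  have := v0 e e0.
  have gE l : (0 < l)%N ->
      (gcdn l e)%:R = \sum_(i < e.+1 | (i %| e)%N) (i %| l)%:R * (totient i)%:R :> rat.
    move=> l0; rewrite -[gcdn l e]sum_totient_dvd natr_sum.
    have le : (gcdn l e <= e)%N by rewrite dvdn_leq ?dvdn_gcdr.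
    rewrite (big_ord_widen_cond e.+1 (fun i => i %| gcdn l e)%N (fun i => (totient i)%:R)) //.
    rewrite [RHS]big_mkcond [LHS]big_mkcond; apply: eq_bigr => i _.
    rewrite dvdn_gcd ltnS; case: (boolP (i %| l)%N); case: (boolP (i %| e)%N) => //= ie il;
      rewrite ?mul1r ?mul0r //.
    by rewrite dvdn_leq ?gcdn_gt0 ?l0 // dvdn_gcd ie il.
  rewrite (eq_big_nat _ _ (F2 := fun l =>
     \sum_(i < e.+1 | (i %| e)%N) (totient i)%:R * (if (i %| l)%N then v l else 0))); last first.
    move=> l /andP[l0 _]; rewrite gE // mulr_sumr; apply: eq_bigr => i _.
    by case: (i %| l)%N; rewrite ?mul1r ?mul0r ?mulr0 // mulrC.
  rewrite exchange_big /= (bigD1 ord_max) ?dvdnn //= [X in _ + X]big1 => [|i /andP[ie ine]].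
    rewrite addr0 -mulr_sumr -big_mkcond => /eqP; rewrite mulf_eq0 => /orP[|/eqP //].
    by rewrite pnatr_eq0 -leqn0 leqNgt totient_gt0 e0.
  rewrite -mulr_sumr -big_mkcond -[\sum_(_ <= _ < _ | _) _]/(w i) IH ?mulr0 //.
    by rewrite ltn_neqAle -ltnS ltn_ord andbT.
  by rewrite (dvdn_gt0 e0 ie).
suff H k : forall l, (0 < l < N)%N -> (N - l <= k)%N -> v l = 0.
  by move=> l hl; apply: H hl (leqnn _).
elim: k => [|k IH] l /andP[l0 lN] lk.
  by move: lk; rewrite leqn0 subn_eq0 leqNgt lN.
have := w0 l l0; rewrite /w big_mkcond (big_cat_nat (n := l)) ?(ltnW lN) //=.
rewrite [X in X + _]big_nat_cond [X in X + _]big1 ?add0r; last first.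
  move=> i /andP[/andP[i0 il] _]; case: ifP => // li.
  by have := dvdn_leq i0 li; rewrite leqNgt il.
rewrite big_ltn // dvdnn big_nat_cond [X in _ + X]big1 ?addr0 // => i.
rewrite andbT => /andP[li iN]; case: ifP => // _; apply: IH.
  by rewrite iN (leq_ltn_trans _ li).
by rewrite -ltnS (leq_trans _ lk) // ltn_sub2l.
Qed.

(** Match the i-th element of a fibre with the i-th element of the corresponding fibre. This is
    injective in both directions, and finiteness does the rest. *)
Lemma fiber_bijection (T T' : finType) (K : eqType) (k : T -> K) (k' : T' -> K) :
  (forall l, #|[pred x | k x == l]| = #|[pred x | k' x == l]|) ->
  exists2 g : T -> T', bijective g & forall x, k' (g x) = k x.
Proof.
move=> e.
have cast (U V : finType) (a : U -> K) (b : V -> K) :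
    (forall l, #|[pred x | a x == l]| = #|[pred x | b x == l]|) ->
    exists2 g : U -> V, injective g & forall x, b (g x) = a x.
  move=> eab; pose fib (x : U) := enum [pred y | b y == a x].
  pose fiU x := enum [pred y | a y == a x].
  have ltf x : (index x (fiU x) < size (fib x))%N.
    by rewrite -cardE -eab cardE index_mem mem_enum inE.
  (* [nth] needs a default in [V], and only the nonempty fibre of [x] supplies one; it depends on
     [x], hence [set_nth_default] below. *)
  have inhV (x : U) : V by case: (fib x) (ltf x) => // y.
  pose g x := nth (inhV x) (fib x) (index x (fiU x)).
  have kg x : b (g x) = a x.
    by apply/eqP; have := mem_nth (inhV x) (ltf x); rewrite mem_enum inE.
  exists g => // x y exy.
  have exyk : a x = a y by rewrite -kg exy kg.
  have efib : fib y = fib x by rewrite /fib exyk.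
  have efiU : fiU y = fiU x by rewrite /fiU exyk.
  have ltx := ltf x; have := ltf y; rewrite efib efiU => lty.
  move: exy; rewrite /g efib efiU (set_nth_default (inhV x) (inhV y)) //.
  move=> /eqP; rewrite nth_uniq ?enum_uniq // => /eqP ei.
  have xi : x \in fiU x by rewrite mem_enum inE.
  have yi : y \in fiU x by rewrite mem_enum inE exyk.
  by rewrite -(nth_index x xi) ei nth_index.
have [g injg kg] := cast _ _ _ _ e.
have [g' injg' kg'] := cast _ _ _ _ (fun l => esym (e l)).
exists g => //; apply: inj_card_bij injg _.
by apply: leq_card injg'.
Qed.

(* A cycle of length l of s splits into gcd (l, d) cycles of s ^+ d, so the hypothesis
   determines the number of cycles of s of each length. *)
Lemma perm_conjugate (T T' : finType) (s : {perm T}) (t : {perm T'}) :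
  (forall d, #|porbits (s ^+ d)%g| = #|porbits (t ^+ d)%g|) ->
  exists2 g : T -> T', bijective g & forall x, g (s x) = t (g x).
Proof.
move=> e.
pose N := (maxn #|T| #|T'|).+1.
have porb_lt (U : finType) (r : {perm U}) x : (#|U| < N)%N ->
    (0 < #|porbit r x| < N)%N.
  by move=> UN; rewrite lt0n card_porbit_neq0 (leq_ltn_trans (max_card _)).
have TN : (#|T| < N)%N by rewrite ltnS leq_maxl.
have TN' : (#|T'| < N)%N by rewrite ltnS leq_maxr.
pose a (U : finType) (r : {perm U}) l := #|[pred x | #|porbit r x| == l]|.
(* [a U r l] counts the points lying on cycles of length l, so [a / l] is the number of such
   cycles. *)
have aE (U : finType) (r : {perm U}) d : (#|U| < N)%N -> (0 < d)%N ->
  #|porbits (r ^+ d)%g|%:R = \sum_(1 <= l < N) ((a U r l)%:R / l%:R) * (gcdn l d)%:R :> rat.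
  move=> UN d0; rewrite card_porbits_sum.
  under eq_bigr do rewrite card_porbit_expg.
  rewrite big_geq_mkord.
  rewrite (eq_bigr (fun x => ((gcdn #|porbit r x| d)%:R / #|porbit r x|%:R : rat))); last first.
    move=> x _; have l0 : #|porbit r x| != 0%N by rewrite card_porbit_neq0.
    have g0 : (gcdn #|porbit r x| d)%:R != 0 :> rat.
      by rewrite pnatr_eq0 -lt0n gcdn_gt0 d0 orbT.
    rewrite -{4}(divnK (dvdn_gcdl #|porbit r x| d)) natrM invfM mulrCA mulfV ?mulr1 //.
  rewrite (partition_big (fun x => inord #|porbit r x| : 'I_N) (fun i => 0 < i)%N) /=.
    apply: eq_big => // l l0; rewrite (eq_bigr (fun=> ((gcdn l d)%:R / l%:R : rat))).
      rewrite sumr_const -[LHS]mulr_natl mulrAC mulrA; congr (_%:R * _ / _).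
      apply: eq_card => x; rewrite unfold_in /= inordK //.
      by case/andP: (porb_lt _ r x UN).
    move=> x /eqP el; have := inordK (andP (porb_lt _ r x UN)).2.
    by rewrite el => ->.
  by move=> x _; case/andP: (porb_lt _ r x UN) => ? ?; rewrite inordK.
have ea l : a T s l = a T' t l.
  have [/andP[l0 lN]|out] := boolP (0 < l < N)%N; last first.
    rewrite /a !eq_card0 // => x; rewrite !inE; apply/negP=> /eqP el;
      by move: out; rewrite -el porb_lt.
  have := @gcd_sum_eq0 N (fun l => (a T s l)%:R / l%:R - (a T' t l)%:R / l%:R) _ l.
  rewrite l0 lN => /(_ _ isT) H; apply/eqP; rewrite -(eqr_nat rat).
  rewrite -(inj_eq (@mulIf _ (l%:R)^-1 _)) ?invr_eq0 ?pnatr_eq0 -?lt0n //.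
  rewrite -subr_eq0; apply/eqP/H => d d0.
  under eq_bigr do rewrite mulrBl.
  by rewrite sumrB -!aE // e subrr.
(* The cycles themselves are now matched by a length-preserving bijection [w]. *)
pose Q (U : finType) (r : {perm U}) := {O : {set U} | O \in porbits r}.
have eQ l : #|[pred O : Q T s | #|val O| == l]| = #|[pred O : Q T' t | #|val O| == l]|.
  have [->|l0] := eqVneq l 0%N.
    rewrite !eq_card0 // => -[O hO]; have /imsetP[x _ eO] := hO;
      by apply/negbTE; suff: #|O| != 0%N by []; rewrite eO card_porbit_neq0.
  have cQ (U : finType) (r : {perm U}) : (#|[pred O : Q U r | #|val O| == l]| * l)%N = a U r l.
    pose A := [set x | #|porbit r x| == l].
    have -> : a U r l = #|A| by apply: eq_card => x; rewrite !inE.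
    rewrite -sum1_card (partition_big_imset (porbit r)) /=.
    have -> : #|[pred O : Q U r | #|val O| == l]| = #|porbit r @: A|.
      rewrite -(card_imset _ (val_inj : injective (val : Q U r -> _))).
      apply: eq_card => O; apply/imsetP/imsetP => [[[O' hO] h ->]|[x h ->]].
        have /imsetP[x _ eO] := hO; exists x => //.
        have {}h : #|O'| == l by [].
        by rewrite inE -eO.
      exists (exist (fun O => O \in porbits r) (porbit r x) (mem_porbits r x)) => //.
      by move: h; rewrite !inE.
    rewrite -sum_nat_const; apply: eq_bigr => _ /imsetP[x xA ->].
    rewrite sum1_card; have := xA; rewrite inE => /eqP xl; rewrite -xl; apply: eq_card => y.
    rewrite -[RHS]/((y \in A) && (porbit r y == porbit r x)) inE -eq_porbit_mem.
    by case: eqP => [->|]; rewrite ?andbF // xl eqxx.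
  by apply/eqP; rewrite -(@eqn_pmul2r l) ?lt0n // !cQ ea.
have [w bijw cw] := fiber_bijection eQ.
have injw := bij_inj bijw.
pose cl (U : finType) (r : {perm U}) x : Q U r :=
  exist (fun O => O \in porbits r) (porbit r x) (mem_porbits r x).
have rep (U : finType) (r : {perm U}) (O : Q U r) : exists x, porbit r x == val O.
  by case: O => O hO; have /imsetP[x _ eO] := hO; exists x; rewrite /= eO.
pose rp U r O := xchoose (rep U r O).
have rpP U r O : porbit r (rp U r O) = val O by apply/eqP/(xchooseP (rep U r O)).
have ix (x : T) : exists i, (s ^+ i)%g (rp _ s (cl _ s x)) == x.
  have : x \in porbit s (rp _ s (cl _ s x)) by rewrite rpP porbit_id.
  by case/porbitP=> i ei; exists i; rewrite -ei.
(* Each cycle gets a base point, and s^i (base) is sent to t^i (base of the matched cycle). By [gE]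
   the choice of i is irrelevant, because matched cycles have equal length. *)
pose g x := (t ^+ xchoose (ix x))%g (rp _ t (w (cl _ s x))).
have gE x i : (s ^+ i)%g (rp _ s (cl _ s x)) = x -> g x = (t ^+ i)%g (rp _ t (w (cl _ s x))).
  move=> ei; rewrite /g; move: (xchoose _) (xchooseP (ix x)) => j /eqP ej.
  wlog ij : i j ei ej / (i <= j)%N => [H|].
    by case: (leqP i j) => ij; [apply: H | apply/esym/H => //; apply: ltnW].
  rewrite -(subnK ij) expgD permM; congr ((t ^+ i)%g _); apply/eqP; rewrite perm_expg_id.
  rewrite rpP cw -(rpP _ s) -perm_expg_id -(inj_eq (@perm_inj _ (s ^+ i)%g)) -permM -expgD.
  by rewrite subnK // ej ei.
have clg x : porbit t (g x) = val (w (cl _ s x)) by rewrite porbit_perm rpP.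
have gx x : exists i, (s ^+ i)%g (rp _ s (cl _ s x)) = x /\
                      g x = (t ^+ i)%g (rp _ t (w (cl _ s x))).
  by have := xchooseP (ix x) => /eqP ei; exists (xchoose (ix x)).
have injg : injective g.
  move=> x y exy.
  have ew : cl _ s x = cl _ s y by apply/injw/val_inj; rewrite -!clg exy.
  have [i [ei gi]] := gx x; have [j [ej gj]] := gx y; rewrite gi gj -ew in exy.
  rewrite -ew in ej; rewrite -ei -ej {gi gj}.
  wlog ij : i j {ei ej} exy / (i <= j)%N => [H|].
    by case: (leqP i j) => ij; [apply: H | apply/esym/H => //; apply: ltnW].
  move/eqP: exy; rewrite -(subnK ij) !expgD !permM (inj_eq (@perm_inj _ _)) eq_sym perm_expg_id.
  by rewrite rpP cw -(rpP _ s) -perm_expg_id => /eqP ->.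
exists g => [|x].
  (* The case d = 0 of the hypothesis compares the cardinals: the identity has one cycle per
     point. *)
  apply: inj_card_bij injg _; have := e 0%N; rewrite !expg0.
  have c1 (U : finType) : #|porbits (1 : {perm U})%g| = #|U|.
    rewrite card_imset // => x y /eqP; rewrite eq_porbit_mem => /porbitP[i ->].
    by rewrite expg1n perm1.
  by rewrite !c1 => ->.
have sx : cl _ s (s x) = cl _ s x by apply/val_inj/(porbit_perm s 1).
have := xchooseP (ix x); rewrite /= => /eqP ei.
rewrite (gE (s x) (xchoose (ix x)).+1) sx; last by rewrite expgSr permM ei.
by rewrite expgSr permM.
Qed.
End PermutationLemma.

(** * Trace functions and p-th powers *)

Section PowerTrace.
Variables (p : nat) (F : nzRingType).
Hypothesis charF : p \in [pchar F].

Let p_pr : prime p := pcharf_prime charF.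

(** Cycles have length 1 or p, and a cycle of length p contributes p times a constant, which is 0 in
    [F]. *)
Lemma sum_perm_fixed (T : finType) (s : {perm T}) (G : T -> F) :
  (s ^+ p)%g = 1%g -> (forall x, G (s x) = G x) ->
  \sum_x G x = \sum_(x | s x == x) G x.
Proof.
move=> sp Gs; rewrite (bigID (fun x => s x == x)) /= [X in _ + X](_ : _ = 0) ?addr0 //.
rewrite (partition_big (porbit s) (mem (porbits s))) /= => [|x _]; last exact: mem_porbits.
apply: big1 => _ /imsetP[x _ ->].
rewrite (eq_bigr (fun=> G x)) => [|y /andP[_]]; last first.
  rewrite eq_porbit_mem => /porbitP[i ->].
  by elim: i => [|i IH]; rewrite ?expg0 ?perm1 // expgSr permM Gs.
(* The inner sum runs over the moved points of the cycle of [x], so it is empty when [x] is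
   fixed. *)
have [sx|sx] := eqVneq (s x) x.
  apply: big_pred0 => y; apply/negbTE/negP => /andP[sy].
  rewrite eq_porbit_mem => /porbitP[i ey]; move: sy; rewrite ey.
  suff -> : (s ^+ i)%g x = x by rewrite sx eqxx.
  by elim: i {ey} => [|i IH]; rewrite ?expg0 ?perm1 // expgSr permM IH.
rewrite sumr_const (@eq_card _ _ (mem (porbit s x))) => [|y].
  have l1 : #|porbit s x| != 1%N by rewrite -dvdn1 -perm_expg_id expg1.
  have : (#|porbit s x| %| p)%N by rewrite -perm_expg_id sp perm1.
  by move/(prime_nt_dvdP p_pr l1)=> ->; rewrite -mulr_natr pcharf0 ?mulr0.
rewrite -[LHS]/((s y != y) && (porbit s y == porbit s x)) eq_porbit_mem andbC.
case: (boolP (y \in porbit s x)) => //= /porbitP[i ->].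
rewrite -[s]expg1 -permM -expgD addnC expgD permM (inj_eq (@perm_inj _ _)).
by rewrite expg1.
Qed.

(* Expand the p-th power into words of length p: g is invariant under their cyclic
   rotation, whose orbits have length 1 or p. *)
Lemma trace_sum_exp_pchar (R : pzRingType) (g : R -> F) (J : finType) (x : J -> R) :
  {morph g : a b / a + b >-> a + b} -> (forall a b, g (a * b) = g (b * a)) ->
  g ((\sum_j x j) ^+ p) = \sum_j g (x j ^+ p).
Proof.
move=> gD gC; have g0 : g 0 = 0 by apply: (addrI (g 0)); rewrite -gD !addr0.
have gsum (I : finType) (y : I -> R) : g (\sum_i y i) = \sum_i g (y i).
  exact: (big_morph g gD g0).
case: p charF p_pr sum_perm_fixed => // -[|q] // _ _ sum_fixed.
have -> : (\sum_j x j) ^+ q.+2 = \prod_(t < q.+2) \sum_j x j.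
  by rewrite big_const_ord; elim: (q.+2) => //= n IH; rewrite exprS IH.
rewrite bigA_distr_bigA gsum.
pose rot (w : {ffun 'I_q.+2 -> J}) : {ffun 'I_q.+2 -> J} := [ffun t => w (ordS t)].
have inj_rot : injective rot.
  move=> w w' e; apply/ffunP=> t; rewrite -[t]ord_predK.
  by have := congr1 (fun k : {ffun _ -> _} => k (ord_pred t)) e; rewrite !ffunE.
have rotE k w t : iter k rot w t = w (iter k (@ordS _) t).
  by elim: k w t => //= k IH w t; rewrite ffunE IH -iterSr.
have iterS k (t : 'I_q.+2) : iter k (@ordS _) t = ((t + k) %% q.+2)%N :> nat.
  elim: k => [|k IH] /=; first by rewrite addn0 modn_small.
  by rewrite IH -addn1 modnDml addn1 addnS.
rewrite (@sum_fixed _ (perm inj_rot)) => [||w]; last 2 first.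
- apply/permP=> w; rewrite permX perm1 (eq_iter (permE inj_rot)).
  apply/ffunP=> t; rewrite rotE; congr (w _); apply: val_inj.
  by rewrite [LHS]iterS modnDr modn_small.
- rewrite permE big_ord_recr [in RHS]big_ord_recl /= gC; congr (g (_ * _)).
    by rewrite ffunE; congr (x (w _)); apply: val_inj; rewrite /= modnn.
  apply: eq_bigr => t _; rewrite ffunE; congr (x (w _)); apply: val_inj => /=.
  by rewrite modn_small // ltnS.
(* A word invariant under rotation is constant, so the surviving words are indexed by [J]. *)
rewrite (reindex (fun j => [ffun=> j] : {ffun 'I_q.+2 -> J})) /=; last first.
  exists (fun w : {ffun 'I_q.+2 -> J} => w ord0) => [j _|w]; first by rewrite ffunE.
  rewrite unfold_in /= permE => /eqP ew; apply/ffunP=> t; rewrite ffunE.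
  rewrite -(_ : iter t (@ordS _) ord0 = t); last first.
    by apply: val_inj; rewrite /= iterS add0n modn_small.
  by elim: (val t) => //= k ->; rewrite -{1}ew ffunE.
apply: eq_big => [j|j _].
  by rewrite permE; apply/eqP/ffunP=> t; rewrite !ffunE.
rewrite (eq_bigr (fun=> x j)) => [|t _]; last by rewrite ffunE.
by rewrite big_const_ord; congr g; elim: (q.+2) => //= n IH; rewrite exprS IH.
Qed.

(** [A] need not be commutative, but M |-> f (tr M) is still a trace function on matrices. Apply
    [trace_sum_exp_pchar] to it, with [Phi] split into the matrices [R i] having one nonzero row:
    the p-th power of [R i] has trace [Phi i i ^+ p]. *)
Lemma trace_mx_exp_pchar (A : nzRingType) (f : A -> F) d (Phi : 'M[A]_d) :
  {morph f : a b / a + b >-> a + b} -> (forall a b, f (a * b) = f (b * a)) ->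
  (forall a, f (a ^+ p) = f a ^+ p) ->
  f (\tr (Phi ^+ p)) = \sum_i f (Phi i i ^+ p).
Proof.
move=> fD fC fp; have f0 : f 0 = 0 by apply: (addrI (f 0)); rewrite -fD !addr0.
have fsum (I : finType) (y : I -> A) : f (\sum_i y i) = \sum_i f (y i).
  exact: (big_morph f fD f0).
pose R i : 'M[A]_d := \matrix_(a, b) (if a == i then Phi a b else 0).
have -> : Phi = \sum_i R i.
  apply/matrixP=> a b; rewrite summxE (bigD1 a) //= big1 => [|i nia].
    by rewrite !mxE eqxx addr0.
  by rewrite mxE eq_sym (negPf nia).
rewrite (@trace_sum_exp_pchar _ (fun M => f (\tr M))) => [|a b|a b]; last 2 first.
- by rewrite mxtraceD fD.
- rewrite /mxtrace !fsum; under eq_bigr do rewrite mxE fsum.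
  rewrite exchange_big; apply: eq_bigr => i _; rewrite mxE fsum.
  by apply: eq_bigr => k _; rewrite fC.
apply: eq_bigr => i _; rewrite summxE (bigD1 i) //= big1 ?addr0 => [|k nki]; last first.
  by rewrite mxE eq_sym (negPf nki).
rewrite [R i i i]mxE eqxx.
have [q ->] : exists q, p = q.+1 by case: p p_pr => // q; exists q.
have RX n : R i ^+ n.+1 = \matrix_(a, b) (if a == i then Phi i i ^+ n * Phi i b else 0).
  elim: n => [|n IH].
    by apply/matrixP=> a b; rewrite !mxE mul1r; case: eqP => // ->.
  apply/matrixP=> a b; rewrite exprS IH !mxE (bigD1 i) //= big1 ?addr0.
    by rewrite !mxE eqxx; case: eqP => [->|]; rewrite ?mul0r // mulrA -exprS.
  by move=> k nki; rewrite !mxE (negPf nki) mulr0.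
rewrite RX /mxtrace (bigD1 i) //= big1 ?addr0 => [|k nki]; rewrite mxE ?(negPf nki) //.
by rewrite eqxx exprSr.
Qed.
End PowerTrace.

(** * Transfer maps of bimodules *)

Local Notation ract := Defs.ract.

Section Transfer.
Variables (O : comNzRingType) (p : nat) (F : fieldType) (rho : O -> F).

Record frobenius_trace (A : algType O) (f : A -> F) : Prop := FrobeniusTrace {
  ftrD : {morph f : x y / x + y >-> x + y};
  ftrZ : forall a x, f (a *: x) = rho a * f x;
  ftrC : forall x y, f (x * y) = f (y * x);
  ftrX : forall x, f (x ^+ p) = f x ^+ p }.

Lemma ftr_sum (A : algType O) (f : A -> F) (I : finType) (P : pred I) (x : I -> A) :
  frobenius_trace f -> f (\sum_(i | P i) x i) = \sum_(i | P i) f (x i).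
Proof.
move=> ff; apply: (big_morph f (ftrD ff)).
by apply: (addrI (f 0)); rewrite -(ftrD ff) !addr0.
Qed.

(** The data of the dual basis lemma for [M] as a left [A]-module, kept as a [Type] so that transfer
    maps can be computed from it. *)
Record dual_basis (A B : algType O) (M : bimodule A B) := DualBasis {
  db_index : finType;
  db_vec : db_index -> M;
  db_form : db_index -> M -> A;
  db_formD : forall i x y, db_form i (x + y) = db_form i x + db_form i y;
  db_formM : forall i a x, db_form i (lact a x) = a * db_form i x;
  db_decomp : forall x, x = \sum_i lact (db_form i x) (db_vec i) }.

Arguments db_vec {A B M} d i.
Arguments db_form {A B M} d i x.
Arguments db_formD {A B M} d i x y.
Arguments db_formM {A B M} d i a x.
Arguments db_decomp {A B M} d x.

Section OneBimodule.
Variables (A B : algType O) (M : bimodule A B) (D : dual_basis M).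

Lemma db_form_sum (I : finType) i (x : I -> M) :
  db_form D i (\sum_j x j) = \sum_j db_form D i (x j).
Proof.
apply: (big_morph (db_form D i) (db_formD D i)).
by apply: (addrI (db_form D i 0)); rewrite -db_formD !addr0.
Qed.

Lemma lact_scale (k : O) (x : M) : k *: x = lact k%:A x.
Proof.
by rewrite (lin_scale _ _ (bim_linear_al (bimoduleP M) x)) (bim_1l (bimoduleP M)).
Qed.

(** This is f applied to the Hattori-Stallings trace of right multiplication by [b], an endomorphism
    of the projective left [A]-module [M]. *)
Definition transfer (f : A -> F) (b : B) : F :=
  \sum_i f (db_form D i (ract (db_vec D i) b)).

End OneBimodule.

Definition left_linear (A B B' : algType O) (M : bimodule A B) (N : bimodule A B')
    (phi : M -> N) : Prop :=
  {morph phi : x y / x + y >-> x + y} /\ forall a x, phi (lact a x) = lact a (phi x).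

Lemma left_linear_ract (A B : algType O) (M : bimodule A B) (b : B) :
  left_linear (fun x : M => ract x b).
Proof.
have [_ _ _ _ a5 _ _ _ a9] := bimoduleP M; split=> [|a x]; last by rewrite a9.
exact: lin_addr (a5 b).
Qed.

Lemma left_linear_sum (A B B' : algType O) (M : bimodule A B) (N : bimodule A B')
    (phi : M -> N) (I : finType) (x : I -> M) :
  left_linear phi -> phi (\sum_i x i) = \sum_i phi (x i).
Proof.
case=> phiD _; apply: (big_morph phi phiD).
by apply: (addrI (phi 0)); rewrite -phiD !addr0.
Qed.

(** The analogue of tr (XY) = tr (YX): expanding in both dual bases gives double sums of f (xy) and
    of f (yx). It yields both the independence of the dual basis and the trace property of
    transfers. *)
Lemma dual_basis_trace_comm (A B B' : algType O) (M : bimodule A B)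
    (N : bimodule A B') (D : dual_basis M) (E : dual_basis N) (phi : M -> N)
    (psi : N -> M) (f : A -> F) :
  frobenius_trace f -> left_linear phi -> left_linear psi ->
  \sum_i f (db_form D i (psi (phi (db_vec D i)))) =
  \sum_j f (db_form E j (phi (psi (db_vec E j)))).
Proof.
move=> ff lphi lpsi.
transitivity (\sum_i \sum_j f (db_form E j (phi (db_vec D i)) *
                               db_form D i (psi (db_vec E j)))).
  apply: eq_bigr => i _; rewrite {1}(db_decomp E (phi _)) (left_linear_sum _ lpsi).
  rewrite db_form_sum ftr_sum //; apply: eq_bigr => j _.
  by rewrite lpsi.2 db_formM.
rewrite exchange_big /=; apply: eq_bigr => j _.
rewrite {2}(db_decomp D (psi _)) (left_linear_sum _ lphi).
rewrite db_form_sum ftr_sum //; apply: eq_bigr => i _.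
by rewrite lphi.2 db_formM (ftrC ff).
Qed.

(** Apply the commutation of traces to the isomorphism and to its inverse composed with right
    multiplication by [b]. *)
Lemma transfer_iso (A B : algType O) (M N : bimodule A B) (D : dual_basis M)
    (E : dual_basis N) (f : A -> F) :
  frobenius_trace f -> bimodule_iso M N -> transfer D f =1 transfer E f.
Proof.
move=> ff [phi [[psi psiK phiK] phil phir]] b.
have lpsi : left_linear (fun x => psi (ract x b)).
  split=> [x y|a x]; apply: (can_inj psiK); rewrite ?raddfD /= ?phil ?phiK.
    exact: (left_linear_ract N b).1.
  exact: (left_linear_ract N b).2.
have lphi : left_linear phi by split=> [x y|a x]; rewrite ?raddfD ?phil.
transitivity (\sum_i f (db_form D i (psi (ract (phi (db_vec D i)) b)))).
  by apply: eq_bigr => i _; rewrite -phir psiK.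
rewrite (dual_basis_trace_comm D E ff lphi lpsi).
by apply: eq_bigr => j _; rewrite phiK.
Qed.

(** For the p-th power condition, right multiplication by [x] is written as a matrix [Phi] over [A].
    The transfer of x^p is then f (tr Phi^p), to which [trace_mx_exp_pchar] applies. *)
Lemma transfer_frobenius (charF : p \in [pchar F]) (A B : algType O)
    (M : bimodule A B) (D : dual_basis M) (f : A -> F) :
  frobenius_trace f -> frobenius_trace (transfer D f).
Proof.
move=> ff; have [_ _ _ _ a5 a6 a7 a8 a9] := bimoduleP M.
split=> [x y|k x|x y|x].
- rewrite -big_split; apply: eq_bigr => i _ /=.
  by rewrite (lin_addr (a6 _)) db_formD (ftrD ff).
- rewrite mulr_sumr; apply: eq_bigr => i _.
  rewrite (lin_scale _ _ (a6 _)) lact_scale db_formM -scalerAl mul1r.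
  by rewrite (ftrZ ff).
- transitivity (\sum_i f (db_form D i (ract (ract (db_vec D i) x) y))).
    by apply: eq_bigr => i _; rewrite a8.
  rewrite (dual_basis_trace_comm D D (phi := fun m => ract m x)
    (psi := fun m => ract m y)) //; try exact: left_linear_ract.
  by apply: eq_bigr => i _; rewrite a8.
pose n := #|db_index D|.
pose m (i : 'I_n) := db_vec D (enum_val i); pose h (i : 'I_n) := db_form D (enum_val i).
have decomp y : y = \sum_i lact (h i y) (m i).
  by rewrite {1}(db_decomp D y) (reindex _ (onW_bij _ (@enum_val_bij (db_index D)))).
have transferE b : transfer D f b = \sum_i f (h i (ract (m i) b)).
  by rewrite /transfer (reindex _ (onW_bij _ (@enum_val_bij (db_index D)))).
pose Phi : 'M[A]_n := \matrix_(i, j) h j (ract (m i) x).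
have PhiX q i : ract (m i) (x ^+ q.+1) = \sum_j lact ((Phi ^+ q.+1) i j) (m j).
  elim: q i => [|q IH] i.
    by rewrite {1}[ract _ _]decomp; apply: eq_bigr => j _; rewrite !expr1 mxE.
  rewrite exprS a8 [ract (m i) x]decomp (left_linear_sum _ (left_linear_ract _ _)).
  under eq_bigr => j _.
    rewrite (left_linear_ract M _).2 IH.
    rewrite (big_morph _ (lin_addr (bim_linear_l (bimoduleP M) _))
                         (lin_zero (bim_linear_l (bimoduleP M) _))).
    under eq_bigr do rewrite -(bim_Ml (bimoduleP M)).
    over.
  rewrite exchange_big /=; apply: eq_bigr => k _.
  rewrite -(big_morph _ (lin_addr (bim_linear_al (bimoduleP M) _))
                         (lin_zero (bim_linear_al (bimoduleP M) _))).
  by rewrite [in RHS]exprS mxE; congr lact; apply: eq_bigr => j _; rewrite mxE.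
(* The vectors [m i] need not be free, so the matrix of the [h l (m k)] is not the identity but the
   projection onto [M]; [PhiE] shows that [Phi] absorbs it. *)
have hX q i j : h j (ract (m i) (x ^+ q.+1)) = (Phi ^+ q.+1 *m \matrix_(k, l) h l (m k)) i j.
  rewrite PhiX mxE /h db_form_sum; apply: eq_bigr => k _; rewrite db_formM.
  by rewrite [in RHS]mxE.
have [q qE] : exists q, p = q.+1 by case: (p) (pcharf_prime charF) => // q; exists q.
have PhiE : Phi *m \matrix_(k, l) h l (m k) = Phi.
  by apply/matrixP=> i j; have := hX 0%N i j; rewrite !expr1 => <-; rewrite mxE.
rewrite transferE.
transitivity (f (\tr (Phi ^+ p))).
  rewrite ftr_sum //; apply: eq_bigr => i _; rewrite qE hX exprSr -mulmxE -mulmxA.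
  by rewrite PhiE.
rewrite (trace_mx_exp_pchar charF) //; [|exact: ftrD ff|exact: ftrC|exact: ftrX].
rewrite transferE -(pFrobenius_autE charF) rmorph_sum; apply: eq_bigr => i _.
by rewrite /= pFrobenius_autE (ftrX ff) mxE.
Qed.

(** * Dual bases and transfers of regular, zero, sum and tensor bimodules *)

Section Constructions.
Variables (A B C : algType O).

Let one : regular_bimodule A := 1 : A.
Fact regular_dual_basis_decomp (x : regular_bimodule A) :
  x = \sum_(i : unit) lact (x : A) one.
Proof. by rewrite (bigD1 tt) //= big1 ?addr0; [rewrite /one mulr1 | case]. Qed.
Definition regular_dual_basis : dual_basis (regular_bimodule A) :=
  @DualBasis A A (regular_bimodule A) unit (fun=> one) (fun _ x => x)
   (fun _ _ _ => erefl) (fun _ _ _ => erefl) regular_dual_basis_decomp.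

Lemma transfer_regular f : transfer regular_dual_basis f =1 f.
Proof.
move=> b; rewrite /transfer (bigD1 tt) //= big1 ?addr0; last by case.
by rewrite /one mul1r.
Qed.

Fact zero_dual_basis_decomp (x : zero_bimodule A B) :
  x = \sum_(i : void) lact (0 : A) (0 : zero_bimodule A B).
Proof. by rewrite /= [LHS]thinmx0 [RHS]thinmx0. Qed.
Definition zero_dual_basis : dual_basis (zero_bimodule A B) :=
  @DualBasis A B (zero_bimodule A B) void (fun=> 0) (fun _ _ => 0)
   (fun i => match i with end) (fun i => match i with end) zero_dual_basis_decomp.

Lemma transfer_zero f b : transfer zero_dual_basis f b = 0.
Proof. by rewrite /transfer big_pred0 // => -[]. Qed.

Section Sum.
Variables (M N : bimodule A B) (D : dual_basis M) (E : dual_basis N).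
Let I : finType := (db_index D + db_index E)%type.
Definition sum_vec (i : I) : bimodule_sum M N :=
  match i with inl i => (db_vec D i, 0) | inr j => (0, db_vec E j) end.
Definition sum_form (i : I) (x : bimodule_sum M N) : A :=
  match i with inl i => db_form D i x.1 | inr j => db_form E j x.2 end.
Fact sum_formD i x y : sum_form i (x + y) = sum_form i x + sum_form i y.
Proof. by case: i => i; rewrite /sum_form /= db_formD. Qed.
Fact sum_formM i a x : sum_form i (lact a x) = a * sum_form i x.
Proof. by case: i => i; rewrite /sum_form /= db_formM. Qed.
Fact sum_decomp x : x = \sum_i lact (sum_form i x) (sum_vec i).
Proof.
have l0 (P : bimodule A B) a : lact a (0 : P) = 0.
  exact: lin_zero (bim_linear_l (bimoduleP P) a).
rewrite big_sumType /= [X in X + _](_ : _ = (x.1, 0)) ?[X in _ + X](_ : _ = (0, x.2)).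
- by case: x => x y; congr pair; rewrite /= ?addr0 ?add0r.
- rewrite [in RHS](db_decomp E x.2); elim/big_rec2: _ => // i y1 y2 _ ->.
  by congr pair; rewrite /= ?l0 ?addr0.
rewrite [in RHS](db_decomp D x.1); elim/big_rec2: _ => // i y1 y2 _ ->.
by congr pair; rewrite /= ?l0 ?addr0.
Qed.
Definition sum_dual_basis := DualBasis sum_formD sum_formM sum_decomp.

Lemma transfer_sum f b : transfer sum_dual_basis f b = transfer D f b + transfer E f b.
Proof. by rewrite /transfer big_sumType. Qed.
End Sum.

Section Tensor.
Variables (M : bimodule A B) (N : bimodule B C).
Variables (D : dual_basis M) (E : dual_basis N).
Let I : finType := (db_index D * db_index E)%type.
Definition tensor_vec (i : I) : bimodule_tensor M N :=
  tens [:: (db_vec D i.1, db_vec E i.2)].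
Let form0 (i : I) (m : M) (n : N) : A := db_form D i.1 (ract m (db_form E i.2 n)).
(** Evaluated on the chosen formal sum representing [x]; the value does not depend on it because
    [form0 i] is balanced. *)
Definition tensor_form (i : I) (x : bimodule_tensor M N) : A :=
  bal_sum (form0 i) (generic_quotient.repr (x : tensor_sort M N)).
Fact form0_balanced i : balanced (form0 i).
Proof.
have [_ _ _ _ a5 a6 a7 a8 a9] := bimoduleP M.
split=> [m m' n|m n n'|m b n]; rewrite /form0.
- by rewrite (left_linear_ract M _).1 db_formD.
- by rewrite db_formD (lin_addr (a6 _)) db_formD.
- by rewrite db_formM a8.
Qed.
Lemma tensor_formE i s : tensor_form i (tens s) = bal_sum (form0 i) s.
Proof. exact/tens_repr/form0_balanced. Qed.
Fact tensor_formD i x y : tensor_form i (x + y) = tensor_form i x + tensor_form i y.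
Proof.
elim/tens_ind: x => s; elim/tens_ind: y => t.
by rewrite -[tens s + tens t]tens_cat !tensor_formE bal_sum_cat.
Qed.
Fact tensor_formM i a x : tensor_form i (lact a x) = a * tensor_form i x.
Proof.
elim/tens_ind: x => s; rewrite [lact _ _]tens_lactE !tensor_formE bal_sum_map.
rewrite /bal_sum mulr_sumr; apply: eq_bigr => x _.
by rewrite /form0 /= -(bim_lr (bimoduleP M)) db_formM.
Qed.
Let pure (m : M) (n : N) : bimodule_tensor M N := tens [:: (m, n)].
Lemma pure_balanced : balanced pure.
Proof.
split=> [m m' n|m n n'|m b n]; rewrite /pure -?[tens _ + tens _]tens_cat;
  apply/tensP => W f bf; rewrite /bal_sum ?big_cat !big_seq1 /=.
- exact: balDl.
- exact: balDr.
exact: balM.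
Qed.
Lemma pure_suml (J : finType) (m : J -> M) n : pure (\sum_j m j) n = \sum_j pure (m j) n.
Proof.
apply: (big_morph (pure^~ n) (fun x y => balDl pure_balanced x y n)).
by apply: (addrI (pure 0 n)); rewrite -(balDl pure_balanced) !addr0.
Qed.
Lemma pure_sumr (J : finType) m (n : J -> N) : pure m (\sum_j n j) = \sum_j pure m (n j).
Proof.
apply: (big_morph (pure m) (balDr pure_balanced m)).
by apply: (addrI (pure m 0)); rewrite -(balDr pure_balanced) !addr0.
Qed.
(** For a pure tensor, expand n in the basis of [N], move its coefficients across the tensor sign
    onto m, and expand the result in the basis of [M]. *)
Fact tensor_decomp x : x = \sum_i lact (tensor_form i x) (tensor_vec i).
Proof.
have [_ a2 _ _ _ _ _ _ _] := bimoduleP (bimodule_tensor M N).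
elim/tens_ind: x; elim=> [|[m n] s IH].
  rewrite big1 // => i _.
  by rewrite tensor_formE /bal_sum big_nil (lin_zero (a2 _)).
have -> : tens ((m, n) :: s) = pure m n + (tens s : bimodule_tensor M N).
  by rewrite /pure -[RHS]tens_cat.
rewrite {1}IH; under [RHS]eq_bigr do rewrite tensor_formD (lin_addr (a2 _)).
rewrite big_split /=; congr (_ + _).
rewrite {1}(db_decomp E n) pure_sumr.
under [LHS]eq_bigr => k _.
  rewrite -(balM pure_balanced) (db_decomp D (ract m _)) pure_suml.
  over.
rewrite exchange_big pair_big /=; apply: eq_bigr => -[i k] _ /=.
rewrite /pure tensor_formE /bal_sum big_seq1 /form0 /=.
by rewrite [RHS]tens_lactE.
Qed.
Definition tensor_dual_basis := DualBasis tensor_formD tensor_formM tensor_decomp.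

Lemma transfer_tensor f b : frobenius_trace f ->
  transfer tensor_dual_basis f b = transfer E (transfer D f) b.
Proof.
move=> ff; rewrite /transfer exchange_big pair_big; apply: eq_bigr => -[i k] _ /=.
by rewrite /tensor_vec tens_ractE tensor_formE /bal_sum big_seq1.
Qed.
End Tensor.
End Constructions.

Section Projective.
Variables (A B : algType O) (M : bimodule A B).
Local Notation P := (left_restr M).
Variables (d : nat) (e : 'I_d -> P).
Local Notation U := {ffun 'I_d -> A^o}.

Definition free_cover (u : U) : P := \sum_i (u i : A) *: e i.
Fact free_cover_linear : linear free_cover.
Proof.
move=> a u v; rewrite /free_cover scaler_sumr -big_split; apply: eq_bigr => i _ /=.
by rewrite !ffunE scalerDl scalerA.
Qed.
HB.instance Definition _ := GRing.isLinear.Build A U P *:%R free_cover free_cover_linear.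
End Projective.

(** Projectivity splits the cover of [M] by a free module on its generators; the coordinates of the
    splitting are the forms. *)
Lemma biprojective_dual_basis (A B : algType O) (M : bimodule A B) :
  biprojective M -> inhabited (dual_basis M).
Proof.
case=> [[d [e gen_e]] projM _ _]; split.
have surj (v : left_restr M) : exists u, free_cover e u = v.
  by have [c ->] := gen_e v; exists [ffun i => c i]; apply: eq_bigr => i _; rewrite ffunE.
have /cid[h hK] := projM _ _ (free_cover e : {linear _ -> left_restr M}) idfun surj.
apply: (@DualBasis A B M 'I_d e (fun i x => h (x : left_restr M) i)).
- by move=> i x y; rewrite -[x + y]/((x : left_restr M) + y) raddfD ffunE.
- by move=> i a x; rewrite -[lact a x]/(a *: (x : left_restr M)) linearZ ffunE.
by move=> x; rewrite -[LHS](hK x).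
Qed.

(** * Transfers of virtual bimodules *)

Section VirtualTransfer.
Hypothesis charF : p \in [pchar F].

Definition virtual_transfer (A B : algType O) (X : virtual_bimodule A B)
    (D : dual_basis (vpos X)) (E : dual_basis (vneg X)) (f : A -> F) (b : B) : F :=
  transfer D f b - transfer E f b.

Lemma virtual_transfer_frobenius (A B : algType O) (X : virtual_bimodule A B) D E f :
  frobenius_trace f -> frobenius_trace (@virtual_transfer A B X D E f).
Proof.
move=> ff; have fD := transfer_frobenius charF D ff.
have fE := transfer_frobenius charF E ff; rewrite /virtual_transfer.
split=> [x y|a x|x y|x].
- by rewrite (ftrD fD) (ftrD fE) opprD addrACA.
- by rewrite (ftrZ fD) (ftrZ fE) mulrBr.
- by rewrite (ftrC fD) (ftrC fE).
by rewrite (ftrX fD) (ftrX fE) -!(pFrobenius_autE charF) rmorphB.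
Qed.

(** The source of Galois equivariance: a transfer is an alternating sum of values of f, so any
    additive [tau] passes through it. *)
Lemma virtual_transfer_comp (A B : algType O) (X : virtual_bimodule A B) D E (f : A -> F)
    (tau : {additive F -> F}) :
  @virtual_transfer A B X D E (tau \o f) =1 tau \o virtual_transfer D E f.
Proof. by move=> b; rewrite /virtual_transfer /transfer -!raddf_sum -raddfB. Qed.

Lemma transferB (A B : algType O) (M : bimodule A B) (D : dual_basis M) (f g : A -> F) b :
  transfer D (fun a => f a - g a) b = transfer D f b - transfer D g b.
Proof. exact: sumrB. Qed.

(** Equality in the Grothendieck group is an isomorphism after adding some [L]. Both sides are
    transferred through dual bases of matching shape, and the term of [L] cancels in [F]. *)
Lemma virtual_transferK (A B : algType O) (X : virtual_bimodule A B)
    (Y : virtual_bimodule B A) (D : dual_basis (vpos X)) (E : dual_basis (vneg X))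
    (D' : dual_basis (vpos Y)) (E' : dual_basis (vneg Y)) (f : A -> F) :
  eq_P (virtual_tensor X Y) (virtual_class (regular_bimodule A)) ->
  frobenius_trace f -> virtual_transfer D' E' (virtual_transfer D E f) =1 f.
Proof.
case=> L /biprojective_dual_basis[DL] iso ff a.
pose dl := sum_dual_basis (sum_dual_basis (sum_dual_basis (tensor_dual_basis D D')
  (tensor_dual_basis E E')) (zero_dual_basis A A)) DL.
pose dr := sum_dual_basis (sum_dual_basis (regular_dual_basis A)
  (sum_dual_basis (tensor_dual_basis D E') (tensor_dual_basis E D'))) DL.
have := transfer_iso dl dr ff iso a.
rewrite !transfer_sum transfer_zero addr0 transfer_regular => /addIr.
rewrite !transfer_tensor // /virtual_transfer !transferB => e.
by rewrite opprB addrACA [- _ + _]addrC addrA -[LHS]addrA -opprD e addrK.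
Qed.

Lemma virtual_Morita_transfer (A B : algType O) (X : virtual_bimodule A B)
    (Y : virtual_bimodule B A) :
  virtual_Morita X Y ->
  exists (T : (A -> F) -> B -> F) (S : (B -> F) -> A -> F),
    [/\ forall f, frobenius_trace f -> frobenius_trace (T f) /\ S (T f) =1 f,
        forall g, frobenius_trace g -> frobenius_trace (S g) /\ T (S g) =1 g,
        forall (tau : {additive F -> F}) f, T (tau \o f) =1 tau \o T f &
        forall (tau : {additive F -> F}) g, S (tau \o g) =1 tau \o S g].
Proof.
move=> [[/biprojective_dual_basis[D] /biprojective_dual_basis[E]]].
move=> [/biprojective_dual_basis[D'] /biprojective_dual_basis[E']] isoA isoB.
exists (virtual_transfer D E), (virtual_transfer D' E'); split.
- by move=> f ff; split; [apply: virtual_transfer_frobenius | apply: virtual_transferK].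
- by move=> f ff; split; [apply: virtual_transfer_frobenius | apply: virtual_transferK].
- by move=> tau f; apply: (virtual_transfer_comp D E f tau).
by move=> tau f; apply: (virtual_transfer_comp D' E' f tau).
Qed.
End VirtualTransfer.
End Transfer.

(** * Modular representations over an algebraically closed field *)

(** Existence of simple submodules and of composition series is provided only under [classically];
    excluded middle removes it. *)
Lemma classically_elim (P : Prop) : classically P -> P.
Proof.
move=> cP; have [//|nP] := pselect P.
by have := cP false (fun hP => False_ind _ (nP hP)).
Qed.

Local Notation in_setT := finset.in_setT.

Section GroupAlgebraElements.
Variables (F : comNzRingType) (G : finGroupType).
Local Notation FG := (group_algebra F G).

Definition ga_elt (g : G) : FG := [ffun h => (h == g)%:R].

Lemma coefg_elt g h : coefg (ga_elt g) h = (h == g)%:R.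
Proof. by rewrite /coefg ffunE. Qed.

Lemma ga_eltM g h : ga_elt g * ga_elt h = ga_elt (g * h)%g.
Proof.
apply: coefgP => x; rewrite coefgM (bigD1 g) //= big1 => [|k nkg]; rewrite !coefg_elt.
  by rewrite eqxx mul1r addr0 -(inj_eq (mulgI g)) mulKVg.
by rewrite (negPf nkg) mul0r.
Qed.

Lemma coefg_sum (I : Type) (r : seq I) (P : pred I) (x : I -> FG) g :
  coefg (\sum_(i <- r | P i) x i) g = \sum_(i <- r | P i) coefg (x i) g.
Proof.
apply: (big_morph (fun a : FG => coefg a g)) => [a b|]; first exact: coefgD.
by rewrite /coefg ffunE.
Qed.

Lemma ga_eltE (a : FG) : a = \sum_g coefg a g *: ga_elt g.
Proof.
apply: coefgP => h; rewrite coefg_sum (bigD1 h) //= big1 => [|g ngh].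
  by rewrite coefgZ coefg_elt eqxx mulr1 addr0.
by rewrite coefgZ coefg_elt eq_sym (negPf ngh) mulr0.
Qed.

End GroupAlgebraElements.

Section GroupAlgebraAction.
Variables (F : fieldType) (G : finGroupType).
Local Notation FG := (group_algebra F G).

Section Ext.
Variables (d : nat) (rG : mx_representation F [set: G] d).

Definition ext (a : FG) : 'M[F]_d := \sum_g coefg a g *: rG g.

Lemma ext_is_linear : linear ext.
Proof.
move=> k a b; rewrite /ext scaler_sumr -big_split; apply: eq_bigr => g _ /=.
by rewrite coefgD coefgZ scalerDl scalerA.
Qed.
HB.instance Definition _ := GRing.isLinear.Build F FG 'M[F]_d _ ext ext_is_linear.

Lemma ext_elt g : ext (ga_elt F g) = rG g.
Proof.
rewrite /ext (bigD1 g) //= big1 => [|h nhg]; first by rewrite coefg_elt eqxx scale1r addr0.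
by rewrite coefg_elt (negPf nhg) scale0r.
Qed.

Lemma ext1 : ext 1 = 1%:M.
Proof.
have -> : (1 : FG) = ga_elt F 1%g by [].
by rewrite ext_elt repr_mx1.
Qed.

Lemma extM a b : ext (a * b) = ext a *m ext b.
Proof.
have extD (x y : FG) : ext (x + y) = ext x + ext y by rewrite linearD.
have ext0 : ext 0 = 0 by rewrite linear0.
have extS := big_morph ext extD ext0.
rewrite [a]ga_eltE [b]ga_eltE mulr_suml !extS mulmx_suml.
apply: eq_bigr => g _; rewrite mulr_sumr extS mulmx_sumr; apply: eq_bigr => h _.
rewrite -scalerAl -scalerAr !linearZ /= ga_eltM !ext_elt repr_mxM ?in_setT //.
by rewrite -scalemxAl scalerA mulrC -scalerA.
Qed.

Lemma extX a n : ext (a ^+ n) = ext a ^+ n.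
Proof. by elim: n => [|n IH]; rewrite ?ext1 // !exprS extM IH. Qed.
End Ext.

Lemma ext_rsim d (rG : mx_representation F [set: G] d) d'
    (rG' : mx_representation F [set: G] d') a :
  mx_rsim rG rG' -> ext rG' a = 0 -> ext rG a = 0.
Proof.
case/mx_rsim_def=> B [B' _ e] a0; rewrite /ext.
transitivity (B *m ext rG' a *m B'); last by rewrite a0 mulmx0 mul0mx.
rewrite /ext mulmx_sumr mulmx_suml; apply: eq_bigr => g _.
by rewrite e ?in_setT // -scalemxAr -scalemxAl.
Qed.

(** The row of the identity element in the regular matrix of [a] lists the coefficients of [a]. *)
Lemma ext_regular_eq0 (a : FG) : ext (regular_repr F [set: G]%G) a = 0 -> a = 0.
Proof.
move=> a0; apply: coefgP => h.
have /matrixP/(_ (gring_index [set: G]%G 1%g) (gring_index [set: G]%G h)) := a0.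
rewrite /ext summxE (bigD1 h) //= big1 ?addr0 => [|g ngh];
  rewrite !mxE gring_indexK ?in_setT // mul1g.
  by rewrite !eqxx mulr1 => ->; rewrite /coefg ffunE.
rewrite eqxx /=; case: eqP => [e|]; last by rewrite mulr0.
have := congr1 enum_val e; rewrite !gring_indexK ?in_setT // => eg.
by rewrite eg eqxx in ngh.
Qed.

(** Induction on the dimension: [a] kills a simple submodule V, and by induction some a^N maps
    everything into V, so a^(N+1) acts as 0. *)
Lemma ext_nilpotent d (rG : mx_representation F [set: G] d) a :
  (forall d' (rS : mx_representation F [set: G] d'), mx_irreducible rS -> ext rS a = 0) ->
  exists N, ext rG a ^+ N = 0.
Proof.
move=> a0; move: {2}d (leqnn d) => m.
elim: m d rG => [|m IH] d rG dm.
  by exists 1%N; apply/matrixP => i; have := leq_trans (ltn_ord i) dm.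
have [d0|d0] := posnP d.
  by exists 1%N; apply/matrixP => i; have := ltn_ord i; rewrite [X in (_ < X)%N]d0.
have nz1 : 1%:M != 0 :> 'M[F]_d by rewrite -mxrank_eq0 mxrank1 -lt0n.
have [V simV _] := classically_elim (mxsimple_exists (mxmodule1 rG) nz1).
have [modV nzV _] := simV.
have sub0 := a0 _ _ ((submod_mx_irr modV).2 simV).
have V0 : V *m ext rG a = 0.
  apply/eqP; rewrite -submx0 -(eqmxMr _ (val_submod1 V)) submx0; apply/eqP.
  transitivity (val_submod (1%:M *m ext (submod_repr modV) a)); last first.
    by rewrite sub0 mulmx0 linear0.
  rewrite /ext !mulmx_sumr linear_sum; apply: eq_bigr => g _.
  by rewrite -!scalemxAr linearZ /= val_submodJ ?in_setT.
have [|N N0] := IH _ (factmod_repr modV).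
  rewrite mxrank_coker -ltnS (leq_trans _ dm) // ltn_subrL d0 andbT.
  by rewrite lt0n mxrank_eq0.
exists N.+1; rewrite exprSr.
have factJ (W : 'M_d) : in_factmod V (W *m ext rG a) = in_factmod V W *m ext (factmod_repr modV) a.
  rewrite /ext !mulmx_sumr linear_sum; apply: eq_bigr => g _.
  by rewrite -!scalemxAr linearZ /= in_factmodJ ?in_setT.
have : in_factmod V (ext rG a ^+ N) = 0.
  rewrite -[_ ^+ N]mul1mx.
  have -> n : in_factmod V (1%:M *m ext rG a ^+ n) =
              in_factmod V 1%:M *m ext (factmod_repr modV) a ^+ n.
    elim: n => [|n IHn]; first by rewrite !expr0 !mulmx1.
    by rewrite !exprSr -!mulmxE !mulmxA factJ IHn.
  by rewrite N0 mulmx0.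
move/eqP; rewrite in_factmod_eq0 => /submxP[w ->].
by rewrite -mulmxE -mulmxA V0 mulmx0.
Qed.

End GroupAlgebraAction.

(** E_ij = E_i0 E_0j, and exchanging the factors gives E_00 if i = j and 0 otherwise. *)
Lemma trace_form_mx (F : fieldType) d (g : 'M[F]_d.+1 -> F) :
  linear_for *%R g -> (forall M N, g (M *m N) = g (N *m M)) ->
  forall M, g M = g (delta_mx 0 0) * \tr M.
Proof.
move=> lg gC M.
have gD x y : g (x + y) = g x + g y by have := lg 1 x y; rewrite scale1r mul1r.
have g0 : g 0 = 0 by apply: (addrI (g 0)); rewrite -gD !addr0.
have gZ k x : g (k *: x) = k * g x by have := lg k x 0; rewrite g0 !addr0.
have gsum := big_morph g gD g0.
have gdelta i j : g (delta_mx i j) = (i == j)%:R * g (delta_mx 0 0).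
  rewrite -(mul_delta_mx (0 : 'I_d.+1)) gC; case: eqP => [<-|nij].
    by rewrite mul_delta_mx mul1r.
  by rewrite mul_delta_mx_0 ?g0 ?mul0r // eq_sym; apply/eqP.
rewrite [M in LHS]matrix_sum_delta gsum /mxtrace mulr_sumr; apply: eq_bigr => i _.
rewrite gsum (bigD1 i) //= big1 => [|j nji]; rewrite gZ gdelta.
  by rewrite eqxx mul1r addr0 mulrC.
by rewrite eq_sym (negPf nji) mul0r mulr0.
Qed.

Section ModularRepresentations.
Variables (F : closedFieldType) (G : finGroupType).
Local Notation FG := (group_algebra F G).

Record irrep := Irrep {
  irdim : nat;
  irmx :> mx_representation F [set: G] irdim;
  irmxP : mx_irreducible irmx }.

Arguments irmxP : clear implicits.

(** Burnside's theorem: over an algebraically closed field an irreducible representation is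
    absolutely irreducible, so its enveloping algebra is the full matrix algebra. *)
Lemma ext_surj (r : irrep) M : exists a, ext r a = M.
Proof.
have /mx_abs_irrP[_ [a_ a_E]] := group_closure_closed_field (irmxP r).
exists ([ffun g => a_ g M] : {ffun G -> F}); rewrite [RHS]a_E.
by apply: eq_big => [g|g _]; rewrite ?in_setT // /coefg ffunE.
Qed.

Lemma irdim_gt0 (r : irrep) : (0 < irdim r)%N.
Proof. by have [] := (mx_irrP r).1 (irmxP r). Qed.

Lemma delta_mulmx d (i j : 'I_d) (A : 'M[F]_d) :
  delta_mx i j *m A = \sum_l A j l *: delta_mx i l.
Proof.
apply/matrixP=> k m; rewrite mxE summxE (bigD1 j) //= big1 ?addr0 => [|l nlj].
  rewrite (bigD1 m) //= big1 ?addr0 => [|l nlm]; rewrite !mxE ?eqxx ?andbT 1?mulrC //.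
  by rewrite [m == l]eq_sym (negPf nlm) andbF ?mul0r ?mulr0.
by rewrite mxE (negPf nlj) andbF mul0r.
Qed.

(* For a suitable row vector v, the matrix with rows v *m ext r1 (lift (delta_mx o m))
   is a nonzero intertwiner, since the rows delta_mx o m span a simple module. *)
Lemma ext_kernel_rsim (r1 r2 : irrep) :
  (forall a, ext r2 a = 0 -> ext r1 a = 0) -> mx_rsim r2 r1.
Proof.
move=> ker; have [lift liftK] : {lift | forall M, ext r2 (lift M) = M}.
  exists (fun M => sval (cid (ext_surj (r := r2) M))) => M.
  exact: (svalP (cid (ext_surj (r := r2) M))).
pose o : 'I_(irdim r2) := Ordinal (irdim_gt0 r2).
have eq_ext a b : ext r2 a = ext r2 b -> ext r1 a = ext r1 b.
  by move=> e; apply/eqP; rewrite -subr_eq0 -raddfB; apply/eqP/ker; rewrite raddfB /= e subrr.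
pose B (v : 'rV_(irdim r1)) : 'M_(irdim r2, irdim r1) :=
  \matrix_m (v *m ext r1 (lift (delta_mx o m))).
have BJ v g : r2 g *m B v = B v *m r1 g.
  apply/row_matrixP=> m; rewrite !row_mul rowK -mulmxA -(ext_elt r1) -extM.
  rewrite (eq_ext _ (\sum_l r2 g m l *: lift (delta_mx o l))); last first.
    rewrite extM liftK ext_elt linear_sum.
    by rewrite delta_mulmx; apply: eq_bigr => l _; rewrite linearZ /= liftK.
  rewrite (linear_sum (ext r1)) mulmx_sumr mulmx_sum_row; apply: eq_bigr => l _.
  by rewrite linearZ /= -scalemxAr mxE rowK.
(* Otherwise every lift of [delta_mx o m] acts as 0 on [r1], and so does the sum over m of E_mo
   E_om, which is the identity. *)
have [v Bv] : exists v, B v != 0.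
  apply: contrapT => noB.
  have Bv v : B v = 0 by apply/eqP/negPn/negP=> nB; apply: noB; exists v.
  have E0 m : ext r1 (lift (delta_mx o m)) = 0.
    apply/row_matrixP=> i; rewrite rowE row0.
    by have /row_matrixP/(_ m) := Bv (delta_mx 0 i); rewrite rowK row0.
  have := ext1 r1; rewrite (eq_ext _ (\sum_m lift (delta_mx m o) * lift (delta_mx o m))).
    rewrite linear_sum big1 => [/eqP|m _]; last by rewrite /= extM E0 mulmx0.
    by rewrite eq_sym -mxrank_eq0 mxrank1 -leqn0 leqNgt irdim_gt0.
  rewrite ext1 linear_sum mx1_sum_delta; apply: eq_bigr => m _.
  by rewrite /= extM !liftK mul_delta_mx.
have [_ irr1] := (mx_irrP r1).1 (irmxP r1).
have [_ irr2] := (mx_irrP r2).1 (irmxP r2).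
have free : row_free (B v).
  rewrite -kermx_eq0; apply: contraT => nzK.
  have modK : mxmodule r2 (kermx (B v)).
    apply/mxmoduleP=> g _; apply/sub_kermxP.
    by rewrite -mulmxA BJ mulmxA mulmx_ker mul0mx.
  have /row_fullP[M MK] := irr2 _ modK nzK.
  by case/eqP: Bv; rewrite -[LHS]mul1mx -MK -mulmxA mulmx_ker mulmx0.
have full : row_full <<B v>>%MS.
  apply: irr1; last by rewrite -mxrank_eq0 mxrank_gen mxrank_eq0.
  rewrite (eqmx_module _ (genmxE _)); apply/mxmoduleP=> g _.
  by rewrite -BJ submxMl.
have eqd : irdim r2 = irdim r1.
  move: free full; rewrite /row_free /row_full mxrank_gen => /eqP -> /eqP //.
by exists (B v).
Qed.

Lemma ext_separate (r1 r2 : irrep) :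
  ~ mx_rsim r2 r1 -> exists a, ext r1 a = 1%:M /\ ext r2 a = 0.
Proof.
move=> nsim.
have [a [a2 a1]] : exists a, ext r2 a = 0 /\ ext r1 a != 0.
  apply: contrapT => no; apply/nsim/ext_kernel_rsim => a a2.
  by apply/eqP/negPn/negP=> a1; apply: no; exists a.
have [i [j nz]] : exists i j, ext r1 a i j != 0.
  apply: contrapT => no; case/eqP: a1; apply/matrixP=> i j; rewrite [RHS]mxE.
  by apply/eqP/negPn/negP=> nz; apply: no; exists i, j.
have lift (M : 'M_(irdim r1)) := cid (ext_surj (r := r1) M).
(* The sum over m of E_mi M E_jm is M_ij times the identity; here M is [ext r1 a], with a nonzero
   entry at i, j. *)
exists (\sum_m (ext r1 a i j)^-1 *: (sval (lift (delta_mx m i)) * a * sval (lift (delta_mx j m)))).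
split; rewrite linear_sum; last first.
  by apply: big1 => m _; rewrite linearZ /= !extM a2 mulmx0 mul0mx scaler0.
rewrite mx1_sum_delta; apply: eq_bigr => m _.
rewrite linearZ /= !extM !(svalP (lift _)) delta_mulmx mulmx_suml (bigD1 j) //=.
rewrite big1 ?addr0 => [|l nlj]; last by rewrite -scalemxAl mul_delta_mx_0 ?scaler0.
by rewrite -scalemxAl mul_delta_mx scalerA mulVf ?scale1r.
Qed.

Lemma ext_separate_seq (I : eqType) (r : I -> irrep) (i : I) (s : seq I) :
  (forall j, j \in s -> ~ mx_rsim (r j) (r i)) ->
  exists a, ext (r i) a = 1%:M /\ forall j, j \in s -> ext (r j) a = 0.
Proof.
elim: s => [_|j s IH nsim]; first by exists 1; rewrite ext1.
have [|a [ai aj]] := IH; first by move=> k ks; apply: nsim; rewrite inE ks orbT.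
have [|a' [a'i a'j]] := @ext_separate (r i) (r j); first by apply: nsim; rewrite mem_head.
exists (a' * a); split=> [|k]; first by rewrite extM a'i ai mul1mx.
rewrite inE => /orP[/eqP->|ks]; rewrite extM ?a'j ?mul0mx //.
by rewrite aj // mulmx0.
Qed.

Definition irr_family (I : finType) (r : I -> irrep) : Prop :=
  (forall i j, mx_rsim (r i) (r j) -> i = j) /\ (forall s : irrep, exists i, mx_rsim s (r i)).

(** Every simple module is a composition factor of the regular representation; among isomorphic
    factors only the one of least index is kept. *)
Lemma irr_family_exists : exists (I : finType) (r : I -> irrep), irr_family r.
Proof.
have [U [compU lastU _]] := classically_elim
  (mx_Schreier (rG := regular_repr F [set: G]%G) (U := [::]) isT isT).
pose r (i : 'I_(size U)) := Irrep (mx_series_repr_irr compU (ltn_ord i)).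
pose P (i : 'I_(size U)) := `[< forall j : 'I_(size U), (j < i)%N -> ~ mx_rsim (r j) (r i) >].
exists {i | P i}, (fun i => r (val i)); split=> [i j sim|s].
  apply: val_inj; case: i j sim => [i /asboolP Pi] [j /asboolP Pj] /= sim.
  case: (ltngtP i j) => [ij|ij|/val_inj //]; first by case: (Pj i ij).
  by case: (Pi j ij); apply: mx_rsim_sym.
have [i0 sim0] := rsim_regular_series (irmxP s) compU lastU.
have ex0 : exists i, `[< mx_rsim s (r i) >] by exists i0; apply/asboolP.
pose i := [arg min_(i < i0 | `[< mx_rsim s (r i) >]) (i : nat)].
have : [/\ mx_rsim s (r i) & forall j, mx_rsim s (r j) -> (i <= j)%N].
  rewrite /i; case: arg_minnP => [|k /asboolP simk mink]; first exact/asboolP.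
  by split=> // j simj; apply: mink; apply/asboolP.
case=> simi mini.
have Pi : P i.
  apply/asboolP=> j ji simj; have := mini j; rewrite leqNgt ji => /(_ _)/negP.
  by apply=> //; apply: mx_rsim_trans simi (mx_rsim_sym simj).
by exists (exist _ i Pi).
Qed.

Section Family.
Variables (I : finType) (r : I -> irrep).
Hypothesis rP : irr_family r.

Lemma irr_idempotents i :
  exists a, ext (r i) a = 1%:M /\ forall j, j != i -> ext (r j) a = 0.
Proof.
have [|a [ai aj]] := @ext_separate_seq _ r i [seq j <- enum I | j != i].
  move=> j; rewrite mem_filter => /andP[nji _] /(rP.1) e.
  by rewrite e eqxx in nji.
by exists a; split=> // j nji; apply: aj; rewrite mem_filter nji mem_enum.
Qed.

Lemma irr_lift : exists E : forall i, 'M[F]_(irdim (r i)) -> FG,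
  forall i M, ext (r i) (E i M) = M /\ forall j, j != i -> ext (r j) (E i M) = 0.
Proof.
exists (fun i M => sval (cid (irr_idempotents i)) * sval (cid (ext_surj (r := r i) M))).
move=> i M; case: (cid (irr_idempotents i)) => e /= [ei ej].
case: (cid (ext_surj M)) => a /= ea; split=> [|j nji]; rewrite extM.
  by rewrite ei ea mul1mx.
by rewrite ej // mul0mx.
Qed.

(** The p-th power condition acts twice: it makes f factor through the product of the matrix
    algebras of the simple modules, and it forces the coefficients into F_p. *)
Lemma trace_function_irr (p : nat) (f : FG -> F) :
  p \in [pchar F] ->
  linear_for *%R f -> (forall a b, f (a * b) = f (b * a)) ->
  (forall a, f (a ^+ p) = f a ^+ p) ->
  exists2 c : I -> F, (forall i, c i ^+ p = c i) &
    forall a, f a = \sum_i c i * \tr (ext (r i) a).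
Proof.
move=> charF lf fC fX.
have fD x y : f (x + y) = f x + f y by have := lf 1 x y; rewrite scale1r mul1r.
have f0 : f 0 = 0 by apply: (addrI (f 0)); rewrite -fD !addr0.
have fZ k x : f (k *: x) = k * f x by have := lf k x 0; rewrite f0 !addr0.
have fsum := big_morph f fD f0.
(* Such an element is nilpotent, so some p-power of f a is the value of f at 0. *)
have fJ a : (forall i, ext (r i) a = 0) -> f a = 0.
  move=> a0; have [|N N0] := @ext_nilpotent F G _ (regular_repr F [set: G]%G) a.
    move=> d rS irrS; have [i sim] := rP.2 (Irrep irrS).
    exact: ext_rsim sim (a0 i).
  have aN : a ^+ N = 0 by apply: ext_regular_eq0; rewrite extX.
  have fpk k : f (a ^+ (p ^ k)) = f a ^+ (p ^ k).
    by elim: k => [|k IH]; rewrite ?expn0 ?expr1 // expnSr !exprM fX IH.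
  have p1 := prime_gt1 (pcharf_prime charF).
  have : f (a ^+ (p ^ N)) = 0.
    by rewrite -(subnK (ltnW (ltn_expl N p1))) exprD aN mulr0.
  by rewrite fpk => /eqP; rewrite expf_eq0 => /andP[_ /eqP].
have fJeq a b : (forall i, ext (r i) a = ext (r i) b) -> f a = f b.
  move=> e; apply/eqP; rewrite -subr_eq0 -mulN1r -fZ scaleN1r -fD.
  by apply/eqP/fJ => i; rewrite raddfB /= e subrr.
have [E EP] := irr_lift.
have EE i M : ext (r i) (E i M) = M by case: (EP i M).
have EN i j M : j != i -> ext (r j) (E i M) = 0 by case: (EP i M) => _; apply.
pose g i M := f (E i M).
have gL i : linear_for *%R (g i).
  move=> k M N; rewrite /g -fZ -fD; apply: fJeq => j.
  rewrite linearD linearZ /=; case: (eqVneq j i) => [->|nji]; first by rewrite !EE.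
  by rewrite !EN // scaler0 addr0.
have gM i M N : g i (M *m N) = f (E i M * E i N).
  apply: fJeq => j; rewrite extM.
  by case: (eqVneq j i) => [->|nji]; rewrite ?EE // !EN // mulmx0.
have gC i M N : g i (M *m N) = g i (N *m M) by rewrite !gM fC.
have gtr i : exists2 c, c ^+ p = c & forall M, g i M = c * \tr M.
  have pw M : g i (M ^+ p) = g i M ^+ p.
    rewrite /g -fX; apply: fJeq => j; rewrite extX.
    case: (eqVneq j i) => [->|nji]; rewrite ?EE // !EN // expr0n.
    by rewrite eqn0Ngt (prime_gt0 (pcharf_prime charF)).
  move: (irdim_gt0 (r i)) (g i) (gL i) (gC i) pw; case: (irdim (r i)) => // d _ h hL hC pw.
  exists (h (delta_mx 0 0)); last exact: (trace_form_mx hL hC).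
  (* The power condition at this idempotent of trace 1 reads c = c^p. *)
  have e : delta_mx 0 0 * delta_mx 0 0 = delta_mx 0 0 :> 'M[F]_d.+1 by rewrite -mulmxE mul_delta_mx.
  rewrite -pw; congr h; case: (p) (prime_gt0 (pcharf_prime charF)) => // q _.
  by elim: q => [|q IH]; rewrite ?expr1 // exprS IH e.
pose c i := s2val (cid2 (gtr i)).
exists c => [i|a]; first exact: (s2valP (cid2 (gtr i))).
transitivity (\sum_i g i (ext (r i) a)).
  rewrite -fsum; apply: fJeq => j; rewrite linear_sum (bigD1 j) //= EE big1 ?addr0 // => i nij.
  by rewrite EN // eq_sym.
by apply: eq_bigr => i _; rewrite (s2valP' (cid2 (gtr i))).
Qed.

Lemma irr_trace_free i : exists a, forall j, \tr (ext (r j) a) = (j == i)%:R.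
Proof.
have [E EP] := irr_lift; pose o := Ordinal (irdim_gt0 (r i)).
exists (E i (delta_mx o o)) => j; have [e0 e1] := EP i (delta_mx o o).
have [->|nji] := eqVneq j i; last by rewrite e1 // mxtrace0.
rewrite e0 /mxtrace (bigD1 o) //= big1 ?addr0 => [|k nko]; rewrite mxE ?eqxx //.
by rewrite (negPf nko).
Qed.

End Family.
End ModularRepresentations.

(** * Residue fields and roots of unity *)

Lemma rmorphism_of (R S : nzRingType) (f : R -> S) :
  (forall x y, f (x - y) = f x - f y) -> f 1 = 1 -> (forall x y, f (x * y) = f x * f y) ->
  exists g : {rmorphism R -> S}, g =1 f.
Proof.
move=> fB f1 fM.
pose z := GRing.isZmodMorphism.Build R S f fB.
pose m := GRing.isMonoidMorphism.Build R S f (f1, fM).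
by exists (HB.pack_for {rmorphism R -> S} f z m).
Qed.

Section RootsOfUnity.

Lemma closed_prim_root (F : closedFieldType) m :
  m%:R != 0 :> F -> exists z : F, m.-primitive_root z.
Proof.
move=> m0; have mgt0 : (0 < m)%N by case: (m) m0 => //; rewrite eqxx.
have [rs ers] := closed_field_poly_normal ('X^m - 1 : {poly F}).
move: ers; rewrite (monicP (monicXnsubC _ mgt0)) scale1r => ers.
have urs : uniq rs by rewrite -separable_prod_XsubC -ers separable_Xn_sub_1.
have srs : size rs = m.
  by apply: succn_inj; rewrite -(size_prod_XsubC rs id) -ers size_XnsubC.
have all_unity : all m.-unity_root rs.
  by apply/allP=> z zrs; rewrite /root_of_unity ers root_prod_XsubC.
have := has_prim_root mgt0 all_unity urs; rewrite srs leqnn => /(_ isT) /hasP[z _ hz].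
by exists z.
Qed.

End RootsOfUnity.

(** * Embedding the splitting field of X^m - 1 into an algebraically closed field *)

Section ClosedEmbedding.
Variables (k : fieldType) (L : splittingFieldType k) (m : nat).
Hypothesis m_neq0 : m%:R != 0 :> k.
Hypothesis splitL : splittingFieldFor 1 ('X^m - 1 : {poly L}) fullv.

Lemma splitting_prim_root : exists2 z : L, m.-primitive_root z & <<1; z>>%VS = fullv.
Proof.
have [rs ers genrs] := splitL.
have mgt0 : (0 < m)%N by case: (m) m_neq0 => //; rewrite eqxx.
have mL : m%:R != 0 :> L.
  by rewrite -(rmorph_nat (in_alg L)) fmorph_eq0.
move: ers; rewrite eqp_monic ?monicXnsubC ?monic_prod_XsubC // => /eqP ers.
have urs : uniq rs by rewrite -separable_prod_XsubC -ers separable_Xn_sub_1.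
have srs : size rs = m.
  by apply: succn_inj; rewrite -(size_prod_XsubC rs id) -ers size_XnsubC.
have unity z : z \in rs -> m.-unity_root z.
  by move=> zrs; rewrite /root_of_unity ers root_prod_XsubC.
have all_unity : all m.-unity_root rs by apply/allP.
have := has_prim_root mgt0 all_unity urs; rewrite srs leqnn => /(_ isT) /hasP[z _ hz].
exists z => //; apply/eqP; rewrite eqEsubv subvf /= -genrs.
apply/Fadjoin_seqP; split=> [|x xrs]; first exact: subv_adjoin.
have /unity_rootP/(prim_rootP hz)[i ->] := unity x xrs.
by rewrite rpredX // memv_adjoin.
Qed.

(** [L] is generated by one primitive root z, which is sent to a root w in [E] of the image of its
    minimal polynomial. *)
Lemma closed_embedding (E : closedFieldType) (q : {rmorphism k -> E}) :
  exists e : {rmorphism L -> E}, forall x, e (in_alg L x) = q x.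
Proof.
have [z _ genz] := splitting_prim_root.
have /polyOver1P[mp emp] := minPolyOver 1 z.
have szmp : size (map_poly q mp) != 1%N.
  rewrite size_map_poly -(size_map_poly (in_alg L)) -emp.
  have := root_size_gt1 (monic_neq0 (monic_minPoly 1 z)) (root_minPoly 1 z).
  by rewrite neq_ltn orbC => ->.
have /closed_rootP[w rw] := szmp.
have ex x : exists r : {poly k}, x = (map_poly (in_alg L) r).[z].
  by apply/Fadjoin1_polyP; rewrite genz memvf.
have wd r r' : (map_poly (in_alg L) r).[z] = (map_poly (in_alg L) r').[z] ->
    (map_poly q r).[w] = (map_poly q r').[w].
  move/eqP; rewrite -subr_eq0 -hornerN -hornerD -rmorphB => rz.
  apply/eqP; rewrite -subr_eq0 -hornerN -hornerD -rmorphB.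
  have : minPoly 1 z %| map_poly (in_alg L) (r - r') by rewrite minPoly_dvdp ?alg_polyOver.
  rewrite emp dvdp_map => /dvdpP[s ->].
  by rewrite rmorphM hornerM (rootP rw) mulr0.
pose e0 x := (map_poly q (sval (cid (ex x)))).[w].
have e0E r : e0 (map_poly (in_alg L) r).[z] = (map_poly q r).[w].
  by apply: wd; rewrite -(svalP (cid (ex _))).
have [||x y|e eE] := @rmorphism_of L E e0.
- move=> x y; have [r ->] := ex x; have [s ->] := ex y.
  by rewrite -hornerN -hornerD -rmorphB !e0E rmorphB hornerD hornerN.
- by have := e0E 1; rewrite !rmorph1 !hornerE.
- have [r ->] := ex x; have [s ->] := ex y.
  by rewrite -hornerM -rmorphM !e0E rmorphM hornerM.
exists e => x; rewrite eE -(hornerC (in_alg L x) z) -map_polyC /= e0E.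
by rewrite map_polyC hornerC.
Qed.
End ClosedEmbedding.

(** * Reduction modulo the maximal ideal and roots of unity of order prime to p *)

Section Reduction.
Variables (p : nat) (O : idomainType) (K k : fieldType).
Variables (iota : {rmorphism O -> K}) (pi : {rmorphism O -> k}).
Variables (Kbar kbar : closedFieldType) (j : {rmorphism K -> Kbar}) (red : Kbar -> kbar).
Hypothesis p_pr : prime p.
Hypothesis pmsP : p_modular_system p iota pi.
Hypothesis redP : reduction (j \o iota) red.
Hypothesis p_gen : generates_jacobson (p%:R : O).

Local Notation emb := (j \o iota).
Local Notation integral := (integralOver emb).

Let p_neq0 : p%:R != 0 :> O.
Proof.
rewrite -(inj_eq (pms_frac_inj pmsP)) rmorph_nat rmorph0; apply/negP=> pK.
by have := pms_char0 pmsP p; rewrite !inE p_pr pK.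
Qed.

Let jac_p : jacobson (p%:R : O).
Proof. by apply/p_gen; exists 1; rewrite mul1r. Qed.

Let p_nonunit y : p%:R * y <> 1 :> O.
Proof.
move=> e; have [_ [S [[[S0 S1 SD] maxS] _ _]]] := pms_dvr pmsP.
have pS : p%:R \in S by apply: jac_p; split.
by case/negP: S1; have := SD y _ _ pS S0; rewrite addr0 mulrC e.
Qed.

(* The inverse is the limit of the geometric series. *)
Lemma one_sub_p_unit (d : O) : exists v, (1 - p%:R * d) * v = 1.
Proof.
pose t := p%:R * d; pose u i : O := \sum_(l < i) t ^+ l.
have [|a aP] := pms_complete pmsP p_gen (u := u).
  by move=> i; exists (d ^+ i); rewrite /u big_ord_recr /= addrAC subrr add0r exprMn mulrC.
(* [S] is the intersection of the ideals p^i O. Its generator g satisfies g = p y g for some y, so g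
   = 0 because p is not a unit. The limit [a] is therefore an exact inverse, not merely one modulo
   every p^i. *)
pose S : {pred O} := fun x => `[< forall i, exists y, x = y * p%:R ^+ i >].
have idS : idealr_closed S.
  split.
  - by apply/asboolP=> i; exists 0; rewrite mul0r.
  - apply/negP=> /asboolP/(_ 1%N)[y e]; apply: (@p_nonunit y).
    by rewrite [RHS]e expr1 mulrC.
  move=> x y z /asboolP ys /asboolP zs; apply/asboolP=> i.
  have [y' ->] := ys i; have [z' ->] := zs i.
  by exists (x * y' + z'); rewrite mulrDl mulrA.
have [g gP] := (pms_dvr pmsP).1 _ idS.
have /asboolP gS : g \in S by apply/gP; exists 1; rewrite mul1r.
have [g' eg] := gS 1%N; rewrite expr1 mulrC in eg.
have g'S : g' \in S.
  apply/asboolP=> i; have [y ey] := gS i.+1; exists y.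
  by apply: (mulfI p_neq0); rewrite -eg ey exprS mulrCA.
have /gP[y ey] := g'S.
have g0 : g = 0.
  apply/eqP; apply: contraT => ng; case: (@p_nonunit y); apply: (mulIf ng).
  by rewrite mul1r -mulrA -ey.
exists a; apply/eqP; rewrite -subr_eq0; apply/eqP.
have /gP[y' ->] : (1 - t) * a - 1 \in S; last by rewrite g0 mulr0.
apply/asboolP=> i; have [z ez] := aP i.
exists ((1 - t) * z - d ^+ i); rewrite [RHS]mulrBl -mulrA [d ^+ i * _]mulrC -exprMn -/t.
have -> : a = u i + z * p%:R ^+ i by rewrite -ez addrC subrK.
have -> : (1 - t) * (u i + z * p%:R ^+ i) = 1 - t ^+ i + (1 - t) * (z * p%:R ^+ i).
  by rewrite mulrDr; congr (_ + _); rewrite -[LHS]opprK -mulNr opprB -subrX1 opprB.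
by rewrite addrAC [1 - _]addrC addrK addrC.
Qed.

Let int_O a : integral (emb a).
Proof. exact: (integral_id (j \o iota)). Qed.

Let rho a := red (emb a).

Let rhoD : {morph rho : x y / x + y >-> x + y}.
Proof. by move=> x y; rewrite /rho /= !rmorphD (redD redP) //; apply: int_O. Qed.

Let rhoM : {morph rho : x y / x * y >-> x * y}.
Proof. by move=> x y; rewrite /rho /= !rmorphM (redM redP) //; apply: int_O. Qed.

Let rho1 : rho 1 = 1.
Proof. by rewrite /rho /= !rmorph1 (red1 redP). Qed.

Let rho_rmorph : exists r : {rmorphism O -> kbar}, r =1 rho.
Proof.
have rho0 : rho 0 = 0 by apply: (addrI (rho 0)); rewrite -rhoD !addr0.
have rhoN x : rho (- x) = - rho x.
  by apply/eqP; rewrite -addr_eq0 -rhoD addNr rho0.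
by apply: rmorphism_of => // x y; rewrite rhoD rhoN.
Qed.

Lemma integralX n x : integral x -> integral (x ^+ n).
Proof.
move=> ix; elim: n => [|n IH]; first exact: (integral1 (j \o iota)).
by rewrite exprS; apply: (integral_mul (RtoK := j \o iota)).
Qed.

Lemma redX n x : integral x -> red (x ^+ n) = red x ^+ n.
Proof.
move=> ix; elim: n => [|n IH]; first by rewrite !expr0 (red1 redP).
by rewrite !exprS (redM redP) ?IH //; apply: integralX.
Qed.

Lemma red0 : red 0 = 0.
Proof.
have i0 := integral0 (j \o iota).
by apply: (addrI (red 0)); rewrite -(redD redP) ?addr0.
Qed.

Lemma integral_sum_seq (I : eqType) (s : seq I) (x : I -> Kbar) :
  (forall i, i \in s -> integral (x i)) -> integral (\sum_(i <- s) x i).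
Proof.
elim: s => [_|i s IH xs]; first by rewrite big_nil; apply: (integral0 (j \o iota)).
rewrite big_cons; apply: (integral_add (RtoK := j \o iota)).
  exact/xs/mem_head.
by apply: IH => l ls; apply: xs; rewrite inE ls orbT.
Qed.

Lemma red_sum (I : eqType) (s : seq I) (x : I -> Kbar) :
  (forall i, i \in s -> integral (x i)) ->
  red (\sum_(i <- s) x i) = \sum_(i <- s) red (x i).
Proof.
elim: s => [_|i s IH xs]; first by rewrite !big_nil red0.
have xs' l : l \in s -> integral (x l) by move=> ls; apply: xs; rewrite inE ls orbT.
rewrite !big_cons (redD redP) ?IH //; first exact/xs/mem_head.
exact: integral_sum_seq.
Qed.

(* [reduction] does not mention p.  If p were invertible in kbar, a monic equation over
   O for a preimage y of 1/p, multiplied by p^n, would produce an element of the form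
   1 + p d, a unit of O, in the kernel of red. *)
Lemma char_kbar : p \in [pchar kbar].
Proof.
have [r rE] := rho_rmorph.
rewrite inE p_pr; apply: contraT => /negP np.
have nz : p%:R != 0 :> kbar by apply/negP.
have [y [q mq /rootP ry] ey] := red_surj redP (p%:R)^-1.
have iy : integral y by exists q => //; apply/rootP.
pose n := (size q).-1; have sq : size q = n.+1.
  by rewrite /n prednK // lt0n size_poly_eq0 monic_neq0.
have mapq : (map_poly r q).[(p%:R)^-1] = 0.
  rewrite -ey horner_coef size_map_poly_id0; last first.
    by rewrite (monicP mq) rmorph1 oner_eq0.
  move: ry; rewrite horner_coef size_map_poly_id0; last first.
    by rewrite (monicP mq) /= !rmorph1 oner_eq0.
  move/(congr1 red); rewrite red0 red_sum => [e0|i _]; last first.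
    rewrite coef_map; apply: (integral_mul (RtoK := j \o iota)); first exact: int_O.
    exact: integralX.
  rewrite -[RHS]e0; apply: eq_bigr => i _; rewrite !coef_map (redM redP).
  - by rewrite redX //; congr (_ * _); apply: rE.
  - exact: int_O.
  exact: integralX.
pose d : O := \sum_(i < n) q`_i * p%:R ^+ (n - i.+1).
have : r (1 - p%:R * - d) = 0.
  rewrite mulrN opprK rmorphD rmorph1 rmorphM rmorph_nat rmorph_sum mulr_sumr.
  move: mapq; rewrite horner_coef size_map_poly_id0; last first.
    by rewrite (monicP mq) rmorph1 oner_eq0.
  rewrite sq big_ord_recr /= => /(congr1 (fun x => p%:R ^+ n * x)).
  rewrite mulr0 mulrDr => {2}<-; rewrite addrC; congr (_ + _).
    rewrite mulr_sumr; apply: eq_bigr => i _.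
    rewrite rmorphM rmorphXn rmorph_nat coef_map mulrCA [RHS]mulrCA; congr (_ * _).
    rewrite -exprS -subSn // subSS exprVn.
    have pi0 : p%:R ^+ i != 0 :> kbar by rewrite expf_neq0.
    by apply: (mulIf pi0); rewrite -exprD subnK ?divfK // ltnW.
  have qn : q`_n = 1 by rewrite -(monicP mq) lead_coefE.
  by rewrite coef_map /= qn rmorph1 mul1r exprVn mulfV // expf_neq0.
have [v ev] := one_sub_p_unit (- d).
move=> r0; have := congr1 r ev; rewrite rmorphM r0 mul0r rmorph1 => /eqP.
by rewrite eq_sym oner_eq0.
Qed.

(** The kernel of [pi] is J(O) = pO, [O] being absolutely unramified, and p vanishes in [kbar] by
    [char_kbar]; so the reduction on [O] factors through [k]. *)
Lemma residue_embedding : exists q : {rmorphism k -> kbar}, forall a, q (pi a) = red (emb a).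
Proof.
have [r rE] := rho_rmorph.
have wd a b : pi a = pi b -> r a = r b.
  move/eqP; rewrite -subr_eq0 -rmorphB => /eqP/(pms_residue_ker pmsP)/p_gen[y e].
  apply/eqP; rewrite -subr_eq0 -rmorphB e rmorphM rmorph_nat.
  by rewrite (pcharf0 char_kbar) mulr0.
pose s x := sval (cid (pms_residue_surj pmsP x)).
have sE x : pi (s x) = x by apply: (svalP (cid (pms_residue_surj pmsP x))).
have [||x y|q qE] := @rmorphism_of k kbar (fun x => r (s x)).
- by move=> x y; rewrite -rmorphB; apply: wd; rewrite rmorphB !sE.
- by rewrite -(rmorph1 r); apply: wd; rewrite sE rmorph1.
- by rewrite -rmorphM; apply: wd; rewrite rmorphM !sE.
by exists q => a; rewrite qE -[RHS]rE; apply: wd; rewrite sE.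
Qed.

Lemma unity_integral m z : (0 < m)%N -> z ^+ m = 1 -> integral z.
Proof.
move=> m0 zm; exists ('X^m - 1); first exact: monicXnsubC.
by rewrite rmorphB /= map_polyXn rmorph1 rootE !hornerE zm subrr.
Qed.

Lemma p'_neq0 (F : fieldType) m : p \in [pchar F] -> ~~ (p %| m)%N -> m%:R != 0 :> F.
Proof. by move=> charF; rewrite (dvdn_pcharf charF). Qed.

(** If z differs from 1, then 1 + z + ... + z^(m-1) = 0, which reduces to m = 0 in [kbar]. *)
Lemma red_unity_inj1 m z : ~~ (p %| m)%N -> z ^+ m = 1 -> red z = 1 -> z = 1.
Proof.
move=> pm zm rz; have m0 : (0 < m)%N by case: (m) pm => //; rewrite dvdn0.
have iz := unity_integral m0 zm.
apply/eqP; apply: contraT => nz1.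
have s0 : \sum_(i < m) z ^+ i = 0.
  by apply/eqP; have /eqP := subrX1 z m; rewrite zm subrr eq_sym mulf_eq0 subr_eq0 (negPf nz1).
have := congr1 red s0; rewrite red0 red_sum => [|i _]; last exact: integralX.
under eq_bigr do rewrite redX // rz expr1n.
rewrite sumr_const card_ord => /eqP.
by rewrite (negPf (p'_neq0 char_kbar pm)).
Qed.

Lemma red_unity_inj m m' z z' : ~~ (p %| m)%N -> ~~ (p %| m')%N ->
  z ^+ m = 1 -> z' ^+ m' = 1 -> red z = red z' -> z = z'.
Proof.
move=> pm pm' zm zm' e.
have m'0 : (0 < m')%N by case: (m') pm' => //; rewrite dvdn0.
have m0 : (0 < m)%N by case: (m) pm => //; rewrite dvdn0.
have iz := unity_integral m0 zm; have iz' := unity_integral m'0 zm'.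
have nz' : z' != 0.
  by apply/eqP=> z0; move/eqP: zm'; rewrite z0 expr0n eqn0Ngt m'0 eq_sym oner_eq0.
have zV : z' * z' ^+ m'.-1 = 1 by rewrite -exprS prednK.
have : z * z' ^+ m'.-1 = 1.
  apply: (@red_unity_inj1 (m * m')%N).
  - by rewrite Euclid_dvdM // negb_or pm.
  - rewrite exprMn [in X in X * _]exprM zm expr1n mul1r -exprM.
    by rewrite [(m * m')%N]mulnC mulnCA exprM zm' expr1n.
  rewrite (redM redP) ?redX //; last exact: integralX.
  by rewrite e -exprS prednK // -redX // zm' (red1 redP).
by move/(congr1 (fun x => x * z')); rewrite -mulrA [_ * z']mulrC zV mulr1 mul1r.
Qed.

(** By [red_unity_inj1] a primitive m-th root of unity stays primitive under reduction, so x is a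
    power of its image. *)
Lemma unity_lift m (x : kbar) : ~~ (p %| m)%N -> x ^+ m = 1 -> exists2 z, z ^+ m = 1 & red z = x.
Proof.
move=> pm xm; have m0 : (0 < m)%N by case: (m) pm => //; rewrite dvdn0.
have mK : m%:R != 0 :> Kbar.
  rewrite -(rmorph_nat (j \o iota)) -(rmorph0 (j \o iota)) /= (inj_eq (fmorph_inj j)).
  rewrite (inj_eq (pms_frac_inj pmsP)); apply/negP=> /eqP mO.
  have := congr1 iota mO; rewrite rmorph_nat rmorph0 => mK.
  have /(pcharf0P K) charK := pms_char0 pmsP.
  by move: m0; rewrite lt0n -charK mK eqxx.
have [z hz] := closed_prim_root mK; have zm := prim_expr_order hz.
have iz := unity_integral m0 zm.
have hr : m.-primitive_root (red z).
  have rzm : red z ^+ m = 1 by rewrite -redX // zm (red1 redP).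
  have [l hl lm] := prim_order_exists m0 rzm.
  have zl : z ^+ l = 1.
    apply: (@red_unity_inj1 m); rewrite ?redX ?(prim_expr_order hl) //.
    by rewrite exprAC zm expr1n.
  have : (m %| l)%N by rewrite (prim_order_dvd hz) zl.
  by move=> ml; have /eqP -> : m == l by rewrite eqn_dvd ml.
have [i ->] := prim_rootP hr xm.
exists (z ^+ i); first by rewrite exprAC zm expr1n.
by rewrite redX.
Qed.

End Reduction.

(** * Frobenius powers and the prime field *)

Section Frobenius.
Variables (p : nat) (F : fieldType).
Hypothesis charF : p \in [pchar F].

Fact frobenius_rmorphism u : exists f : {rmorphism F -> F}, f =1 fun x => x ^+ (p ^ u).
Proof.
have fB v (x y : F) : (x - y) ^+ (p ^ v) = x ^+ (p ^ v) - y ^+ (p ^ v).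
  elim: v => [|v IH]; first by rewrite !expr1.
  by rewrite expnSr !exprM IH -!(pFrobenius_autE charF) rmorphB.
apply: rmorphism_of => [x y||x y]; [exact: fB | exact: expr1n | exact: exprMn].
Qed.
Definition frobenius u : {rmorphism F -> F} := sval (cid (frobenius_rmorphism u)).

Lemma frobeniusE u x : frobenius u x = x ^+ (p ^ u).
Proof. exact: (svalP (cid (frobenius_rmorphism u))). Qed.

Lemma unity_p'part n (x : F) : (0 < n)%N -> x ^+ n = 1 -> x ^+ n`_p^' = 1.
Proof.
move=> n0; rewrite -{1}(partnC p n0) p_part mulnC exprM -frobeniusE.
by rewrite -[RHS](rmorph1 (frobenius (logn p n))) => /fmorph_inj.
Qed.

Lemma mxtrace_exp_pchar d (A : 'M[F]_d) u : \tr (A ^+ (p ^ u)) = \tr A ^+ (p ^ u).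
Proof.
elim: u => [|u IH]; first by rewrite !expr1.
rewrite expnSr !exprM -IH; set B := A ^+ _.
have -> : \tr (B ^+ p) = \sum_i B i i ^+ p.
  by apply: (trace_mx_exp_pchar charF (f := idfun)) => // a b; rewrite /= mulrC.
rewrite -(pFrobenius_autE charF) rmorph_sum; apply: eq_bigr => i _.
by rewrite /= pFrobenius_autE.
Qed.

Lemma natr_inj_ord (l l' : 'I_p) : l%:R = l'%:R :> F -> l = l'.
Proof.
move=> e; apply: val_inj.
wlog ll : l l' e / (l <= l')%N => [H|].
  by case: (leqP l l') => ll; [apply: H | apply/esym/H => //; apply: ltnW].
apply/eqP; rewrite eqn_leq ll -subn_eq0 /=.
have : (p %| l' - l)%N by rewrite (dvdn_pcharf charF) natrB // e subrr.
case: (posnP (l' - l)) => [->//|gt0 /(dvdn_leq gt0)].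
by rewrite leqNgt (leq_ltn_trans (leq_subr _ _)).
Qed.
(** The p elements of the prime field already exhaust the roots of X^p - X. *)
Lemma expp_natr (x : F) : x ^+ p = x -> exists l : 'I_p, x = l%:R.
Proof.
move=> xp; have p_pr := pcharf_prime charF.
pose q : {poly F} := 'X^p - 'X.
have sq : size q = p.+1.
  by rewrite size_polyDl ?size_polyXn // size_polyN size_polyX ltnS prime_gt1.
pose rs : seq F := [seq (l : nat)%:R | l : 'I_p].
have urs : uniq rs by rewrite map_inj_uniq ?enum_uniq //; apply: natr_inj_ord.
have rrs (y : F) : y ^+ p = y -> root q y.
  by move=> yp; rewrite rootE !hornerE yp subrr.
have frs : all (root q) rs.
  by apply/allP=> _ /mapP[l _ ->]; apply: rrs; rewrite -(pFrobenius_autE charF) rmorph_nat.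
have q0 : q != 0 by rewrite -size_poly_eq0 sq.
apply: contrapT => nx; have := max_poly_roots q0 (rs := x :: rs).
rewrite /= rrs // frs urs andbT sq /= size_map size_enum_ord ltnn.
have -> : x \notin rs by apply/negP=> /mapP[l _ e]; apply: nx; exists l.
by move=> /(_ isT isT).
Qed.

End Frobenius.

(** * Eigenvalues with multiplicity *)

Section Spectrum.
Variable F : closedFieldType.

Definition spectrum d (A : 'M[F]_d) : seq F :=
  sval (closed_field_poly_normal (char_poly A)).

Lemma spectrumE d (A : 'M[F]_d) : char_poly A = \prod_(x <- spectrum A) ('X - x%:P).
Proof.
rewrite {1}(svalP (closed_field_poly_normal (char_poly A))) -/(spectrum A).
by rewrite (monicP (char_poly_monic A)) scale1r.
Qed.

Lemma size_spectrum d (A : 'M[F]_d) : size (spectrum A) = d.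
Proof. by apply: succn_inj; rewrite -(size_prod_XsubC _ id) -spectrumE size_char_poly. Qed.

Lemma spectrum_trace d (A : 'M[F]_d) : \tr A = \sum_(x <- spectrum A) x.
Proof.
have [d0|d0] := posnP d.
  rewrite /mxtrace big1 => [|i _]; last by have := ltn_ord i; rewrite [X in (_ < X)%N]d0.
  by case: (spectrum A) (size_spectrum A) => [|? ?]; rewrite ?big_nil // d0.
apply: oppr_inj; rewrite -char_poly_trace // spectrumE -{2}(size_spectrum A).
by rewrite coefPn_prod_XsubC // size_spectrum -lt0n.
Qed.

Lemma spectrum_perm_eq d (A : 'M[F]_d) (s : seq F) :
  char_poly A = \prod_(x <- s) ('X - x%:P) -> perm_eq (spectrum A) s.
Proof. by rewrite spectrumE => /prod_XsubC_eq. Qed.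

Lemma spectrum_unity d (A : 'M[F]_d) n x : A ^+ n = 1 -> x \in spectrum A -> x ^+ n = 1.
Proof.
move=> An; rewrite -root_prod_XsubC -spectrumE -eigenvalue_root_char => /eigenvalueP[v vA nv].
have : v *m A ^+ n = x ^+ n *: v.
  elim: {An} n => [|n IH]; first by rewrite mulmx1 scale1r.
  by rewrite exprSr -mulmxE mulmxA IH -scalemxAl vA scalerA -exprSr.
rewrite An mulmx1 -{1}[v]scale1r => /eqP; rewrite -subr_eq0 -scalerBl scaler_eq0 (negPf nv) orbF.
by rewrite subr_eq0 eq_sym => /eqP.
Qed.

Lemma spectrum_map d (A : 'M[F]_d) (f : {rmorphism F -> F}) :
  perm_eq (spectrum (map_mx f A)) (map f (spectrum A)).
Proof.
apply: prod_XsubC_eq; rewrite -spectrumE -map_char_poly spectrumE.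
by rewrite map_prod_XsubC big_map.
Qed.

Lemma spectrum_rsim (G : finGroupType) d (rG : mx_representation F [set: G] d) d'
    (rG' : mx_representation F [set: G] d') g :
  mx_rsim rG rG' -> perm_eq (spectrum (rG g)) (spectrum (rG' g)).
Proof.
case=> B ed; case: _ / ed in rG' B * => freeB hB.
apply: prod_XsubC_eq; rewrite -!spectrumE /char_poly.
have detB : \det (map_mx polyC B) != 0.
  by rewrite det_map_mx polyC_eq0 -unitfE -unitmxE -row_free_unit.
apply: (mulIf detB); rewrite -det_mulmx [RHS]mulrC -det_mulmx; congr (\det _).
rewrite /char_poly_mx mulmxBl mulmxBr -!map_mxM /= hB ?in_setT //.
by rewrite scalar_mxC.
Qed.
End Spectrum.

(** * Brauer characters of a block *)

(* bc_char enumerates the irreducible Brauer characters of a block, bc_perm is the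
   action on them of the automorphism raising p'-roots of unity to the power p ^ u0,
   and bc_trace c is the linear combination of the corresponding kbar-characters with
   coefficients c in F_p, encoded as 'I_p. *)
Record block_coordinates (p n u0 : nat) (Kbar : closedFieldType) (G : finGroupType)
    (IB : set {ffun p_regular p G -> Kbar}) (A : Type) (F : fieldType)
    (V : (A -> F) -> Prop) (tau : F -> F) : Type := BlockCoordinates {
  bc_index : finType;
  bc_char : bc_index -> {ffun p_regular p G -> Kbar};
  bc_perm : {perm bc_index};
  bc_trace : {ffun bc_index -> 'I_p} -> A -> F;
  bc_char_inj : injective bc_char;
  bc_charP : forall phi, IB phi <-> exists i, phi = bc_char i;
  bc_galois : forall sigma l i, cyclotomic_automorphism n sigma ->
    power_on_p'_roots p n sigma (l * u0) ->
    galois_act sigma (bc_char i) = bc_char ((bc_perm ^+ l)%g i);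
  bc_traceP : forall c, V (bc_trace c);
  bc_trace_onto : forall f, V f -> exists c, f =1 bc_trace c;
  bc_trace_inj : forall c c', bc_trace c =1 bc_trace c' -> c = c';
  bc_trace_tau : forall c,
    tau \o bc_trace c =1 bc_trace [ffun i => c ((bc_perm^-1)%g i)] }.

Arguments bc_char {p n u0 Kbar G IB A F V tau} b i.
Arguments bc_trace {p n u0 Kbar G IB A F V tau} b c x.
Arguments bc_char_inj {p n u0 Kbar G IB A F V tau} b i i' : rename.
Arguments bc_charP {p n u0 Kbar G IB A F V tau} b phi.
Arguments bc_galois {p n u0 Kbar G IB A F V tau} b sigma l i.
Arguments bc_traceP {p n u0 Kbar G IB A F V tau} b c.
Arguments bc_trace_onto {p n u0 Kbar G IB A F V tau} b f.
Arguments bc_trace_inj {p n u0 Kbar G IB A F V tau} b c c'.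
Arguments bc_trace_tau {p n u0 Kbar G IB A F V tau} b c.

Section BlockCoordinates.
Variables (p : nat) (O : idomainType) (K k : fieldType).
Variables (iota : {rmorphism O -> K}) (pi : {rmorphism O -> k}).
Variables (Kbar kbar : closedFieldType) (j : {rmorphism K -> Kbar}) (red : Kbar -> kbar).
Hypothesis p_pr : prime p.
Hypothesis pmsP : p_modular_system p iota pi.
Hypothesis redP : reduction (j \o iota) red.
Hypothesis p_gen : generates_jacobson (p%:R : O).
Variables (n : nat) (k' : splittingFieldType k).
Hypothesis n_gt0 : (0 < n)%N.
Hypothesis splitP : splittingFieldFor 1 ('X^(n`_p^') - 1 : {poly k'}) fullv.
Variables (q : {rmorphism k -> kbar}) (e : {rmorphism k' -> kbar}).
Hypothesis qE : forall a, q (pi a) = red ((j \o iota) a).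
Hypothesis eE : forall x, e (in_alg k' x) = q x.
Variables (u0 : nat) (tau : {rmorphism k' -> k'}).
Hypothesis tau_alg : forall x, tau (in_alg k' x) = in_alg k' x.
Hypothesis tau_unity : forall eta, eta ^+ n`_p^' = 1 -> tau eta = eta ^+ (p ^ u0).
Variable G : finGroupType.
Hypothesis G_dvd : (#|G| %| n)%N.

Local Notation m := (n`_p^')%N.
Local Notation emb := (j \o iota).

Let char_kb : p \in [pchar kbar]. Proof. exact: (char_kbar p_pr pmsP redP p_gen). Qed.
Let char_k' : p \in [pchar k'].
Proof. by have := char_kb; rewrite -(fmorph_pchar e). Qed.

Let p_ndvd_m : ~~ (p %| m)%N.
Proof.
have := part_pnat p^' n; rewrite -prime_coprime //.
by move/(pnat_coprime (pnat_id p_pr)).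
Qed.

Let m_gt0 : (0 < m)%N. Proof. exact: part_gt0. Qed.

Lemma repr_mx_expn d (rG : mx_representation kbar [set: G] d) g l :
  rG (g ^+ l)%g = rG g ^+ l.
Proof.
elim: l => [|l IH]; first by rewrite expg0 repr_mx1.
by rewrite expgS exprS repr_mxM ?in_setT ?IH.
Qed.

Lemma expg_n (g : G) : (g ^+ n)%g = 1%g.
Proof.
case/dvdnP: G_dvd => l ->.
by rewrite mulnC expgM -cardsT expg_cardG ?in_setT // expg1n.
Qed.

Lemma spectrum_repr_unity d (rG : mx_representation kbar [set: G] d) g x :
  x \in spectrum (rG g) -> x ^+ m = 1.
Proof.
move=> xs; apply: (unity_p'part char_kb n_gt0); apply: (spectrum_unity _ xs).
by rewrite -repr_mx_expn expg_n repr_mx1.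
Qed.

Lemma unity_lift_fun : exists tl : kbar -> Kbar,
  forall x, x ^+ m = 1 -> tl x ^+ m = 1 /\ red (tl x) = x.
Proof.
(* The default 0 is arbitrary: lifts are only ever taken of m-th roots of unity. *)
exists (fun x => match pselect (x ^+ m = 1) with
  | left xm => s2val (cid2 (unity_lift p_pr pmsP redP p_gen p_ndvd_m xm))
  | right _ => 0 end) => x xm.
by case: pselect => // xm'; case: (cid2 _).
Qed.
Let tl : kbar -> Kbar := sval (cid unity_lift_fun).
Let tl_unity x : x ^+ m = 1 -> tl x ^+ m = 1.
Proof. by move/(svalP (cid unity_lift_fun)) => []. Qed.
Let tlK x : x ^+ m = 1 -> red (tl x) = x.
Proof. by move/(svalP (cid unity_lift_fun)) => []. Qed.

Let red_tl z : p'_root_of_unity p z -> red z ^+ m = 1 -> tl (red z) = z.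
Proof.
case=> m' pm' zm' rm.
apply: (red_unity_inj p_pr pmsP redP p_gen p_ndvd_m pm') => //; first exact: tl_unity.
by rewrite tlK.
Qed.

Let tl_X x l : x ^+ m = 1 -> tl (x ^+ l) = tl x ^+ l.
Proof.
move=> xm; have xlm : (x ^+ l) ^+ m = 1 by rewrite exprAC xm expr1n.
apply: (red_unity_inj p_pr pmsP redP p_gen p_ndvd_m p_ndvd_m); rewrite ?tl_unity //.
  by rewrite exprAC tl_unity // expr1n.
by rewrite (redX redP) ?tlK //; apply: unity_integral m_gt0 (tl_unity xm).
Qed.

(** The list in [is_Brauer_character] is forced up to order: the characteristic polynomial
    determines the eigenvalues, and a lift of order prime to p is unique. *)
Lemma Brauer_characterP d (rG : mx_representation kbar [set: G] d) phi :
  is_Brauer_character red rG phi <->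
  forall g : p_regular p G, phi g = \sum_(x <- spectrum (rG (val g))) tl x.
Proof.
split=> [Bphi g|Bphi g].
  have [s [s_unity s_poly ->]] := Bphi g.
  have eqs : perm_eq (spectrum (rG (val g))) (map red s).
    by apply: spectrum_perm_eq; rewrite big_map.
  rewrite (perm_big _ eqs) big_map /= [LHS]big_seq [RHS]big_seq; apply: eq_bigr => z zs.
  rewrite red_tl //; first exact: s_unity.
  by apply: (@spectrum_repr_unity _ rG (val g)); rewrite (perm_mem eqs) map_f.
exists (map tl (spectrum (rG (val g)))); split=> [z /mapP[x xs ->]||].
- by exists m => //; apply/tl_unity/(spectrum_repr_unity xs).
- rewrite spectrumE big_map [LHS]big_seq [RHS]big_seq; apply: eq_bigr => x xs.
  by rewrite tlK // (spectrum_repr_unity xs).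
by rewrite Bphi big_map.
Qed.

Lemma Brauer_character_red d (rG : mx_representation kbar [set: G] d) phi
    (g : p_regular p G) :
  is_Brauer_character red rG phi -> red (phi g) = \tr (rG (val g)).
Proof.
move/Brauer_characterP=> ->; rewrite spectrum_trace (red_sum redP) => [|x xs].
  rewrite [LHS]big_seq [RHS]big_seq; apply: eq_bigr => x xs.
  by rewrite tlK // (spectrum_repr_unity xs).
by apply: unity_integral m_gt0 _; apply/tl_unity/(spectrum_repr_unity xs).
Qed.

(** With p^a the p-part of n, the element g^(p^a) is p-regular and its trace is the p^a-th power of
    the trace of g; Frobenius is injective. *)
Lemma mxtrace_p_regular d d' (rG : mx_representation kbar [set: G] d)
    (rG' : mx_representation kbar [set: G] d') :
  (forall g : p_regular p G, \tr (rG (val g)) = \tr (rG' (val g))) ->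
  forall g, \tr (rG g) = \tr (rG' g).
Proof.
move=> eq_tr g; pose h := (g ^+ (p ^ logn p n))%g.
have hreg : (p^'.-elt h)%g.
  have hm : (h ^+ m)%g = 1%g by rewrite -expgM -p_part partnC // expg_n.
  by apply: pnat_dvd (part_pnat p^' n); rewrite order_dvdn hm.
have := eq_tr (exist _ h hreg); rewrite /= /h !repr_mx_expn !(mxtrace_exp_pchar char_kb).
by rewrite -!(frobeniusE char_kb) => /fmorph_inj.
Qed.

(* [tl] lifts roots of unity of order dividing m from kbar to Kbar. *)
Lemma cyclotomic_sum (s : seq kbar) sigma u :
  (forall x, x \in s -> x ^+ m = 1) -> cyclotomic_automorphism n sigma ->
  power_on_p'_roots p n sigma u ->
  sigma (\sum_(x <- s) tl x) = \sum_(x <- s) tl (x ^+ (p ^ u)).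
Proof.
move=> s_unity cyc pow.
have cyc_unity x : x ^+ m = 1 -> cyclotomic_subfield n (tl x).
  move=> xm S _ rootS; apply: rootS.
  by rewrite -(partnC p n_gt0) mulnC exprM tl_unity // expr1n.
(* [sigma] is additive only on Q_n, so the partial sums must be shown to stay there. *)
have cyc_sum (r : seq kbar) : (forall x, x \in r -> x ^+ m = 1) ->
    cyclotomic_subfield n (\sum_(x <- r) tl x).
  elim: r => [_|x r IH r_unity] S divS rootS.
    rewrite big_nil; have S1 : 1 \in S by apply: rootS; rewrite expr1n.
    by have [_ SB _] := divS; rewrite -(subrr 1) SB.
  have [S1 SB _] := divS.
  have xS : tl x \in S by apply: (cyc_unity _ (r_unity x (mem_head x r))).
  have rS : \sum_(y <- r) tl y \in S.
    by apply: IH => // y yr; apply: r_unity; rewrite inE yr orbT.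
  have S0 : 0 \in S by rewrite -(subrr 1) SB.
  by rewrite big_cons -[\sum_(_ <- _) _]opprK SB // -[- _]sub0r SB.
elim: s s_unity => [_|x s IH s_unity].
  by rewrite !big_nil; have := cycl_Q cyc 0; rewrite /ratr (_ : numq 0 = 0) // mulr0z mul0r.
have xm : x ^+ m = 1 by apply: s_unity; rewrite mem_head.
have sm y : y \in s -> y ^+ m = 1 by move=> ys; apply: s_unity; rewrite inE ys orbT.
rewrite !big_cons (cycl_D cyc) ?IH //; [|exact: cyc_unity|exact: cyc_sum].
by rewrite pow ?tl_X ?tl_unity.
Qed.

Let k'_unity x : x ^+ m = 1 -> exists2 eta, eta ^+ m = 1 & e eta = x.
Proof.
have m_neq0 : m%:R != 0 :> k by apply: p'_neq0 (pms_charp pmsP) p_ndvd_m.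
have [z hz _] := splitting_prim_root m_neq0 splitP.
have hez : m.-primitive_root (e z) by rewrite fmorph_primitive_root.
move=> /(prim_rootP hez)[i ->]; exists (z ^+ i); last by rewrite rmorphXn.
by rewrite exprAC (prim_expr_order hz) expr1n.
Qed.

(** A trace is a sum of m-th roots of unity, all of which come from [k'], and on those [tau] is the
    power map with exponent p^u0. *)
Let trace_lift d (rG : mx_representation kbar [set: G] d) g :
  exists w, e w = \tr (rG g) /\ tau w = w ^+ (p ^ u0).
Proof.
rewrite spectrum_trace; have : forall x, x \in spectrum (rG g) -> x ^+ m = 1.
  by move=> x; apply: spectrum_repr_unity.
elim: (spectrum (rG g)) => [_|x s IH s_unity].
  by exists 0; rewrite big_nil !rmorph0 -(frobeniusE char_k') rmorph0.
have [|w [ew tw]] := IH; first by move=> y ys; apply: s_unity; rewrite inE ys orbT.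
have [eta etam ex] := k'_unity (s_unity x (mem_head x s)).
exists (eta + w); rewrite big_cons !rmorphD ex ew tw tau_unity //.
by rewrite -!(frobeniusE char_k') rmorphD.
Qed.

Let twist d (rG : mx_representation kbar [set: G] d) :=
  map_repr (frobenius char_kb u0) rG.

Let twist_irr d (rG : mx_representation kbar [set: G] d) :
  mx_irreducible rG -> mx_irreducible (twist rG).
Proof.
move=> irrG; apply: mx_abs_irrW; rewrite map_mx_abs_irr.
exact: (group_closure_closed_field irrG).
Qed.

Let twist_trace d (rG : mx_representation kbar [set: G] d) g :
  \tr (twist rG g) = \tr (rG g) ^+ (p ^ u0).
Proof. by rewrite map_reprE trace_map_mx; apply: frobeniusE. Qed.

Let wl d (rG : mx_representation kbar [set: G] d) g : k' := sval (cid (trace_lift rG g)).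
Let wlE d rG g : e (@wl d rG g) = \tr (rG g).
Proof. by case: (svalP (cid (trace_lift rG g))). Qed.
Let wl_tau d rG g : tau (@wl d rG g) = @wl d rG g ^+ (p ^ u0).
Proof. by case: (svalP (cid (trace_lift rG g))). Qed.

Local Notation OG := (group_algebra O G).
Local Notation kG := (group_algebra kbar G).

Definition push (x : OG) : kG := ([ffun g => q (pi (coefg x g))] : {ffun G -> kbar}).

Lemma coefg_push x g : coefg (push x) g = q (pi (coefg x g)).
Proof. by rewrite {1}/coefg ffunE. Qed.

Lemma pushD x y : push (x + y) = push x + push y.
Proof. by apply: coefgP => g; rewrite !(coefgD, coefg_push) !rmorphD. Qed.

Lemma pushZ a x : push (a *: x) = q (pi a) *: push x.
Proof. by apply: coefgP => g; rewrite !(coefgZ, coefg_push) !rmorphM. Qed.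

Lemma pushM x y : push (x * y) = push x * push y.
Proof.
apply: coefgP => g; rewrite coefg_push !coefgM !rmorph_sum; apply: eq_bigr => h _.
by rewrite !coefg_push !rmorphM.
Qed.

Lemma push_elt g : push (ga_elt O g) = ga_elt kbar g.
Proof. by apply: coefgP => h; rewrite coefg_push !coefg_elt !rmorph_nat. Qed.

Lemma pushX x l : push (x ^+ l.+1) = push x ^+ l.+1.
Proof. by elim: l => [|l IH]; rewrite ?expr1 // exprS pushM IH -exprS. Qed.

Let tr_push d (rG : mx_representation kbar [set: G] d) x :
  \tr (ext rG (push x)) = \sum_g q (pi (coefg x g)) * \tr (rG g).
Proof.
rewrite /ext raddf_sum; apply: eq_bigr => g _.
by rewrite /= mxtraceZ coefg_push.
Qed.

(** The character of the reduced representation, brought down from [kbar] to [k'] so that [tau] can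
    be applied to it. *)
Let chi d (rG : mx_representation kbar [set: G] d) (x : OG) : k' :=
  \sum_g in_alg k' (pi (coefg x g)) * wl rG g.

Let chiE d rG x : e (@chi d rG x) = \tr (ext rG (push x)).
Proof.
by rewrite tr_push rmorph_sum; apply: eq_bigr => g _; rewrite rmorphM wlE eE.
Qed.

Let chi_tau d rG x : e (tau (@chi d rG x)) = \tr (ext (twist rG) (push x)).
Proof.
rewrite tr_push !rmorph_sum; apply: eq_bigr => g _.
by rewrite !rmorphM tau_alg eE wl_tau twist_trace -wlE rmorphXn.
Qed.

Variables (I : finType) (r : I -> irrep kbar G).
Hypothesis rP : irr_family r.

Let irr_trace_inj i i' : (forall g, \tr (r i g) = \tr (r i' g)) -> i = i'.
Proof.
move=> eq_tr; have [a aP] := irr_trace_free rP i.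
have : \tr (ext (r i) a) = \tr (ext (r i') a).
  rewrite /ext !raddf_sum; apply: eq_bigr => g _.
  by rewrite /= !mxtraceZ eq_tr.
rewrite !aP eqxx; case: (eqVneq i' i) => [->//|_ /eqP].
by rewrite oner_eq0.
Qed.

Variables (b : OG) (hb : block_idempotent b).

Let bC : central b. Proof. by case: hb => -[]. Qed.
Let bb : b * b = b. Proof. by case: hb => -[]. Qed.

Let inb d (rG : mx_representation kbar [set: G] d) : Prop := ext rG (push b) = 1%:M.

(** By Schur's lemma the central idempotent acts as a scalar c with c^2 = c. *)
Let block_dichotomy (s : irrep kbar G) : inb s \/ ext s (push b) = 0.
Proof.
have absG := group_closure_closed_field (irmxP s).
have /(mx_abs_irr_cent_scalar absG)/is_scalar_mxP[c cE] : centgmx s (ext s (push b)).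
  by apply/centgmxP=> g _; rewrite -(ext_elt s) -!extM -push_elt -!pushM bC.
have cc : c * c = c.
  have := congr1 (fun M : 'M_(irdim s) => M (Ordinal (irdim_gt0 s)) (Ordinal (irdim_gt0 s)))
    (extM s (push b) (push b)).
  by rewrite -pushM bb cE -scalar_mxM !mxE eqxx !mulr1n => <-.
have /eqP : c * (c - 1) = 0 by rewrite mulrBr cc mulr1 subrr.
rewrite mulf_eq0 subr_eq0 => /orP[/eqP c0|/eqP c1]; [right|left].
  by rewrite cE c0 raddf0.
by rewrite /inb cE c1.
Qed.

Let T : finType := {i : I | `[< inb (r i) >]}.
Let Tb (i : T) : inb (r (val i)). Proof. by apply/asboolP; case: i. Qed.

Let inb_rsim d d' (rG : mx_representation kbar [set: G] d)
    (rG' : mx_representation kbar [set: G] d') : mx_rsim rG rG' -> inb rG -> inb rG'.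
Proof.
have inbE d0 (rG0 : mx_representation kbar [set: G] d0) :
    inb rG0 <-> ext rG0 (push b - 1) = 0.
  rewrite /inb raddfB /= ext1; split=> [->|/eqP]; first by rewrite subrr.
  by rewrite subr_eq0 => /eqP.
by move=> sim /inbE b0; apply/inbE/(ext_rsim (mx_rsim_sym sim)).
Qed.

(** The trace of x on [r i] equals that of b x. Applying [tau] gives the same equality on the twist,
    because b has coefficients in [O]. If b acted as 0 there, all traces of the twist would vanish,
    contradicting [irr_trace_free]. *)
Let twist_inb (i : T) : inb (twist (r (val i))).
Proof.
have [//|e0] := block_dichotomy (Irrep (twist_irr (irmxP (r (val i))))).
have [i' sim] := rP.2 (Irrep (twist_irr (irmxP (r (val i))))).
have tr0 x : \tr (ext (twist (r (val i))) (push x)) = 0.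
  rewrite -chi_tau; have -> : chi (r (val i)) x = chi (r (val i)) (b * x).
    by apply: (fmorph_inj e); rewrite !chiE pushM extM Tb mul1mx.
  by rewrite chi_tau pushM extM e0 mul0mx mxtrace0.
have [a aP] := irr_trace_free rP i'.
have : \tr (ext (r i') a) = 0.
  rewrite /ext raddf_sum big1 // => g _; rewrite /= mxtraceZ.
  rewrite -(mxtrace_rsim sim (in_setT g)) /=.
  by have := tr0 (ga_elt O g); rewrite push_elt ext_elt => ->; rewrite mulr0.
by rewrite aP eqxx => /eqP; rewrite oner_eq0.
Qed.

Let twist_index (i : T) : {i' : T | mx_rsim (twist (r (val i))) (r (val i'))}.
Proof.
have /cid[i' sim] := rP.2 (Irrep (twist_irr (irmxP (r (val i))))).
have hi' : `[< inb (r i') >] by apply/asboolP/(inb_rsim sim)/twist_inb.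
by exists (exist _ i' hi').
Qed.

Let tw (i : T) : T := sval (twist_index i).
Let twP i : mx_rsim (twist (r (val i))) (r (val (tw i))).
Proof. exact: (svalP (twist_index i)). Qed.

Let tw_trace i g : \tr (r (val (tw i)) g) = \tr (r (val i) g) ^+ (p ^ u0).
Proof. by rewrite -(mxtrace_rsim (twP i) (in_setT g)) twist_trace. Qed.

Let tw_inj : injective tw.
Proof.
move=> i i' ei; apply/val_inj/irr_trace_inj => g.
by apply: (fmorph_inj (frobenius char_kb u0)); rewrite !frobeniusE -!tw_trace ei.
Qed.

Let s : {perm T} := perm tw_inj.

Let sX_spectrum l i g : perm_eq (spectrum (r (val ((s ^+ l)%g i)) g))
  [seq x ^+ (p ^ (l * u0)) | x <- spectrum (r (val i) g)].
Proof.
elim: l => [|l IH].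
  rewrite expg0 perm1 mul0n expn0 (eq_map (g := id)) ?map_id // => x.
rewrite expgSr permM permE.
have sim := spectrum_rsim g (mx_rsim_sym (twP ((s ^+ l)%g i))).
apply: (perm_trans sim); rewrite map_reprE.
apply: (perm_trans (spectrum_map _ _)).
apply: (perm_trans (perm_map _ IH)); rewrite -map_comp.
by rewrite (eq_map (g := fun x => x ^+ (p ^ (l.+1 * u0)))) // => x /=;
  rewrite frobeniusE -exprM -expnD mulSn addnC.
Qed.

Let B (i : T) : {ffun p_regular p G -> Kbar} :=
  [ffun g => \sum_(x <- spectrum (r (val i) (val g))) tl x].

Let BP i : is_Brauer_character red (r (val i)) (B i).
Proof. by apply/Brauer_characterP=> g; rewrite ffunE. Qed.

(** Reducing a Brauer character gives the traces on p-regular elements, which determine all traces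
    and hence the simple module. *)
Let B_inj : injective B.
Proof.
move=> i i' eB; apply/val_inj/irr_trace_inj/mxtrace_p_regular => g.
by rewrite -(Brauer_character_red g (BP i)) eB (Brauer_character_red g (BP i')).
Qed.

Let B_IBr phi : IBr p emb red b phi <-> exists i, phi = B i.
Proof.
have sumE d (rG : mx_representation kbar [set: G] d) :
    \sum_(g : G) red (emb (coefg b g)) *: rG g = ext rG (push b).
  by apply: eq_bigr => g _; rewrite coefg_push qE.
split=> [[d [rG [irrG]]]|[i ->]].
  rewrite sumE => bG /Brauer_characterP phiE.
  have [i' sim] := rP.2 (Irrep irrG).
  have hi' : `[< inb (r i') >] by apply/asboolP/(inb_rsim sim).
  exists (exist _ i' hi'); apply/ffunP=> g; rewrite phiE ffunE.
  by apply: perm_big; apply: spectrum_rsim.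
exists (irdim (r (val i))), (r (val i)); split; first exact: irmxP.
  by rewrite sumE Tb.
exact: BP.
Qed.

Let B_galois sigma l i : cyclotomic_automorphism n sigma ->
  power_on_p'_roots p n sigma (l * u0) -> galois_act sigma (B i) = B ((s ^+ l)%g i).
Proof.
move=> cyc pow; apply/ffunP=> g; rewrite !ffunE.
rewrite (cyclotomic_sum _ cyc pow) => [|x]; last exact: spectrum_repr_unity.
by rewrite (perm_big _ (sX_spectrum l i (val g))) big_map.
Qed.

Let enc (c : {ffun T -> 'I_p}) (x : block_algebra hb) : k' :=
  \sum_i (c i)%:R * chi (r (val i)) (val x).

(** The [kbar]-linear counterpart of [enc c] on the whole group algebra, where independence of the
    irreducible characters is available. *)
Let Fhat (c : {ffun T -> 'I_p}) (a : kG) : kbar :=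
  \sum_i (c i)%:R * \tr (ext (r (val i)) a).

Let encE c x : e (enc c x) = Fhat c (push (val x)).
Proof. by rewrite rmorph_sum; apply: eq_bigr => i _; rewrite rmorphM rmorph_nat chiE. Qed.

(** Only positive exponents: the unit of the block algebra is b, not 1. *)
Let val_exp (x : block_algebra hb) l : val (x ^+ l.+1) = val x ^+ l.+1.
Proof. by elim: l => [|l IH]; rewrite ?expr1 // exprS [RHS]exprS -IH. Qed.

Let enc_frobenius c : frobenius_trace p (fun a => in_alg k' (pi a)) (enc c).
Proof.
split=> [x y|a x|x y|x]; apply: (fmorph_inj e).
- rewrite rmorphD !encE pushD -big_split; apply: eq_bigr => i _.
  by rewrite raddfD mxtraceD mulrDr.
- rewrite rmorphM !encE eE pushZ mulr_sumr; apply: eq_bigr => i _.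
  by rewrite linearZ /= mxtraceZ mulrCA.
- rewrite !encE; apply: eq_bigr => i _.
  by rewrite /= !pushM !extM mxtrace_mulC.
have frobE (y : kbar) : y ^+ p = frobenius char_kb 1 y by rewrite frobeniusE expn1.
rewrite rmorphXn !encE frobE rmorph_sum; apply: eq_bigr => i _.
rewrite rmorphM rmorph_nat -frobE; congr (_ * _).
have -> : push (val (x ^+ p)) = push (val x) ^+ p.
  by case: (p) (prime_gt0 p_pr) => // l _; rewrite val_exp pushX.
have := mxtrace_exp_pchar char_kb (ext (r (val i)) (push (val x))) 1.
by rewrite expn1 extX.
Qed.

Let blkP (x : OG) : b * x \in in_block hb.
Proof. by rewrite unfold_in mulrA bb. Qed.
Let blk (x : OG) : block_algebra hb := exist (fun y => y \in in_block hb) (b * x) (blkP x).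

Let blk_val x : blk (val x) = x.
Proof. by apply: val_inj; have := valP x; rewrite unfold_in => /eqP. Qed.
Let blkD x y : blk (x + y) = blk x + blk y.
Proof. by apply: val_inj; rewrite /= mulrDr. Qed.
Let blkZ a x : blk (a *: x) = a *: blk x.
Proof. by apply: val_inj; rewrite /= scalerAr. Qed.
Let blkM x y : blk (x * y) = blk x * blk y.
Proof.
apply: val_inj; rewrite -[LHS]/(b * (x * y)) -[RHS]/((b * x) * (b * y)).
by rewrite [RHS]mulrA -[b * x * b]mulrA -bC !mulrA bb.
Qed.
Let blkX x l : blk (x ^+ l.+1) = blk x ^+ l.+1.
Proof. by elim: l => [|l IH]; rewrite ?expr1 // exprS blkM IH -exprS. Qed.
Let blk_b x : blk (b * x) = blk x.
Proof. by apply: val_inj; rewrite /= mulrA bb. Qed.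

Let Fhat_linear c : linear_for *%R (Fhat c).
Proof.
move=> a x y; rewrite /Fhat mulr_sumr -big_split; apply: eq_bigr => i _.
by rewrite linearP mxtraceD mxtraceZ mulrDr /= mulrCA.
Qed.

Let Fhat_b c a : Fhat c (push b * a) = Fhat c a.
Proof. by apply: eq_bigr => i _; rewrite extM Tb mul1mx. Qed.

Let Fhat_free i : exists a, forall c, Fhat c a = (c i)%:R.
Proof.
have [a aP] := irr_trace_free rP (val i); exists a => c.
rewrite /Fhat (bigD1 i) //= big1 => [|i' ni']; first by rewrite aP eqxx mulr1 addr0.
rewrite aP; case: eqP => [ei|_]; last by rewrite mulr0.
by case/eqP: ni'; apply: val_inj.
Qed.

Let linear_kG (f g : kG -> kbar) : linear_for *%R f -> linear_for *%R g ->
  (forall h, f (ga_elt kbar h) = g (ga_elt kbar h)) -> f =1 g.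
Proof.
move=> lf lg fg a.
have L (f' : kG -> kbar) : linear_for *%R f' ->
    f' a = \sum_h coefg a h * f' (ga_elt kbar h).
  move=> lf'; have f'D x y : f' (x + y) = f' x + f' y.
    by have := lf' 1 x y; rewrite scale1r mul1r.
  have f'0 : f' 0 = 0 by apply: (addrI (f' 0)); rewrite -f'D !addr0.
  rewrite {1}(ga_eltE a) (big_morph f' f'D f'0); apply: eq_bigr => h _.
  by have := lf' (coefg a h) (ga_elt kbar h) 0; rewrite f'0 !addr0.
by rewrite (L f) // (L g) //; apply: eq_bigr => h _; rewrite fg.
Qed.

(** The functions [Fhat c] and [Fhat c'] do not change under multiplication by b, so they agree on
    group elements, hence everywhere; their coefficients are then read off on dual elements. *)
Let enc_inj c c' : enc c =1 enc c' -> c = c'.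
Proof.
move=> ec; have eF : Fhat c =1 Fhat c'.
  apply: linear_kG => // h; rewrite -Fhat_b -[RHS]Fhat_b -push_elt -pushM.
  by rewrite -[b * _]/(val (blk (ga_elt O h))) -!encE ec.
apply/ffunP=> i; have [a aE] := Fhat_free i.
by apply: (natr_inj_ord char_kb); rewrite -!aE eF.
Qed.

(** [tau] fixes the coefficients in F_p and carries the character of i to that of s i; reindexing by
    s produces the inverse. *)
Let enc_tau c : tau \o enc c =1 enc [ffun i => c ((s^-1)%g i)].
Proof.
move=> x; apply: (fmorph_inj e); rewrite encE /Fhat /= !rmorph_sum.
rewrite [RHS](reindex_inj (@perm_inj _ s)); apply: eq_bigr => i _.
rewrite !rmorphM !rmorph_nat ffunE permK chi_tau; congr (_ * _).
rewrite !tr_push; apply: eq_bigr => g _.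
by rewrite (mxtrace_rsim (twP i) (in_setT g)) permE.
Qed.

(** Extend f, through the projection x |-> b x, to a [kbar]-linear function [Fh] on the group
    algebra and decompose [Fh] by [trace_function_irr]. *)
Let enc_onto f : frobenius_trace p (fun a => in_alg k' (pi a)) f ->
  exists c, f =1 enc c.
Proof.
move=> ff; pose Fh (a : kG) : kbar := \sum_g coefg a g * e (f (blk (ga_elt O g))).
have Fh_linear : linear_for *%R Fh.
  move=> a x y; rewrite /Fh mulr_sumr -big_split; apply: eq_bigr => g _.
  by rewrite coefgD coefgZ mulrDl mulrA.
have FhD x y : Fh (x + y) = Fh x + Fh y by have := Fh_linear 1 x y; rewrite scale1r mul1r.
have Fh0 : Fh 0 = 0 by apply: (addrI (Fh 0)); rewrite -FhD !addr0.
have FhZ a x : Fh (a *: x) = a * Fh x by have := Fh_linear a x 0; rewrite Fh0 !addr0.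
have Fh_elt g : Fh (ga_elt kbar g) = e (f (blk (ga_elt O g))).
  rewrite /Fh (bigD1 g) //= big1 => [|h nhg]; first by rewrite coefg_elt eqxx mul1r addr0.
  by rewrite coefg_elt (negPf nhg) mul0r.
have Fh_push x : Fh (push x) = e (f (blk x)).
  rewrite {2}(ga_eltE x) (big_morph blk blkD (_ : blk 0 = 0)); last first.
    by apply: (addrI (blk 0)); rewrite -blkD !addr0.
  rewrite (ftr_sum _ _ ff) rmorph_sum; apply: eq_bigr => g _.
  by rewrite coefg_push blkZ (ftrZ ff) rmorphM eE.
have FhC x y : Fh (x * y) = Fh (y * x).
  have sum2 (x' y' : kG) : Fh (x' * y') =
      \sum_g \sum_h coefg x' g * (coefg y' h * Fh (ga_elt kbar g * ga_elt kbar h)).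
    rewrite {1}(ga_eltE x') mulr_suml (big_morph Fh FhD Fh0); apply: eq_bigr => g _.
    rewrite {1}(ga_eltE y') mulr_sumr (big_morph Fh FhD Fh0); apply: eq_bigr => h _.
    by rewrite -scalerAl FhZ -scalerAr FhZ.
  rewrite !sum2 exchange_big; apply: eq_bigr => h _; apply: eq_bigr => g _.
  by rewrite -!push_elt -!pushM !Fh_push !blkM (ftrC ff) mulrCA.
(* The condition is known only on reductions of elements over [O]. Additivity of p-th powers under
   trace functions reduces the general case to group elements, which are such reductions. *)
have FhX x : Fh (x ^+ p) = Fh x ^+ p.
  rewrite {1}(ga_eltE x) (trace_sum_exp_pchar char_kb _ FhD FhC).
  rewrite [in RHS](ga_eltE x) (big_morph Fh FhD Fh0).
  rewrite -(pFrobenius_autE char_kb) rmorph_sum; apply: eq_bigr => g _.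
  rewrite exprZn !FhZ /= pFrobenius_autE exprMn; congr (_ * _).
  have [l pl] : exists l, p = l.+1 by case: (p) (prime_gt0 p_pr) => // l; exists l.
  rewrite -push_elt.
  by rewrite pl -pushX !Fh_push blkX -pl (ftrX ff) rmorphXn.
have [c cp FhE] := trace_function_irr rP char_kb Fh_linear FhC FhX.
(* [Fh] does not change under multiplication by b, whereas b acts as 0 on a simple module outside
   the block; compare on an element dual to i. *)
have c0 i : ~ inb (r i) -> c i = 0.
  move=> ni; have [//|e0] := block_dichotomy (r i).
  have [a aP] := irr_trace_free rP i.
  have <- : Fh a = c i.
    rewrite FhE (bigD1 i) //= big1 => [|i' ni']; first by rewrite aP eqxx mulr1 addr0.
    by rewrite aP (negPf ni') mulr0.
  have -> : Fh a = Fh (push b * a).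
    move: a {aP}; apply: linear_kG => // [a x y|h].
      by rewrite mulrDr -scalerAr FhD FhZ.
    by rewrite -push_elt -pushM !Fh_push blk_b.
  rewrite FhE big1 // => i' _; rewrite extM.
  have [e1|e0'] := block_dichotomy (r i'); last by rewrite e0' mul0mx mxtrace0 mulr0.
  rewrite e1 mul1mx aP; case: eqP => [ei|]; last by rewrite mulr0.
  by case: ni; rewrite -ei.
pose c' : {ffun T -> 'I_p} := [ffun i => sval (cid (expp_natr char_kb (cp (val i))))].
exists c' => x; apply: (fmorph_inj e); rewrite encE -{1}(blk_val x) -Fh_push FhE.
rewrite (bigID (fun i => `[< inb (r i) >])) /= [X in _ + X]big1 ?addr0 => [|i /asboolP ni].
  rewrite big_sub /=; apply: eq_bigr => i _.
  by rewrite ffunE -(svalP (cid (expp_natr char_kb (cp (val i))))).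
by rewrite c0 ?mul0r.
Qed.

Lemma block_coordinates_exist :
  inhabited (@block_coordinates p n u0 Kbar G (IBr p emb red b) (block_algebra hb) k'
    (@frobenius_trace O p k' (fun a => in_alg k' (pi a)) (block_algebra hb)) tau).
Proof.
split; exact: (BlockCoordinates B_inj B_IBr B_galois enc_frobenius enc_onto enc_inj enc_tau).
Qed.

End BlockCoordinates.

(** * The bijection *)

Section PermutationComparison.
Variables (p n u0 : nat) (Kbar : closedFieldType) (G H : finGroupType) (A B : Type).
Variables (F : fieldType) (tau : {additive F -> F}).
Variables (IBG : set {ffun p_regular p G -> Kbar}) (IBH : set {ffun p_regular p H -> Kbar}).
Variables (VA : (A -> F) -> Prop) (VB : (B -> F) -> Prop).
Variables (cG : block_coordinates n u0 IBG VA tau) (cH : block_coordinates n u0 IBH VB tau).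

(** In coordinates [T] becomes an injection [beta] of F_p-valued functions that commutes with the
    shifts induced by [tau], so it maps invariants to invariants. *)
Lemma card_invariants_leq (T : (A -> F) -> B -> F) (S : (B -> F) -> A -> F) d :
  (forall f, VA f -> VB (T f) /\ S (T f) =1 f) ->
  (forall f, T (tau \o f) =1 tau \o T f) ->
  (#|perm_invariants 'I_p (bc_perm cG ^+ d)%g|
     <= #|perm_invariants 'I_p (bc_perm cH ^+ d)%g|)%N.
Proof.
move=> TS Ttau.
have exb c : exists c', T (bc_trace cG c) = bc_trace cH c'.
  have [VT _] := TS _ (bc_traceP cG c).
  by have [c' e] := bc_trace_onto cH _ VT; exists c'; apply/funext.
pose beta c := sval (cid (exb c)).
have betaE c : T (bc_trace cG c) = bc_trace cH (beta c) by apply: svalP (cid (exb c)).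
have beta_inj : injective beta.
  move=> c c' e; apply: (bc_trace_inj cG) => x.
  have [_ <-] := TS _ (bc_traceP cG c); have [_ <-] := TS _ (bc_traceP cG c').
  by rewrite !betaE e.
pose shG (c : {ffun _ -> 'I_p}) : {ffun _ -> 'I_p} := [ffun i => c ((bc_perm cG)^-1%g i)].
pose shH (c : {ffun _ -> 'I_p}) : {ffun _ -> 'I_p} := [ffun i => c ((bc_perm cH)^-1%g i)].
have betash c : beta (shG c) = shH (beta c).
  apply: (bc_trace_inj cH) => x.
  have -> : bc_trace cH (shH (beta c)) x = tau (bc_trace cH (beta c) x).
    by rewrite -[RHS]/((tau \o bc_trace cH (beta c)) x) bc_trace_tau.
  rewrite -!betaE -[RHS](Ttau (bc_trace cG c) x).
  by congr (T _ x); apply/funext=> y; rewrite -[LHS]bc_trace_tau.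
(* Invariance under s^d is restated as being fixed by the d-th iterate of the shift, the form in
   which [beta] transports it. *)
have inv (X : finType) (s : {perm X}) (c : {ffun X -> 'I_p}) :
    (c \in perm_invariants 'I_p (s ^+ d)%g) =
    (iter d (fun c : {ffun X -> 'I_p} => [ffun i => c (s^-1%g i)] : {ffun X -> 'I_p}) c == c).
  have iterE l i :
      iter l (fun c : {ffun X -> 'I_p} => [ffun i => c (s^-1%g i)] : {ffun X -> 'I_p}) c i
      = c ((s ^- l)%g i).
    elim: l i => [|l IH] i; first by rewrite expg0 invg1 perm1.
    by rewrite /= ffunE IH expgSr invMg permM.
  rewrite inE; apply/forallP/eqP => [ci|ci i].
    by apply/ffunP=> i; rewrite iterE -{2}(permKV (s ^+ d)%g i) (eqP (ci _)).
  by rewrite -{1}ci iterE permK.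
rewrite -(card_imset _ beta_inj); apply/subset_leq_card/fintype.subsetP=> _ /imsetP[c cinv ->].
move: cinv; rewrite !inv => /eqP cinv; apply/eqP; rewrite -{2}cinv.
by elim: (d) => //= l ->; rewrite betash.
Qed.
End PermutationComparison.

(** * Exponents u for which the p^u-th power map on roots of unity comes from the Galois group *)

Section ExponentGroup.
Variables (p m : nat) (k : fieldType) (L : splittingFieldType k).
Hypothesis m_neq0 : m%:R != 0 :> k.
Hypothesis p_coprime : coprime m p.

Definition galois_power (u : nat) (tau : gal_of {: L}) : Prop :=
  tau \in 'Gal({: L} / 1)%g /\ forall eta : L, eta ^+ m = 1 -> tau eta = eta ^+ (p ^ u).

(** The set of realised exponents is closed under differences u' - u with u <= u', so Euclidean
    descent shows that its least positive element divides all of them. *)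
Lemma galois_power_generator :
  exists u0 tau0, galois_power u0 tau0 /\
    forall u tau, galois_power u tau -> exists l, u = (l * u0)%N.
Proof.
have m_gt0 : (0 < m)%N by case: (m) m_neq0 => //; rewrite eqxx.
have ex : exists u, (0 < u)%N && `[< exists tau, galois_power u tau >].
  (* By Euler's theorem the identity automorphism realises the exponent [totient m], so a positive
     exponent exists. *)
  exists (totient m); rewrite totient_gt0 m_gt0; apply/asboolP.
  exists 1%g; split=> [|eta etam]; first exact: group1.
  rewrite gal_id -(expr_mod _ etam) Euler_exp_totient 1?coprime_sym //.
  by rewrite expr_mod.
have sub u u' tau tau' : galois_power u tau -> galois_power u' tau' -> (u <= u')%N ->
    exists tau'', galois_power (u' - u) tau''.
  move=> [tauG tauE] [tau'G tau'E] uu'; exists (tau^-1 * tau')%g; split=> [|eta etam].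
    by rewrite groupM ?groupV.
  have etaE : tau ((tau^-1)%g eta) = eta.
    by rewrite -galM ?memvf // mulVg gal_id.
  have etam' : (tau^-1)%g eta ^+ m = 1.
    by apply: (fmorph_inj tau); rewrite rmorphXn /= etaE etam rmorph1.
  rewrite galM ?memvf // tau'E // -(subnK uu') addnC expnD exprM -tauE //.
  by rewrite etaE addKn.
case: (ex_minnP ex) => u0 /andP[u0_gt0 /asboolP[tau0 h0]] min_u0.
exists u0, tau0; split=> // u tau.
elim/ltn_ind: u tau => u IH tau hu.
case: (ltnP u u0) => [lt_uu0|le_u0u].
  exists 0%N; apply/eqP; rewrite mul0n -leqn0 leqNgt; apply/negP=> u_gt0.
  have := min_u0 u; rewrite u_gt0 leqNgt lt_uu0 => /(_ _)/negP; apply=> //.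
  by apply/asboolP; exists tau.
have [tau'' h''] := sub _ _ _ _ h0 hu le_u0u.
have lt_u : (u - u0 < u)%N by rewrite ltn_subrL u0_gt0 (leq_trans u0_gt0).
have [l el] := IH _ lt_u _ h''.
by exists l.+1; rewrite mulSn -el subnKC.
Qed.
End ExponentGroup.

Theorem theorem1 (p : nat) (O : idomainType) (K k : fieldType)
    (iota : {rmorphism O -> K}) (pi : {rmorphism O -> k})
    (Kbar kbar : closedFieldType) (j : {rmorphism K -> Kbar})
    (red : Kbar -> kbar)
    (G H : finGroupType) (n : nat) (k' : splittingFieldType k)
    (b : group_algebra O G) (c : group_algebra O H)
    (hb : block_idempotent b) (hc : block_idempotent c)
    (X : virtual_bimodule (block_algebra hb) (block_algebra hc)) :
  prime p ->
  p_modular_system p iota pi ->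
  perfect_field p k ->
  algebraic_closure j ->
  reduction (j \o iota) red ->
  (0 < n)%N -> (#|G| %| n)%N -> (#|H| %| n)%N ->
  splittingFieldFor 1 ('X^(n`_p^') - 1 : {poly k'}) fullv ->
  generates_jacobson (p%:R : O) ->
  virtual_Morita X (virtual_dual X) ->
  exists I : {ffun p_regular p G -> Kbar} -> {ffun p_regular p H -> Kbar},
    set_bij (IBr p (j \o iota) red b) (IBr p (j \o iota) red c) I /\
    forall (phi : {ffun p_regular p G -> Kbar}) (sigma : Kbar -> Kbar),
      IBr p (j \o iota) red b phi -> H_nk p n k' sigma ->
      galois_act sigma (I phi) = I (galois_act sigma phi).
Proof.
move=> p_pr pmsP _ _ redP n_gt0 G_dvd H_dvd splitP p_gen morita.
have charF : p \in [pchar k'].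
  by have := pms_charp pmsP; rewrite -(fmorph_pchar (in_alg k')).
have p_coprime : coprime n`_p^' p.
  by apply: (pnat_coprime (pi := p^')); rewrite ?part_pnat // pnatNK pnat_id.
have m_neq0 : (n`_p^')%:R != 0 :> k.
  by apply: p'_neq0 (pms_charp pmsP) _; rewrite -prime_coprime // coprime_sym.
have [q qE] := residue_embedding p_pr pmsP redP p_gen.
have [e eE] := closed_embedding m_neq0 splitP q.
have [u0 [tau0 [[tau0G tau0E] genu]]] := galois_power_generator k' m_neq0 p_coprime.
have tau0_alg x : tau0 (in_alg k' x) = in_alg k' x.
  by rewrite (fixed_gal _ tau0G) ?subvf // rpredZ ?mem1v.
have coords (G0 : finGroupType) (b0 : group_algebra O G0) (hb0 : block_idempotent b0) :
    (#|G0| %| n)%N -> inhabited (@block_coordinates p n u0 Kbar G0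
      (IBr p (j \o iota) red b0) (block_algebra hb0) k'
      (@frobenius_trace O p k' (fun a => in_alg k' (pi a)) (block_algebra hb0)) tau0).
  move=> dvd0; have [I [r rP]] := irr_family_exists kbar G0.
  exact: (block_coordinates_exist p_pr pmsP redP p_gen n_gt0 splitP qE eE tau0_alg tau0E dvd0 rP).
have [cG] := coords G b hb G_dvd; have [cH] := coords H c hc H_dvd.
have [T [S [TS ST Ttau Stau]]] := virtual_Morita_transfer (fun a => in_alg k' (pi a)) charF morita.
(* The two inequalities equate p^(number of cycles) on both sides, and p > 1. *)
have card_porb d : #|porbits (bc_perm cG ^+ d)%g| = #|porbits (bc_perm cH ^+ d)%g|.
  have le1 := card_invariants_leq cG cH d TS (Ttau tau0).
  have le2 := card_invariants_leq cH cG d ST (Stau tau0).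
  have /eqP : #|perm_invariants 'I_p (bc_perm cG ^+ d)%g|
            = #|perm_invariants 'I_p (bc_perm cH ^+ d)%g|.
    by apply/eqP; rewrite eqn_leq le1.
  by rewrite !card_perm_invariants card_ord eqn_exp2l ?prime_gt1 // => /eqP.
have [g bijg gE] := perm_conjugate card_porb.
have gX l i : g ((bc_perm cG ^+ l)%g i) = (bc_perm cH ^+ l)%g (g i).
  by elim: l => [|l IH]; rewrite ?expg0 ?perm1 // !expgSr !permM gE IH.
have [I IE] : exists I : {ffun p_regular p G -> Kbar} -> {ffun p_regular p H -> Kbar},
    forall i, I (bc_char cG i) = bc_char cH (g i).
  (* The value 0 outside IBr(G,b) is an arbitrary default. *)
  exists (fun phi => match pselect (exists i, phi = bc_char cG i) with
    | left h => bc_char cH (g (sval (cid h))) | right _ => 0 end) => i.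
  case: pselect => [h|[]]; last by exists i.
  by case: (cid h) => i' /= /(bc_char_inj cG) ->.
exists I; split; first split.
- by move=> phi /(bc_charP cG)[i ->]; rewrite IE; apply/(bc_charP cH); exists (g i).
- move=> phi psi /set_mem/(bc_charP cG)[i ->] /set_mem/(bc_charP cG)[i' ->].
  by rewrite !IE => /(bc_char_inj cH)/(bij_inj bijg) ->.
- move=> psi /(bc_charP cH)[i ->]; have [g' _ gK] := bijg.
  exists (bc_char cG (g' i)); last by rewrite IE gK.
  by apply/(bc_charP cG); exists (g' i).
move=> phi sigma /(bc_charP cG)[i ->] [[cyc _] [u [tau [tauG pow tauE]]]].
(* [sigma] acts on both sets of Brauer characters as the l-th power of the respective permutation,
   and [g] intertwines these powers. *)
have [l el] := genu u tau (conj tauG tauE); rewrite el in pow.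
by rewrite IE (bc_galois cG _ l) // (bc_galois cH _ l) // IE gX.
Qed.
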